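(* Let $T>0$, $\gamma>0$, $p>2\vee\frac{2}{\gamma}$, and let $X_0\in L^p(\Omega,\mathcal{F}_0,P)$ be $\mathbb{R}^d$-valued. Let $b:\mathbb{R}_+\times\mathbb{R}_+\times\mathbb{R}^d\times\mathcal{P}_2(\mathbb{R}^d)\to\mathbb{R}^d$ and $\sigma:\mathbb{R}_+\times\mathbb{R}_+\times\mathbb{R}^d\times\mathcal{P}_2(\mathbb{R}^d)\to\mathbb{R}^{d\times m}$ be Borel measurable. Assume there are positive functions $K_1,K_2,K_3,K_4\in\mathcal{K}$ and a constant $C_T$ such that: (i) for $i\in\{1,3\}$, $j\in\{2,4\}$ and all $0\le t\le t'\le T$, $$\int_0^t|K_i(t',s)-K_i(t,s)|\,ds\le C_T|t-t'|^{\gamma},\qquad \int_0^t|K_j(t',s)-K_j(t,s)|^2\,ds\le C_T|t-t'|^{2\gamma},$$ $$\int_t^{t'}|K_i(t',s)|^2\,ds\le C_T|t-t'|^{2\gamma},\qquad \int_t^{t'}|K_j(t',s)|^2\,ds\le C_T|t-t'|^{2\gamma};$$ (ii) for all $0\le s\le t\le T$, $x,y\in\mathbb{R}^d$, $\mu,\nu\in\mathcal{P}_2(\mathbb{R}^d)$, $$|b(t,s,x,\mu)-b(t,s,y,\nu)|\le K_1(t,s)\big(|x-y|+\mathbb{W}_2(\mu,\nu)\big),$$ $$\|\sigma(t,s,x,\mu)-\sigma(t,s,y,\nu)\|^2\le K_2(t,s)\big(|x-y|^2+\mathbb{W}_2^2(\mu,\nu)\big);$$ (iii) for all $0\le s\le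 t\le T$, $x\in\mathbb{R}^d$, $\mu\in\mathcal{P}_2(\mathbb{R}^d)$, $$|b(t,s,x,\mu)|\le K_3(t,s)\big(1+|x|+\mathbb{W}_2(\mu,\delta_0)\big),\qquad \|\sigma(t,s,x,\mu)\|^2\le K_4(t,s)\big(1+|x|^2+\mathbb{W}_2^2(\mu,\delta_0)\big);$$ (iv) there are positive functions $F_1,F_2$ on $[0,T]^3$ such that for all $t,t',s\in[0,T]$, $x\in\mathbb{R}^d$, $\mu\in\mathcal{P}_2(\mathbb{R}^d)$, $$|b(t',s,x,\mu)-b(t,s,x,\mu)|\le F_1(t',t,s)\big(1+|x|+\mathbb{W}_2(\mu,\delta_0)\big),$$ $$\|\sigma(t',s,x,\mu)-\sigma(t,s,x,\mu)\|^2\le F_2(t',t,s)\big(1+|x|^2+\mathbb{W}_2^2(\mu,\delta_0)\big),$$ and $$\int_0^tF_1(t',t,s)\,ds\le C_T|t-t'|^{\gamma},\qquad\int_0^tF_2(t',t,s)\,ds\le C_T|t-t'|^{2\gamma}.$$ Let $X$ be the solution on $[0,T]$ of $$X_t=X_0+\int_0^t b(t,s,X_s,\mathcal{L}_{X_s})\,ds+\int_0^t\sigma(t,s,X_s,\mathcal{L}_{X_s})\,dW_s .$$ Then for any $\delta\in[0,\frac{\gamma}{2}-\frac1p)$, $t\mapsto X_t$ admits a $\delta$-order Hölder continuous modification on $[0,T]$.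
   Context: $(\Omega,\mathcal{F},(\mathcal{F}_t)_{t\ge0},P)$ is a complete filtered probability space satisfying the usual conditions and $W$ is an $m$-dimensional standard $(\mathcal{F}_t)$-Brownian motion. $\mathcal{L}_{Y}$ denotes the law of a random variable $Y$, and $\delta_0$ is the Dirac measure at $0$. $\mathcal{P}_2(\mathbb{R}^d)$ is the set of probability measures on $\mathbb{R}^d$ with finite second moment, with the 2-Wasserstein distance $\mathbb{W}_2$. $\Delta=\{(t,s)\in\mathbb{R}_+\times\mathbb{R}_+: s\le t\}$. $\mathcal{K}$ is the set of measurable functions $K:\Delta\to\mathbb{R}_+$ such that for every $T>0$: $t\mapsto\int_0^tK(t,s)\,ds$ belongs to $L^\infty(0,T)$, and $\limsup_{\varepsilon\downarrow0}\big\|\int_{\cdot}^{\cdot+\varepsilon}K(\cdot+\varepsilon,s)\,ds\big\|_{L^\infty(0,T)}<1$. ''The solution'' is the measurable $(\mathcal{F}_t)$-adapted process satisfying the equation and the moment bound $E|X_t|^p\le C_{p,T}(E|X_0|^p+1)$ on $[0,T]$. *)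

(* Defs.v *)
From HB Require Import structures.
From mathcomp Require Import all_boot all_order all_algebra.
From mathcomp Require Import all_classical all_reals all_analysis.
From mathcomp Require Import measurable_realfun.

Set Implicit Arguments.
Unset Strict Implicit.
Unset Printing Implicit Defensive.

Import Order.TTheory GRing.Theory Num.Theory.
Import numFieldNormedType.Exports.

Local Open Scope classical_set_scope.
Local Open Scope ring_scope.

(** [R^d] is the type ['cV[R]_d] of column vectors. The topology of
    MathComp-Analysis on matrices is the usual one, so that the following is
    the Borel sigma-algebra. *)

HB.instance Definition _ (R : realType) (d m : nat) :=
  @isMeasurable.Build (sigma_display (@open 'M[R]_(d, m))) 'M[R]_(d, m)
    (@measurable _ (g_sigma_algebraType (@open 'M[R]_(d, m))))
    (@measurable0 _ (g_sigma_algebraType (@open 'M[R]_(d, m))))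
    (@measurableC _ (g_sigma_algebraType (@open 'M[R]_(d, m))))
    (@bigcupT_measurable _ (g_sigma_algebraType (@open 'M[R]_(d, m)))).

(** The Hilbert-Schmidt norm of a matrix, which is the Euclidean norm on
    ['cV[R]_d]. MathComp-Analysis' own norm on matrices is the sup norm. *)
Definition hsnorm (R : realType) (d m : nat) (A : 'M[R]_(d, m)) : R :=
  Num.sqrt (\sum_(i < d) \sum_(j < m) A i j ^+ 2).

Lemma hsnorm0 (R : realType) (d m : nat) : hsnorm (0 : 'M[R]_(d, m)) = 0.
Proof.
by rewrite /hsnorm big1 ?sqrtr0// => i _; rewrite big1// => j _; rewrite mxE expr0n.
Qed.

Lemma measurable_coord (R : realType) (d m : nat) (i : 'I_d) (j : 'I_m) :
  measurable_fun [set: 'M[R]_(d, m)] (fun A : 'M[R]_(d, m) => A i j).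
Proof.
apply: (measurability _ (RGenOpens.measurableE R)).
move=> _ [_ [a [c ->]] <-]; rewrite setTI; apply: sub_sigma_algebra.
apply: open_comp; last exact: interval_open.
by move=> A _; exact: coord_continuous.
Qed.

Lemma measurable_hsnorm (R : realType) (d m : nat) :
  measurable_fun [set: 'M[R]_(d, m)] (@hsnorm R d m).
Proof.
apply: (measurableT_comp (continuous_measurable_fun (@sqrt_continuous R))).
apply: measurable_sum => i; apply: measurable_sum => j.
by apply: measurable_funX; exact: measurable_coord.
Qed.

Definition coupling (R : realType) (d : nat) (mu nu : probability 'cV[R]_d R) :
    set (probability ('cV[R]_d * 'cV[R]_d)%type R) :=
  [set pi | forall A : set 'cV[R]_d, measurable A ->
     pi (A `*` setT) = mu A /\ pi (setT `*` A) = nu A].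

Definition second_moment (R : realType) (d : nat) (mu : probability 'cV[R]_d R)
    : \bar R :=
  (\int[mu]_x (hsnorm x ^+ 2)%:E)%E.

Definition P2 (R : realType) (d : nat) : Type :=
  {mu : probability 'cV[R]_d R | (second_moment mu < +oo)%E}.

Lemma second_moment_dirac0 (R : realType) (d : nat) :
  (second_moment (dirac (0%R : 'cV[R]_d) : probability 'cV[R]_d R) < +oo)%E.
Proof.
rewrite /second_moment integral_dirac//=.
  by rewrite diracT mul1e hsnorm0 ltry.
apply/measurable_EFinP; apply: measurable_funX; exact: measurable_hsnorm.
Qed.

Definition delta0 (R : realType) (d : nat) : P2 R d :=
  exist _ (dirac (0 : 'cV[R]_d) : probability 'cV[R]_d R)
    (second_moment_dirac0 R d).

(** The 2-Wasserstein distance. The infimum is finite on [P2 R d], so [fine]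
    loses nothing. *)
Definition W2 (R : realType) (d : nat) (mu nu : P2 R d) : R :=
  Num.sqrt (fine (ereal_inf
    [set (\int[pi]_z (hsnorm (z.1 - z.2) ^+ 2)%:E)%E
      | pi in coupling (sval mu) (sval nu)])).

Definition W2_open (R : realType) (d : nat) : set (set (P2 R d)) :=
  [set U | forall mu, U mu ->
     exists2 e : R, 0 < e & forall nu, W2 mu nu < e -> U nu].

HB.instance Definition _ (R : realType) (d : nat) := Choice.on (P2 R d).
HB.instance Definition _ (R : realType) (d : nat) :=
  isPointed.Build (P2 R d) (delta0 R d).

HB.instance Definition _ (R : realType) (d : nat) :=
  @isMeasurable.Build (sigma_display (@W2_open R d)) (P2 R d)
    (@measurable _ (g_sigma_algebraType (@W2_open R d)))
    (@measurable0 _ (g_sigma_algebraType (@W2_open R d)))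
    (@measurableC _ (g_sigma_algebraType (@W2_open R d)))
    (@bigcupT_measurable _ (g_sigma_algebraType (@W2_open R d))).

Definition is_law (disp : measure_display) (Omega : measurableType disp)
    (R : realType) (P : probability Omega R) (d : nat) (Y : Omega -> 'cV[R]_d)
    (mu : P2 R d) : Prop :=
  forall A : set 'cV[R]_d, measurable A -> sval mu A = pushforward P Y A.

Section volterra_kernels.
Context {R : realType}.
Implicit Types (K : R -> R -> R) (T C gamma : R).
Local Notation leb := (@lebesgue_measure R).

Definition Delta : set (R * R) := [set z | 0 <= z.2 /\ z.2 <= z.1].

Definition Linfty_norm T (f : R -> \bar R) : \bar R :=
  Lnorm (mrestr leb (measurable_itv `]0, T[)) +oo%E f.

Record kernel_class K : Prop := KernelClass {
  kernel_measurable : measurable_fun Delta (fun z : R * R => K z.1 z.2) ;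
  kernel_ge0 : forall t s : R, 0 <= s -> s <= t -> 0 <= K t s ;
  kernel_bounded : forall T : R, 0 < T ->
    (Linfty_norm T (fun t => \int[leb]_(s in `[0%R, t]) (K t s)%:E) < +oo)%E ;
  kernel_limsup : forall T : R, 0 < T ->
    (limf_esup (fun eps : R =>
       Linfty_norm T (fun t =>
         \int[leb]_(s in `[t, (t + eps)%R]) (K (t + eps)%R s)%:E))
       (0 : R)^'+ < 1)%E }.

(** The two regularity conditions differ only in their first inequality:
    absolute value for the drift, square for the diffusion. *)
Definition drift_kernel_regular T C gamma K : Prop :=
  forall t t' : R, 0 <= t -> t <= t' -> t' <= T ->
    (\int[leb]_(s in `[0%R, t]) (`|K t' s - K t s|)%:E
       <= (C * `|t - t'| `^ gamma)%:E)%E /\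
    (\int[leb]_(s in `[t, t']) (`|K t' s| ^+ 2)%:E
       <= (C * `|t - t'| `^ (2 * gamma))%:E)%E.

Definition diffusion_kernel_regular T C gamma K : Prop :=
  forall t t' : R, 0 <= t -> t <= t' -> t' <= T ->
    (\int[leb]_(s in `[0%R, t]) (`|K t' s - K t s| ^+ 2)%:E
       <= (C * `|t - t'| `^ (2 * gamma))%:E)%E /\
    (\int[leb]_(s in `[t, t']) (`|K t' s| ^+ 2)%:E
       <= (C * `|t - t'| `^ (2 * gamma))%:E)%E.

End volterra_kernels.

(** Time-indexed objects below are functions on all of [R]; only their values
    at nonnegative times matter. *)

Section stochastic_basis.
Context {disp : measure_display} {Omega : measurableType disp} {R : realType}.
Implicit Types (P : probability Omega R) (F : R -> set (set Omega)).

Definition measurable_wrt (disp' : measure_display) (E : measurableType disp')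
    (G : set (set Omega)) (Y : Omega -> E) : Prop :=
  forall B : set E, measurable B -> G (Y @^-1` B).

Record usual_filtration P F : Prop := UsualFiltration {
  filtration_sigma_algebra : forall t : R, 0 <= t -> sigma_algebra setT (F t) ;
  filtration_sub : forall t : R, 0 <= t -> F t `<=` measurable ;
  filtration_nondecreasing : forall s t : R, 0 <= s -> s <= t -> F s `<=` F t ;
  filtration_right_continuous : forall t : R, 0 <= t ->
    \bigcap_(u in [set u | t < u]) F u `<=` F t ;
  filtration_complete : P.-negligible `<=` F 0 }.

Record brownian_motion P F (m : nat) (W : R -> Omega -> 'cV[R]_m) : Prop :=
BrownianMotion {
  bm_adapted : forall t : R, 0 <= t -> measurable_wrt (F t) (W t) ;
  bm_start : {ae P, forall w, W 0 w = 0} ;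
  bm_continuous :
    {ae P, forall w, {within `[0, +oo[, continuous (fun t => W t w)}} ;
  bm_independent_increments : forall s t : R, 0 <= s -> s <= t ->
    forall (A : set Omega) (B : set 'cV[R]_m), F s A -> measurable B ->
      let D := [set w | B (W t w - W s w)] in
      P (A `&` D) = (P A * P D)%E ;
  (* the increment has law N(0, (t - s) I_m); [normal_prob] takes the standard
     deviation *)
  bm_gaussian_increments : forall s t : R, 0 <= s -> s < t ->
    forall B : 'I_m -> set R, (forall i, measurable (B i)) ->
      P [set w | forall i, B i ((W t w - W s w) i 0)] =
      (\prod_(i < m) normal_prob 0%R (Num.sqrt (t - s)) (B i))%E }.

(** The simple process
    [sum_(i < sp_size) sp_coef i * 1_(sp_time i, sp_time (i + 1)]]. *)
Record simple_process F (d m : nat) := SimpleProcess {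
  sp_size : nat ;
  sp_time : nat -> R ;
  sp_coef : nat -> Omega -> 'M[R]_(d, m) ;
  sp_time_ge0 : 0 <= sp_time 0 ;
  sp_time_nondecreasing : {homo sp_time : i j / (i <= j)%N >-> i <= j} ;
  sp_coef_adapted : forall i, (i < sp_size)%N ->
    measurable_wrt (F (sp_time i)) (sp_coef i) ;
  sp_coef_bounded : exists M : R, forall i w, (i < sp_size)%N ->
    hsnorm (sp_coef i w) <= M }.

Definition simple_value F (d m : nat) (S : simple_process F d m)
    (s : R) (w : Omega) : 'M[R]_(d, m) :=
  \sum_(i < sp_size S)
    \1_(`]sp_time S i, sp_time S i.+1]%classic) s *: sp_coef S i w.

Definition simple_integral F (d m : nat) (W : R -> Omega -> 'cV[R]_m)
    (S : simple_process F d m) (t : R) (w : Omega) : 'cV[R]_d :=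
  \sum_(i < sp_size S)
    sp_coef S i w *m (W (Num.min (sp_time S i.+1) t) w -
                      W (Num.min (sp_time S i) t) w).

(** [I] is a version of the Ito integral of the square-integrable integrand [H]
    over [[0, t]], that is, the [L^2]-limit of the integrals of simple processes
    that approximate [H]. By the Ito isometry the limit does not depend on the
    approximating sequence. *)
Record ito_integral P F (d m : nat) (W : R -> Omega -> 'cV[R]_m)
    (H : R -> Omega -> 'M[R]_(d, m)) (t : R) (I : Omega -> 'cV[R]_d) : Prop :=
ItoIntegral {
  ito_integrand_measurable :
    measurable_fun (`[0, t] `*` setT) (fun z : R * Omega => H z.1 z.2) ;
  ito_integrand_adapted : forall s : R, 0 <= s -> s <= t ->
    measurable_wrt (F s) (H s) ;
  ito_integrand_L2 :
    (\int[P]_w \int[lebesgue_measure]_(s in `[0%R, t])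
       (hsnorm (H s w) ^+ 2)%:E < +oo)%E ;
  ito_measurable : measurable_fun setT I ;
  ito_limit : exists S : nat -> simple_process F d m,
    ((fun n => \int[P]_w \int[lebesgue_measure]_(s in `[0%R, t])
       (hsnorm (simple_value (S n) s w - H s w) ^+ 2)%:E)%E @ \oo --> 0%E) /\
    ((fun n => \int[P]_w
       (hsnorm (simple_integral W (S n) t w - I w) ^+ 2)%:E)%E
       @ \oo --> 0%E) }.

(** [X] solves, on [[0, T]],
    [X_t = X_0 + int_0^t b(t, s, X_s, L_s) ds
               + int_0^t sigma(t, s, X_s, L_s) dW_s]
    where [L_s] is the law of [X_s]; it has bounded [p]-th moments. *)
Record volterra_solution P F (d m : nat) (W : R -> Omega -> 'cV[R]_m) (T p : R)
    (b : R -> R -> 'cV[R]_d -> P2 R d -> 'cV[R]_d)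
    (sigma : R -> R -> 'cV[R]_d -> P2 R d -> 'M[R]_(d, m))
    (X0 : Omega -> 'cV[R]_d) (X : R -> Omega -> 'cV[R]_d) (L : R -> P2 R d)
    : Prop :=
VolterraSolution {
  solution_measurable :
    measurable_fun (`[0, T] `*` setT) (fun z : R * Omega => X z.1 z.2) ;
  solution_adapted : forall t : R, 0 <= t -> t <= T -> measurable_wrt (F t) (X t) ;
  solution_law : forall t : R, 0 <= t -> t <= T -> is_law P (X t) (L t) ;
  solution_drift_integrable : forall t : R, 0 <= t -> t <= T ->
    {ae P, forall w, forall i, lebesgue_measure.-integrable `[0, t]
      (fun s => (b t s (X s w) (L s) i 0)%:E)} ;
  solution_equation : forall t : R, 0 <= t -> t <= T ->
    exists2 I : Omega -> 'cV[R]_d,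
      ito_integral P F W (fun s w => sigma t s (X s w) (L s)) t I &
      {ae P, forall w, X t w =
         X0 w
         + (\col_i Rintegral lebesgue_measure `[0, t]
                      (fun s => b t s (X s w) (L s) i 0))
         + I w} ;
  solution_moment : exists C : R, forall t : R, 0 <= t -> t <= T ->
    ('E_P[fun w => (hsnorm (X t w) `^ p)%R] <=
     C%:E * ('E_P[fun w => (hsnorm (X0 w) `^ p)%R] + 1))%E }.

Definition modification P (d : nat) (T : R) (X Y : R -> Omega -> 'cV[R]_d)
    : Prop :=
  forall t : R, 0 <= t -> t <= T ->
    measurable_fun setT (Y t) /\ {ae P, forall w, Y t w = X t w}.

End stochastic_basis.

(** For [delta = 0] the inequality alone would only say that [f] is bounded;
    continuity is automatic when [delta > 0]. *)
Definition holder_continuous (R : realType) (d : nat) (delta T : R)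
    (f : R -> 'cV[R]_d) : Prop :=
  {within `[0, T], continuous f} /\
  exists C : R, forall s t : R, 0 <= s -> s <= T -> 0 <= t -> t <= T ->
    hsnorm (f t - f s) <= C * `|t - s| `^ delta.

(* Main.v *)
(** The Burkholder-Davis-Gundy inequality is replaced by a one-step estimate: if
    [E[M |M|^(p-2) D] = 0], [E|M|^p <= a^(p/2)] and [E|D|^p <= v^(p/2)], then
    [E|M + D|^p <= (a + k v)^(p/2)]. Induction along a grid gives
    [E|int V dW|^p <= (k int (E|V_s|^p)^(2/p) ds)^(p/2)] for elementary [V], and
    truncation and [L^2] limits carry this over to Ito integrals. Between the
    times [t <= t'], the change of the drift integrand and the squared change of
    the diffusion integrand are dominated by a kernel, which is [F_i(t', t, s)]
    for [s <= t] and [K_j(t', s)] for [s > t], times a weight, respectively its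
    square; the weight has bounded [p]-th moments. The integral of this kernel is
    [O((t' - t)^gamma)], hence [E|X_t' - X_t|^p <= c (t' - t)^(gamma p / 2)], and
    Kolmogorov's criterion concludes. *)

Require Import Defs.
From mathcomp Require Import all_boot all_order all_algebra.
From mathcomp Require Import all_classical all_reals all_analysis.
From mathcomp Require Import measurable_realfun.
From mathcomp Require Import ring lra.

Set Implicit Arguments.
Unset Strict Implicit.
Unset Printing Implicit Defensive.

Import Order.TTheory GRing.Theory Num.Theory.
Import numFieldNormedType.Exports.

Local Open Scope classical_set_scope.
Local Open Scope ring_scope.

(** * Inequalities between powers *)

(** The approximations in [ito_integral] converge in [L^2] only, so nothing bounds the [p]-th
    moments of the approximating integrands [V] by those of the limit [D]. Truncation at a level [N]
    repairs this: [clamp N] is bounded and 1-Lipschitz, hence [|clamp N V - clamp N D|^p <=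
    (2N)^(p-2) |V - D|^2], which tends to [0] in mean for fixed [N]. The order of choice matters:
    first [N], from the [L^2] tail of [D], then the index of the approximation, which depends on
    [N]. Moment bounds are kept in the form [E|M|^p <= a^(p/2)] because [a], a bound for the squared
    [L^p] norm, grows by [k v] in one step. A sum over a grid thus costs no constant that depends on
    the number of cells. The cross term vanishes because a Brownian increment is symmetric and
    independent of the past. The range of [delta] is what Kolmogorov's criterion yields from the
    exponent [gamma p / 2], since [(gamma p / 2 - 1) / p = gamma / 2 - 1 / p]. *)

Section powR_inequalities.
Context {R : realType}.
Implicit Types (x y a v p q u e : R).

Lemma ler_powRD x y p : 0 <= p ->
  `|x + y| `^ p <= 2 `^ p * (`|x| `^ p + `|y| `^ p).
Proof.
move=> p0; pose m := Num.max `|x| `|y|.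
have m0 : 0 <= m by rewrite le_max normr_ge0.
have xym : `|x + y| <= 2 * m.
  rewrite (le_trans (ler_normD _ _))// mulr_natl mulr2n lerD// /m le_max lexx//.
  by rewrite orbT.
apply: (@le_trans _ _ ((2 * m) `^ p)).
  by apply: ge0_ler_powR; rewrite ?nnegrE ?mulr_ge0.
rewrite powRM// ler_wpM2l ?powR_ge0// /m.
by case: (leP `|x| `|y|) => _; rewrite ?lerDl ?lerDr ?powR_ge0.
Qed.

(** The constant is crude but depends on [p] and [n] only; [n] will be the dimension of the Brownian
    motion. *)
Lemma ler_powR_sum (n : nat) (f : 'I_n -> R) p : 0 < p ->
  `|\sum_(i < n) f i| `^ p <= (2 `^ p) ^+ n * \sum_(i < n) `|f i| `^ p.
Proof.
move=> p0; elim: n f => [|n ih] f.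
  by rewrite !big_ord0 normr0 powR0 ?mulr0// gt_eqF.
rewrite !big_ord_recr/= (le_trans (ler_powRD _ _ (ltW p0)))// exprS -mulrA.
rewrite ler_wpM2l ?powR_ge0// mulrDr lerD//.
have h : 1 <= 2 `^ p :> R by rewrite -[leLHS](powRr0 2) ler_powR ?ler1n// ltW.
by rewrite ler_peMl ?powR_ge0// exprn_ege1.
Qed.

(** For [u <= 1/2] the bound [expR u <= 1 / (1 - u)] is enough. For larger [u], [u ^+ 2 >= 1/4], so
    [4 * expR M * u ^+ 2] already dominates [expR u]. *)
Lemma expR_le_quadratic M u : 0 <= M -> u <= M ->
  expR u <= 1 + u + (2 + 4 * expR M) * u ^+ 2.
Proof.
move=> M0 uM; have [u2|u2] := leP u 2^-1.
  have h1 : 1 - u <= (expR u)^-1 by rewrite -expRN -[X in X <= _]/(1 + - u) expR_ge1Dx.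
  have h2 : expR u <= (1 - u)^-1.
    rewrite -[leLHS]invrK lef_pV2 ?posrE ?invr_gt0 ?expR_gt0//; lra.
  have h3 : (1 - u)^-1 <= 1 + u + 2 * u ^+ 2.
    rewrite -[leLHS]mul1r ler_pdivrMr; last lra.
    have : 0 <= u ^+ 2 * (1 - 2 * u) by rewrite mulr_ge0 ?sqr_ge0//; lra.
    nra.
  apply: (le_trans h2); apply: (le_trans h3).
  by rewrite lerD2l ler_wpM2r ?sqr_ge0// lerDl mulr_ge0 ?expR_ge0.
have : expR u <= expR M by rewrite ler_expR.
have : 0 < expR M := expR_gt0 M.
move: (expR M) (expR u) => A B A0 BA.
have : 4^-1 <= u ^+ 2 by nra.
nra.
Qed.

(** A second-order Taylor bound for [|x|^p], obtained without derivatives by comparing the sizes of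
    [x] and [y]. The linear term is kept exact because it is the one that will have mean zero. *)
Lemma ler_powR_quadratic p : 2 <= p -> exists2 c : R, 0 < c &
  forall x y, `|x + y| `^ p <=
    `|x| `^ p + p * (x * `|x| `^ (p - 2)) * y
    + c * (`|x| `^ (p - 2) * y ^+ 2 + `|y| `^ p).
Proof.
move=> p2; have p0 : 0 < p by lra.
pose c1 : R := (2 + 4 * expR (p / 2)) * p ^+ 2.
pose c2 : R := 3 `^ p + p * 2 `^ (p - 1).
have c10 : 0 < c1.
  by rewrite /c1 mulr_gt0 ?exprn_gt0// addr_gt0// mulr_gt0 ?expR_gt0.
have c20 : 0 < c2 by rewrite /c2 addr_gt0 ?mulr_gt0 ?powR_gt0.
exists (c1 + c2); first exact: addr_gt0.
move=> x y.
have x2y0 : 0 <= `|x| `^ (p - 2) * y ^+ 2 by rewrite mulr_ge0 ?powR_ge0 ?sqr_ge0.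
have yp0 := powR_ge0 `|y| p.
(* If [|x| <= 2 |y|], a multiple of [|y|^p] dominates everything: [3^p] covers [|x + y|^p], and the
   rest of [c2] covers the linear term, which may be negative. *)
have [xy|xy] := leP `|x| (2 * `|y|).
  have h1 : `|x + y| `^ p <= 3 `^ p * `|y| `^ p.
    rewrite -powRM//; apply: ge0_ler_powR; rewrite ?nnegrE ?mulr_ge0//; first lra.
    by rewrite (le_trans (ler_normD _ _))//; lra.
  have h2 : `|p * (x * `|x| `^ (p - 2)) * y| <= p * 2 `^ (p - 1) * `|y| `^ p.
    rewrite !normrM (gtr0_norm p0) (ger0_norm (powR_ge0 _ _)) -!mulrA.
    rewrite ler_wpM2l ?(ltW p0)//.
    have -> : `|x| * (`|x| `^ (p - 2) * `|y|) = `|x| `^ (p - 1) * `|y|.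
      rewrite mulrA; congr (_ * _).
      by rewrite -(@mulr_powRB1 _ `|x| (p - 1)); [congr (_ * _ `^ _); ring| |lra].
    rewrite -(@mulr_powRB1 _ `|y| p)//.
    rewrite [leRHS](_ : _ = (2 `^ (p - 1) * `|y| `^ (p - 1)) * `|y|); last by ring.
    rewrite ler_wpM2r// -powRM//; apply: ge0_ler_powR; rewrite ?nnegrE//; first lra.

  have h3 : - (p * 2 `^ (p - 1) * `|y| `^ p) <= p * (x * `|x| `^ (p - 2)) * y.
    by move: h2; rewrite ler_norml => /andP[].
  have h4 : 0 <= c1 * (`|x| `^ (p - 2) * y ^+ 2 + `|y| `^ p)
             + c2 * (`|x| `^ (p - 2) * y ^+ 2).
    by apply: addr_ge0; apply: mulr_ge0; rewrite ?(ltW c10) ?(ltW c20)// addr_ge0.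
  have := powR_ge0 `|x| p; move: h4 h1 h3; rewrite mulrDl mulrDr mulrDl.
  by rewrite mulrDr mulrDl; lra.
have x0 : x != 0.
  by apply: contraTneq xy => ->; rewrite normr0 -leNgt mulr_ge0.
have nx0 : 0 < `|x| by rewrite normr_gt0.
(* Otherwise [|z| < 1/2]. Dividing by [|x|^p] leaves [(1 + z)^p <= expR (p z)], to which
   [expR_le_quadratic] applies with [M = p / 2]. *)
pose z := y / x.
have zy : y = x * z by rewrite /z mulrC mulfVK.
have z12 : `|z| < 2^-1.
  by rewrite /z normrM normrV ?unitfE// ltr_pdivrMr//; lra.
have [z1 z2] : - 2^-1 < z /\ z < 2^-1 by move: z12; rewrite ltr_norml => /andP[].
have z1p : 0 < 1 + z by lra.
have h : (1 + z) `^ p <= 1 + p * z + c1 * z ^+ 2.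
  apply: (@le_trans _ _ (expR (p * z))).
    rewrite mulrC expRM; apply: ge0_ler_powR; rewrite ?nnegrE ?(ltW p0) ?(ltW z1p) ?expR_ge0//.
    exact: expR_ge1Dx.
  apply: (le_trans (@expR_le_quadratic (p / 2) _ _ _)); [lra|nra|].
  by rewrite /c1; lra.
have -> : `|x + y| `^ p = `|x| `^ p * (1 + z) `^ p.
  rewrite zy -{1}(mulr1 x) -mulrDr normrM powRM// (gtr0_norm z1p)//.
have -> : p * (x * `|x| `^ (p - 2)) * y = `|x| `^ p * (p * z).
  rewrite zy -(@mulr_powRB1 _ `|x| p)// -(@mulr_powRB1 _ `|x| (p - 1)) //; last lra.
  rewrite (_ : p - 1 - 1 = p - 2); last ring.
  transitivity (p * (x ^+ 2 * `|x| `^ (p - 2)) * z); first ring.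
  by rewrite -(real_normK (num_real x)); ring.
have -> : `|x| `^ (p - 2) * y ^+ 2 = `|x| `^ p * z ^+ 2.
  rewrite zy -(@mulr_powRB1 _ `|x| p)// -(@mulr_powRB1 _ `|x| (p - 1)) //; last lra.
  rewrite (_ : p - 1 - 1 = p - 2); last ring.
  by rewrite exprMn -(real_normK (num_real x)); ring.
have := powR_ge0 `|x| p => A0.
have := ler_wpM2l A0 h.
move: (`|x| `^ p) A0 => A A0 {}h.
have AZ : 0 <= A * z ^+ 2 by rewrite mulr_ge0 ?sqr_ge0.
move: (`|y| `^ p) yp0 => B B0.
have h1 : 0 <= c2 * (A * z ^+ 2) by rewrite mulr_ge0 ?(ltW c20).
have h2 : 0 <= (c1 + c2) * B by rewrite mulr_ge0// addr_ge0 ?(ltW c10) ?(ltW c20).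
rewrite [(c1 + c2) * (_ + _)]mulrDr [(c1 + c2) * (A * _)]mulrDl.
by move: h; rewrite !mulrDr mulr1; lra.
Qed.

(** Write [(a + k v)^q] as [(a + k v) B] with [B = (a + k v)^(q-1)]. Since [B] dominates both
    [a^(q-1)] and [v^(q-1)], the left side is at most [(a + 3 c v) B]. *)
Lemma powRD_superadditive q c : 1 <= q -> 0 <= c -> exists2 k : R, 0 < k &
  forall a v, 0 < a -> 0 < v ->
    a `^ q + c * (2 * a `^ (q - 1) * v + v `^ q) <= (a + k * v) `^ q.
Proof.
move=> q1 c0; pose k : R := 1 + 4 * c.
exists k; first by rewrite /k; lra.
move=> a v a0 v0.
have q0 : 0 < q by lra.
have k1 : 1 <= k by rewrite /k; lra.
have kv0 : 0 < k * v by nra.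
have kvv : v <= k * v by nra.
rewrite -(@mulr_powRB1 _ (a + _))//; last by rewrite ltW// addr_gt0.
rewrite -(@mulr_powRB1 _ a)//; last exact: ltW.
rewrite -(@mulr_powRB1 _ v)//; last exact: ltW.
have h1 : a `^ (q - 1) <= (a + k * v) `^ (q - 1).
  by apply: ge0_ler_powR; rewrite ?nnegrE; lra.
have h2 : v `^ (q - 1) <= (a + k * v) `^ (q - 1).
  by apply: ge0_ler_powR; rewrite ?nnegrE; lra.
have A0 := powR_ge0 a (q - 1); have V0 := powR_ge0 v (q - 1).
move: (a `^ _) (v `^ _) ((_ + _) `^ _) h1 h2 A0 V0 => A V B h1 h2 A0 V0.
have e1 : a * A <= a * B by nra.
have e2 : c * v * (2 * A + V) <= c * v * (3 * B).
  apply: ler_wpM2l; [nra|lra].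
have e3 : 0 <= (v * B) by nra.
have e4 : 0 <= c * (v * B) by nra.
rewrite /k; nra.
Qed.

(** Linearises a root, so that an error known only through its time integral can be bounded under
    the power [1/q]. The factor [e^(1-q)] is harmless when the error is chosen after [e]. *)
Lemma powRV_le_linear q e u : 1 <= q -> 0 < e -> 0 <= u ->
  u `^ q^-1 <= e + e `^ (1 - q) * u.
Proof.
move=> q1 e0 u0; have q0 : 0 < q by lra.
have [ue|ue] := leP u (e `^ q).
  rewrite -[leLHS]addr0 lerD ?mulr_ge0 ?powR_ge0//.
  rewrite -[leRHS](@powRr1 _ e) ?(ltW e0)// -[X in _ <= _ `^ X](@divff _ q) ?gt_eqF//.
  rewrite powRrM; apply: ge0_ler_powR; rewrite ?nnegrE ?powR_ge0 ?invr_ge0//; lra.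
have u00 : 0 < u by rewrite (le_lt_trans _ ue)// powR_ge0.
rewrite (le_trans (y := e `^ (1 - q) * u)) ?lerDr ?(ltW e0)//.
have -> : u `^ q^-1 = u `^ (q^-1 - 1) * u.
  rewrite -{3}(@powRr1 _ u) ?(ltW u00)// -powRD ?subrK//.
  by rewrite (gt_eqF u00)/= implybT.
rewrite ler_wpM2r//.
have -> : q^-1 - 1 = - (1 - q^-1) by ring.
have -> : 1 - q = - (q - 1) by ring.
rewrite !powRN lef_pV2 ?posrE ?powR_gt0//.
have -> : q - 1 = q * (1 - q^-1) by rewrite mulrBr mulr1 divff// gt_eqF.
rewrite powRrM; apply: ge0_ler_powR; rewrite ?nnegrE ?powR_ge0 ?(ltW ue) ?(ltW u00)//.
by rewrite subr_ge0 invf_le1.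
Qed.

Lemma powR_le_expR q u : 0 < q -> 0 <= u -> u `^ q <= q `^ q * expR u.
Proof.
move=> q0 u0; have uq0 : 0 <= u / q by rewrite divr_ge0 ?(ltW q0).
have uE : u / q * q = u by rewrite mulfVK// gt_eqF.
rewrite -[in X in X <= _]uE mulrC powRM ?(ltW q0)// ler_wpM2l ?powR_ge0//.
rewrite -[in leRHS]uE expRM; apply: ge0_ler_powR; rewrite ?nnegrE ?(ltW q0) ?expR_ge0//.
by rewrite (le_trans _ (expR_ge1Dx _))// lerDr.
Qed.

(** A crude form of Young's inequality: the product is at most the larger of [x] and [y] raised to
    the power [p + r]. *)
Lemma powR_mul_le x y p r : 0 <= p -> 0 <= r -> 0 <= x -> 0 <= y ->
  x `^ p * y `^ r <= x `^ (p + r) + y `^ (p + r).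
Proof.
move=> p0 r0 x0 y0.
wlog xy : x y p r p0 r0 x0 y0 / x <= y => [h|].
  have [xy|/ltW yx] := leP x y; first exact: h.
  by rewrite mulrC addrC [p + r]addrC; apply: h.
have [->|y1] := eqVneq y 0.
  have [->|r1] := eqVneq r 0; last by rewrite (powR0 r1) mulr0 addr_ge0 ?powR_ge0.
  by rewrite !powRr0 addr0 mulr1 lerDl powR_ge0.
apply: (@le_trans _ _ (y `^ p * y `^ r)).
  by rewrite ler_wpM2r ?powR_ge0//; apply: ge0_ler_powR.
by rewrite -powRD ?lerDr ?powR_ge0 // y1 implybT.
Qed.

End powR_inequalities.

Lemma measurable_abs_powR (disp : measure_display) (T : measurableType disp)
    (R : realType) (p : R) (D : set T) (f : T -> R) :
  measurable_fun D f -> measurable_fun D (fun x => `|f x| `^ p).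
Proof.
move=> mf; apply: (measurableT_comp (measurable_powR p)).
exact: measurableT_comp.
Qed.

(** * Gaussian moments and independence *)

Section density.
Context {disp : measure_display} {T : measurableType disp} {R : realType}.
Variables (mu nu : {measure set T -> \bar R}) (f : T -> R).
Hypotheses (mf : measurable_fun setT f) (f0 : forall x, 0 <= f x).
Hypothesis nuE : forall A, measurable A -> nu A = (\int[mu]_(x in A) (f x)%:E)%E.
Local Open Scope ereal_scope.
Import HBNNSimple.

Let integral_density_nnsfun (h : {nnsfun T >-> R}) :
  \int[nu]_x (h x)%:E = \int[mu]_x ((h x)%:E * (f x)%:E).
Proof.
transitivity (\sum_(k \in range h)
    \int[mu]_x ((k * \1_(h @^-1` [set k]) x)%:E * (f x)%:E)).
  under eq_integral do rewrite fimfunE -fsumEFin//.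
  rewrite ge0_integral_fsum//; last 2 first.
  - by move=> r; exact/measurable_EFinP/measurable_funM.
  - by move=> r x _; rewrite nnfun_muleindic_ge0.
  apply: eq_fsbigr => r _; rewrite integralZl_indic_nnsfun// integral_indic//= setIT.
  have [r0|r0] := ltP r 0%R.
    rewrite preimage_nnfun0// measure0 mule0 (eq_integral (cst 0)) ?integral0//.
    by move=> x _; rewrite indic0 mulr0 mul0e.
  rewrite nuE// integral_mkcond -ge0_integralZl_EFin//; last 2 first.
  - by move=> x _; apply: erestrict_ge0 => y _; rewrite lee_fin.
  - by apply/(measurable_restrictT _ _).1 => //; exact/measurable_funTS/measurable_EFinP.
  apply: eq_integral => x _; rewrite EFinM -muleA; congr (_ * _).
  rewrite patchE indicE.
  by case: ifPn => _; rewrite ?mul1e ?mul0e.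
rewrite -ge0_integral_fsum//.
- apply: eq_integral => x _; rewrite -ge0_mule_fsuml ?fsumEFin -?fimfunE//.
  by move=> r; rewrite nnfun_muleindic_ge0.
- move=> r; apply: emeasurable_funM => //; last exact/measurable_EFinP.
  exact/measurable_EFinP/measurable_funM.
- move=> r x _; apply: mule_ge0; last by rewrite lee_fin.
  by rewrite EFinM nnfun_muleindic_ge0.
Qed.

(** From simple functions by monotone convergence. It turns integrals against [normal_prob] into
    Lebesgue integrals with the factor [normal_pdf]. *)
Lemma ge0_integral_density (g : T -> \bar R) : measurable_fun setT g ->
  (forall x, 0 <= g x) -> \int[nu]_x g x = \int[mu]_x (g x * (f x)%:E).
Proof.
move=> mg g0; pose g_ := nnsfun_approx measurableT mg.
have g_cvg x : (g_ n x)%:E @[n --> \oo] --> g x.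
  by apply: cvg_nnsfun_approx => // y _.
transitivity (limn (fun n => \int[nu]_x (g_ n x)%:E)).
  rewrite -monotone_convergence//=.
  - by apply: eq_integral => x _; apply/esym/cvg_lim.
  - by move=> n; apply: measurableT_comp.
  - by move=> n x _; rewrite lee_fin.
  - by move=> x _ a b ab; rewrite lee_fin//; exact/lefP/nd_nnsfun_approx.
rewrite [X in limn X](_ : _ = fun n => \int[mu]_x ((g_ n x)%:E * (f x)%:E)); last first.
  by apply/funext => n; exact: integral_density_nnsfun.
rewrite -monotone_convergence//=.
- apply: eq_integral => x _; apply/cvg_lim => //.
  by apply: cvgeMr.
- by move=> n; apply: emeasurable_funM; exact/measurable_EFinP.
- by move=> n x _; rewrite mule_ge0// lee_fin.
- move=> x _ a b ab; rewrite lee_wpmul2r ?lee_fin//.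
  exact/lefP/nd_nnsfun_approx.
Qed.

End density.

Section normal_moments.
Context {R : realType}.
Implicit Types s p : R.

(** Lebesgue measure and the centred density are both invariant under [x |-> - x]. This is the
    symmetry that removes the cross term. *)
Lemma normal_prob_opp s (B : set R) : s != 0 -> measurable B ->
  normal_prob 0 s (-%R @^-1` B) = normal_prob 0 s B.
Proof.
move=> s0 mB; rewrite /normal_prob; apply: esym.
have mN : measurable_fun setT (-%R : measurableTypeR R -> measurableTypeR R) by [].
transitivity (\int[pushforward lebesgue_measure
    (-%R : measurableTypeR R -> measurableTypeR R)]_(x in B) (normal_pdf 0 s x)%:E)%E.
  by apply: eq_measure_integral => /= A mA _; rewrite lebesgue_measureN.
rewrite ge0_integral_pushforward//; last 2 first.
- by apply/measurable_EFinP/measurable_funTS; exact: measurable_normal_pdf.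
- by move=> x _; rewrite lee_fin normal_pdf_ge0.
apply: eq_integral => x _ /=.
by rewrite (normal_pdfE _ s0) /normal_fun !subr0 sqrrN.
Qed.

(** No Gaussian moment is computed. With [u = (x / (2 s))^2] the densities of deviation [s] and
    [2 s] carry [expR (- 2 u)] and [expR (- u / 2)]; one factor [expR (- u)] absorbs [|x|^p], and
    what remains is dominated by the wider density, whose integral is 1. *)
Lemma normal_abs_moment p : 0 < p -> exists2 c : R, 0 < c &
  forall s, 0 < s ->
    (\int[normal_prob 0 s]_x (`|x| `^ p)%:E <= (c * s `^ p)%:E)%E.
Proof.
move=> p0; pose q := p / 2; have q0 : 0 < q by rewrite divr_gt0.
exists (2 * 2 `^ p * q `^ q); first by rewrite !mulr_gt0 ?powR_gt0.
move=> s s0; have s2 : 2 * s != 0 by rewrite gt_eqF ?mulr_gt0.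
have mpow : measurable_fun setT (fun x : R => (`|x| `^ p)%:E).
  by apply/measurable_EFinP/measurable_abs_powR.
rewrite (@ge0_integral_density _ _ _ lebesgue_measure _ (normal_pdf 0 s))//.
- rewrite (_ : (_ * s `^ p)%:E =
    \int[lebesgue_measure]_x ((2 * 2 `^ p * q `^ q * s `^ p)%:E *
        (normal_pdf 0 (2 * s) x)%:E))%E; last first.
    rewrite ge0_integralZl_EFin//.
    + by rewrite integral_normal_pdf mule1.
    + by move=> x _; rewrite lee_fin normal_pdf_ge0.
    + by apply/measurable_EFinP; exact: measurable_normal_pdf.
    + by rewrite !mulr_ge0 ?powR_ge0.
  apply: ge0_le_integral => //.
  + by move=> x _; rewrite -EFinM lee_fin mulr_ge0 ?powR_ge0 ?normal_pdf_ge0.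
  + apply: emeasurable_funM; first exact: mpow.
    by apply/measurable_EFinP; exact: measurable_normal_pdf.
  + apply: emeasurable_funM; first exact: measurable_cst.
    by apply/measurable_EFinP; exact: measurable_normal_pdf.
  move=> x _; rewrite -!EFinM lee_fin.
  rewrite !normal_pdfE ?gt_eqF ?mulr_gt0//= /normal_fun !subr0.
  pose u : R := (x / (2 * s)) ^+ 2.
  have u0 : 0 <= u by rewrite sqr_ge0.
  have -> : - x ^+ 2 / (s ^+ 2 *+ 2) = - u - u.
    by rewrite /u; field; rewrite gt_eqF.
  have -> : - x ^+ 2 / ((2 * s) ^+ 2 *+ 2) = - (u / 2).
    by rewrite /u; field; rewrite gt_eqF.
  have -> : `|x| `^ p = 2 `^ p * s `^ p * u `^ q.
    rewrite -powRM ?(ltW s0)// /u -(@real_normK _ (x / _)) ?num_real//.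
    rewrite -powR_mulrn// -powRrM [2%:R * q]mulrC divfK// -powRM ?mulr_ge0 ?(ltW s0)//.
    by rewrite normrM normrV ?unitfE// (@ger0_norm _ (2 * s)) ?mulr_ge0 ?(ltW s0)// mulrC divfK.
  have -> : normal_peak s = 2 * normal_peak (2 * s).
    rewrite /normal_peak (_ : (2 * s) ^+ 2 * pi *+ 2 = 2 ^+ 2 * (s ^+ 2 * pi *+ 2)); last ring.
    rewrite sqrtrM ?sqr_ge0// sqrtr_sqr ger0_norm// invfM mulrA divff ?mul1r//.
  have h : u `^ q * expR (- u) <= q `^ q.
    have := powR_le_expR q0 u0; rewrite expRN -ler_pdivlMr ?invr_gt0 ?expR_gt0//.
    by rewrite invrK.
  have h2 : expR (- u) <= expR (- (u / 2)) by rewrite ler_expR; lra.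
  rewrite expRD.
  rewrite [leLHS](_ : _ = 2 * 2 `^ p * s `^ p * normal_peak (2 * s) *
     ((u `^ q * expR (- u)) * expR (- u))); last by ring.
  rewrite [leRHS](_ : _ = 2 * 2 `^ p * s `^ p * normal_peak (2 * s) *
     (q `^ q * expR (- (u / 2)))); last by ring.
  rewrite ler_wpM2l ?mulr_ge0 ?powR_ge0 ?normal_peak_ge0//.
  by apply: ler_pM => //; rewrite ?mulr_ge0 ?powR_ge0 ?expR_ge0.
- exact: measurable_normal_pdf.
- by move=> x; rewrite normal_pdf_ge0.
Qed.

End normal_moments.

Section independence.
Context {disp : measure_display} {Omega : measurableType disp} {R : realType}.
Variable P : probability Omega R.
Implicit Types G U : Omega -> R.

Definition independent G U := forall A B : set R, measurable A -> measurable B ->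
  P (G @^-1` A `&` U @^-1` B) = (P (G @^-1` A) * P (U @^-1` B))%E.

Lemma pushforward_probability G : measurable_fun setT G ->
  exists2 mu : probability R R, (forall A, mu A = P (G @^-1` A)) &
    forall f : R -> \bar R, measurable_fun setT f -> (forall x, (0 <= f x)%E) ->
      (\int[mu]_x f x = \int[P]_w f (G w))%E.
Proof.
move=> mG; pose X : {mfun Omega >-> R} := mfun_Sub (mem_set mG : G \in mfun).
exists (distribution P X) => // f mf f0.
by rewrite ge0_integral_distribution.
Qed.

(** The joint law is the product measure, by uniqueness on rectangles. The marginals are arguments
    so that one and the same product measure can serve both [U] and [- U]. *)
Lemma independent_integral2 G U (h : R * R -> \bar R) :
  measurable_fun setT G -> measurable_fun setT U -> independent G U ->
  measurable_fun setT h -> (forall z, (0 <= h z)%E) ->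
  forall muG muU : probability R R,
  (forall A, measurable A -> muG A = P (G @^-1` A)) ->
  (forall A, measurable A -> muU A = P (U @^-1` A)) ->
  (\int[P]_w h (G w, U w) = \int[muG \x muU]_z h z)%E.
Proof.
move=> mG mU GU mh h0 muG muU muGE muUE.
have mGU : measurable_fun setT (fun w => (G w, U w)) by exact/measurable_fun_pair.
pose X : {mfun Omega >-> (R * R)%type} := mfun_Sub (mem_set mGU : _ \in mfun).
rewrite -[LHS](ge0_integral_distribution X)//.
apply: eq_measure_integral => A mA _; apply/esym.
apply: product_measure_unique => // B C mB mC.
transitivity (P (G @^-1` B) * P (U @^-1` C))%E; first exact: GU.
by congr (_ * _)%E; apply/esym; [exact: muGE|exact: muUE].
Qed.

Lemma independent_integralM G U (f g : R -> R) :
  measurable_fun setT G -> measurable_fun setT U -> independent G U ->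
  measurable_fun setT f -> measurable_fun setT g ->
  (forall x, 0 <= f x) -> (forall x, 0 <= g x) ->
  (\int[P]_w (f (G w) * g (U w))%:E =
   (\int[P]_w (f (G w))%:E) * \int[P]_w (g (U w))%:E)%E.
Proof.
move=> mG mU GU mf mg f0 g0.
have [muG muGE iG] := pushforward_probability mG.
have [muU muUE iU] := pushforward_probability mU.
have mfg : measurable_fun setT (fun z : R * R => (f z.1 * g z.2)%:E).
  apply/measurable_EFinP; apply: measurable_funM.
    exact: (measurableT_comp mf).
  exact: (measurableT_comp mg).
rewrite (independent_integral2 mG mU GU mfg _ (fun A _ => muGE A) (fun A _ => muUE A));
  last by move=> z; rewrite lee_fin mulr_ge0.
rewrite fubini_tonelli1//; last by move=> z; rewrite lee_fin mulr_ge0.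
rewrite /fubini_F/=.
under eq_integral => x _.
  under eq_integral do rewrite EFinM.
  rewrite ge0_integralZl_EFin//; last 2 first.
  - by move=> y _; rewrite lee_fin.
  - exact/measurable_EFinP.
  over.
rewrite ge0_integralZr//; last 3 first.
- exact/measurable_EFinP.
- by move=> x _; rewrite lee_fin.
- by apply: integral_ge0 => x _; rewrite lee_fin.
rewrite (iG (fun x => (f x)%:E))//; last exact/measurable_EFinP.
rewrite (iU (fun x => (g x)%:E))//.
exact/measurable_EFinP.
Qed.

(** The pairs [(G, U)] and [(G, - U)] have the same law. Integrating the positive part [h] of the
    product against it shows that the positive and the negative part of [G U] have equal
    integrals. *)
Lemma independent_symmetric_integral G U :
  measurable_fun setT G -> measurable_fun setT U -> independent G U ->
  (forall A : set R, measurable A -> P (U @^-1` (-%R @^-1` A)) = P (U @^-1` A)) ->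
  P.-integrable setT (fun w => (G w * U w)%:E) ->
  (\int[P]_w (G w * U w)%:E = 0)%E.
Proof.
move=> mG mU GU symU iGU.
have [muG muGE _] := pushforward_probability mG.
have [muU muUE _] := pushforward_probability mU.
have mN : measurable_fun setT (fun w => - U w) by exact: measurableT_comp.
have GN : independent G (fun w => - U w).
  move=> A B mA mB; rewrite [X in P (_ `&` X)](_ : _ = U @^-1` (-%R @^-1` B))//.
  rewrite GU//.
  by rewrite -[X in measurable X]setTI; apply: (@oppr_measurable R setT).
pose h (z : R * R) := maxe (z.1 * z.2)%:E 0%E.
have mh : measurable_fun setT h.
  apply: measurable_maxe => //.
  apply/measurable_EFinP; apply: measurable_funM; [exact: measurable_fst|exact: measurable_snd].
have h0 z : (0 <= h z)%E by rewrite /h le_max lexx orbT.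
have E1 := independent_integral2 mG mU GU mh h0 (fun A _ => muGE A) (fun A _ => muUE A).
have E2 := independent_integral2 mG mN GN mh h0 (fun A _ => muGE A)
  (fun A mA => etrans (muUE A) (esym (symU A mA))).
have : (\int[P]_w ((fun w => (G w * U w)%:E) ^\+ w) =
  \int[P]_w ((fun w => (G w * U w)%:E) ^\- w))%E.
  transitivity (\int[P]_w h (G w, U w))%E; first by apply: eq_integral => w _; rewrite funeposE.
  rewrite E1 -E2; apply: eq_integral => w _.
  by rewrite funenegE /h/= mulrN.
move=> e; rewrite integralE e subee//.
by apply: integrable_fin_num => //; exact: integrable_funeneg.
Qed.

End independence.

(** * Moments of martingale transforms *)

(* With these weights both second-order terms are at most [c a^(p/2-1) v] once
   [E|x|^p <= a^(p/2)] and [E|y|^p <= v^(p/2)]. *)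
Lemma ler_powR_increment (R : realType) (p : R) : 2 <= p -> exists2 c : R, 0 < c &
  forall a v x y : R, 0 < a -> 0 < v ->
    `|x + y| `^ p <=
      (1 + c * (a `^ (p / 2 - 1) * v) / a `^ (p / 2)) * `|x| `^ p
      + p * (x * `|x| `^ (p - 2) * y)
      + c * (a `^ (p / 2 - 1) * v / v `^ (p / 2) + 1) * `|y| `^ p.
Proof.
move=> p2; have [c c0 H] := ler_powR_quadratic p2; exists c => // a v x y a0 v0.
apply: (le_trans (H x y)).
set q := p / 2; have pq : p = 2 * q by rewrite /q mulrCA divff ?mulr1.
have sq (w : R) : 0 < w -> w = (w `^ 2^-1) ^+ 2.
  move=> w0; rewrite -powR_mulrn ?powR_ge0// -powRrM mulVf// powRr1//; exact: ltW.
pose sa := a `^ 2^-1; pose sv := v `^ 2^-1.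
have sa0 : 0 < sa by rewrite powR_gt0.
have sv0 : 0 < sv by rewrite powR_gt0.
have sap (r : R) : sa `^ (2 * r) = a `^ r by rewrite -powRrM mulrA mulVf ?mul1r.
have svp (r : R) : sv `^ (2 * r) = v `^ r by rewrite -powRrM mulrA mulVf ?mul1r.
have iv (w z r : R) : 0 <= z -> 0 < w -> (z / w) `^ r = z `^ r / w `^ r.
  move=> z0 w0; rewrite powRM ?invr_ge0 ?(ltW w0)//; congr (_ * _).
  by rewrite -(powR_inv1 (ltW w0)) -powRrM mulN1r powRN.
have {}H : (`|x| / sa) `^ (p - 2) * (`|y| / sv) `^ 2 <=
    (`|x| / sa) `^ (p - 2 + 2) + (`|y| / sv) `^ (p - 2 + 2).
  by apply: powR_mul_le; rewrite ?subr_ge0// divr_ge0// ltW.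
rewrite subrK !iv// (_ : sa `^ p = a `^ q) in H; last by rewrite -sap -pq.
rewrite (_ : sv `^ p = v `^ q) in H; last by rewrite -svp -pq.
rewrite (_ : sa `^ (p - 2) = a `^ (q - 1)) in H; last first.
  by rewrite -sap; congr (_ `^ _); rewrite pq; ring.
rewrite (_ : sv `^ 2 = v) in H; last by rewrite -[X in _ `^ X]mulr1 svp powRr1// ltW.
rewrite (_ : `|y| `^ 2 = y ^+ 2) in H; last by rewrite powR_mulrn// real_normK ?num_real.
have A0 : 0 < a `^ (q - 1) * v by rewrite mulr_gt0 ?powR_gt0.
have E : `|x| `^ (p - 2) * y ^+ 2 <= (a `^ (q - 1) * v) *
  (`|x| `^ p / a `^ q + `|y| `^ p / v `^ q).
  rewrite -ler_pdivrMl//; apply: le_trans H.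
  rewrite le_eqVlt; apply/orP; left; apply/eqP; field.
  by rewrite !gt_eqF ?powR_gt0.
have := ler_wpM2l (ltW c0) E.
move: (a `^ (q - 1) * v) (a `^ q) (v `^ q) (`|x| `^ (p - 2) * y ^+ 2) => A B V X.
rewrite !mulrDr !mulrDl !mulrA => {}E; lra.
Qed.

(** Regards a sub-sigma-algebra as the sigma-algebra of its own space, so that the closure
    properties of [measurable_fun] become available for adapted functions. *)
Lemma measurable_wrtP (disp disp' : measure_display) (Omega : measurableType disp)
    (E : measurableType disp') (G : set (set Omega)) (f : Omega -> E) :
  sigma_algebra setT G ->
  measurable_wrt G f <-> measurable_fun setT (f : g_sigma_algebraType G -> E).
Proof.
move=> sG; split => [mf _ B mB|mf B mB].
  by rewrite setTI; apply: sub_sigma_algebra; exact: mf.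
have := mf measurableT B mB; rewrite setTI.
by rewrite /measurable/= /g_sigma_algebraType/= sigma_algebra_id.
Qed.

Section martingale_transform.
Context {disp : measure_display} {Omega : measurableType disp} {R : realType}.
Variable P : probability Omega R.
Local Open Scope ereal_scope.

Lemma integrable_abs_powR (p : R) (f : Omega -> R) (B : R) : measurable_fun setT f ->
  \int[P]_w (`|f w| `^ p)%:E <= B%:E -> P.-integrable setT (fun w => (`|f w| `^ p)%:E).
Proof.
move=> mf h; apply/integrableP; split.
  exact/measurable_EFinP/measurable_abs_powR.
apply: le_lt_trans (ltry B); apply: le_trans h.
rewrite le_eqVlt; apply/orP; left; apply/eqP; apply: eq_integral => w _.
by rewrite gee0_abs// lee_fin powR_ge0.
Qed.

(** The cross term is asked to vanish only under the assumption that it is integrable. Integrability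
    itself follows here from the two moment bounds, through [|M|^(p-1) |D| <= |M|^p + |D|^p]. *)
Lemma ler_Lp_increment (p : R) : (2 <= p)%R -> exists2 k : R, (0 < k)%R &
  forall (M D : Omega -> R) (a v : R),
    measurable_fun setT M -> measurable_fun setT D -> (0 < a)%R -> (0 < v)%R ->
    \int[P]_w (`|M w| `^ p)%:E <= (a `^ (p / 2))%:E ->
    \int[P]_w (`|D w| `^ p)%:E <= (v `^ (p / 2))%:E ->
    (P.-integrable setT (fun w => (M w * `|M w| `^ (p - 2) * D w)%:E) ->
      \int[P]_w (M w * `|M w| `^ (p - 2) * D w)%:E = 0) ->
    \int[P]_w (`|M w + D w| `^ p)%:E <= ((a + k * v) `^ (p / 2))%:E.
Proof.
move=> p2; have [c c0 H] := ler_powR_increment p2.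
have q1 : (1 <= p / 2)%R by rewrite ler_pdivlMr ?mul1r.
have [k k0 K] := powRD_superadditive q1 (ltW c0).
exists k => // M D a v mM mD a0 v0 Ma Dv cross.
have iM := integrable_abs_powR mM Ma.
have iD := integrable_abs_powR mD Dv.
have mMD : measurable_fun setT (fun w => M w * `|M w| `^ (p - 2) * D w)%R.
  apply: measurable_funM => //; apply: measurable_funM => //.
  exact: measurable_abs_powR.
have icross : P.-integrable setT (fun w => (M w * `|M w| `^ (p - 2) * D w)%:E).
  apply: (le_integrable _ _ _ (integrableD _ iM iD)) => //.
    exact/measurable_EFinP.
  move=> w _; rewrite /= lee_fin (@ger0_norm _ (_ + _)%R) ?addr_ge0 ?powR_ge0//.
  rewrite !normrM (ger0_norm (powR_ge0 _ _)).
  have := @powR_mul_le R `|M w| `|D w| (p - 1)%R 1%R.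
  rewrite subrK powRr1// => h.
  rewrite -(@mulr_powRB1 _ `|M w| (p - 1)%R) in h => //; last lra.
  rewrite (_ : p - 1 - 1 = p - 2)%R in h; last by ring.
  by apply: h => //; lra.
move: cross => /(_ icross) cross.
have iX := integrableZl measurableT p icross.
have iMa := integrableZl measurableT (1 + c * (a `^ (p / 2 - 1) * v) / a `^ (p / 2))%R iM.
have iDb := integrableZl measurableT (c * (a `^ (p / 2 - 1) * v / v `^ (p / 2) + 1))%R iD.
have iS := integrableD measurableT (integrableD measurableT iMa iX) iDb.
have mS : measurable_fun setT (fun w => (`|M w + D w| `^ p)%:E).
  by apply/measurable_EFinP/measurable_abs_powR/measurable_funD.
apply: (@le_trans _ _ (\int[P]_w
   ((1 + c * (a `^ (p / 2 - 1) * v) / a `^ (p / 2))%:E * (`|M w| `^ p)%:E +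
    p%:E * (M w * `|M w| `^ (p - 2) * D w)%:E +
    (c * (a `^ (p / 2 - 1) * v / v `^ (p / 2) + 1))%:E * (`|D w| `^ p)%:E))).
  apply: le_integral => //.
    apply: (le_integrable _ _ _ iS) => //.
    move=> w _; rewrite /= lee_fin ger0_norm ?powR_ge0//.
    by rewrite (le_trans _ (ler_norm _))//; exact: H.
  by move=> w _; rewrite -!EFinM -!EFinD lee_fin; exact: H.
rewrite integralD//; last exact: integrableD.
rewrite integralD// !integralZl// cross mule0 adde0.
(* The weights of [ler_powR_increment] cancel against these bounds. With [q = p / 2] the sum becomes
   [a^q + c (2 a^(q-1) v + v^q)], the left side of [powRD_superadditive]. *)
apply: (@le_trans _ _ ((1 + c * (a `^ (p / 2 - 1) * v) / a `^ (p / 2))%:E * (a `^ (p / 2))%:E +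
   (c * (a `^ (p / 2 - 1) * v / v `^ (p / 2) + 1))%:E * (v `^ (p / 2))%:E)).
  apply: leeD; apply: lee_wpmul2l => //; rewrite lee_fin.
    by rewrite addr_ge0// divr_ge0 ?powR_ge0// !mulr_ge0 ?powR_ge0 ?(ltW c0) ?(ltW v0).
  by rewrite mulr_ge0 ?(ltW c0)// addr_ge0// divr_ge0 ?powR_ge0// mulr_ge0 ?powR_ge0 ?(ltW v0).
rewrite -!EFinM -EFinD lee_fin; apply: le_trans (K a v a0 v0).
rewrite le_eqVlt; apply/orP; left; apply/eqP; field.
by rewrite !gt_eqF ?powR_gt0.
Qed.

End martingale_transform.

Section martingale_transform_moment.
Context {disp : measure_display} {Omega : measurableType disp} {R : realType}.
Variable P : probability Omega R.

Lemma sub_measurable_wrt (disp' : measure_display) (E : measurableType disp')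
    (G H : set (set Omega)) (f : Omega -> E) :
  G `<=` H -> measurable_wrt G f -> measurable_wrt H f.
Proof. by move=> GH mf B mB; exact/GH/mf. Qed.

Lemma measurable_wrt_fun (disp' : measure_display) (E : measurableType disp')
    (G : set (set Omega)) (f : Omega -> E) :
  G `<=` measurable -> measurable_wrt G f -> measurable_fun setT f.
Proof. by move=> GH mf _ B mB; rewrite setTI; exact/GH/mf. Qed.

(** Induction on [n] with the one-step estimate. The offset [a] has to be positive because that
    estimate divides by a power of the bound for the partial sum, and the induction starts from the
    empty sum. *)
Lemma martingale_transform_moment (p : R) : 2 <= p -> exists2 k : R, 0 < k &
  forall (F : nat -> set (set Omega)) (xi U : nat -> Omega -> R) (v : nat -> R) n,
  (forall l, sigma_algebra setT (F l)) ->
  (forall l, F l `<=` measurable) ->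
  {homo F : l1 l2 / (l1 <= l2)%N >-> l1 `<=` l2} ->
  (forall l, (l < n)%N -> measurable_wrt (F l) (xi l)) ->
  (forall l, (l < n)%N -> measurable_wrt (F l.+1) (U l)) ->
  (forall l, (l < n)%N -> forall (A : set Omega) (B : set R), F l A -> measurable B ->
     P (A `&` U l @^-1` B) = (P A * P (U l @^-1` B))%E) ->
  (forall l, (l < n)%N -> forall B : set R, measurable B ->
     P (U l @^-1` (-%R @^-1` B)) = P (U l @^-1` B)) ->
  (forall l, (l < n)%N -> 0 < v l) ->
  (forall l, (l < n)%N ->
     (\int[P]_w (`|xi l w * U l w| `^ p)%:E <= (v l `^ (p / 2))%:E)%E) ->
  forall a : R, 0 < a ->
  (\int[P]_w (`|\sum_(l < n) xi l w * U l w| `^ p)%:E <=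
    ((a + k * \sum_(l < n) v l) `^ (p / 2))%:E)%E.
Proof.
move=> p2; have [k k0 K] := ler_Lp_increment P p2; exists k => //.
move=> F xi U v n sF Fm Fnd; elim: n => [|n ih] mxi mU indU symU v0 hv a a0.
  rewrite big_ord0 mulr0 addr0 (eq_integral (cst 0%E)).
    by rewrite integral0 lee_fin powR_ge0.
  by move=> w _; rewrite big_ord0 normr0 powR0// gt_eqF//; lra.
under eq_integral do rewrite big_ord_recr/=.
rewrite big_ord_recr/= mulrDr addrA.
have mMF : measurable_fun setT ((fun w => \sum_(l < n) xi l w * U l w)
    : g_sigma_algebraType (F n) -> R).
  apply: measurable_sum => l; apply: measurable_funM; apply/measurable_wrtP => //.
    apply: sub_measurable_wrt (mxi l _); last by rewrite ltnS ltnW.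
    by apply: Fnd; rewrite ltnW.
  by apply: sub_measurable_wrt (mU l _); [exact: Fnd|rewrite ltnS ltnW].
have mxiF : measurable_fun setT (xi n : g_sigma_algebraType (F n) -> R).
  by apply/measurable_wrtP => //; exact: mxi.
(* The factor of [U n] in the cross term. It is measurable for [F n], from which [U n] is
   independent. *)
have mGF : measurable_fun setT ((fun w => (\sum_(l < n) xi l w * U l w) *
     `|\sum_(l < n) xi l w * U l w| `^ (p - 2) * xi n w)
    : g_sigma_algebraType (F n) -> R).
  apply: measurable_funM => //; apply: measurable_funM => //.
  exact: measurable_abs_powR.
have mM := measurable_wrt_fun (@Fm n) ((measurable_wrtP _ (sF n)).2 mMF).
have mG := measurable_wrt_fun (@Fm n) ((measurable_wrtP _ (sF n)).2 mGF).
have mx := measurable_wrt_fun (@Fm n) ((measurable_wrtP _ (sF n)).2 mxiF).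
have mUn := measurable_wrt_fun (@Fm n.+1) (mU n (ltnSn n)).
apply: K => //.
- exact: measurable_funM.
- rewrite ltr_wpDr// mulr_ge0 ?(ltW k0)// sumr_ge0// => i _.
  by rewrite ltW// v0// ltnS ltnW.
- exact: v0.
- by apply: ih => // l ln; [apply: mxi|apply: mU|apply: indU|apply: symU|
     apply: v0|apply: hv]; exact: ltnW.
- exact: hv.
move=> icross; rewrite -[RHS](@independent_symmetric_integral _ _ _ P _ _ mG mUn).
- by apply: eq_integral => w _; rewrite mulrA.
- move=> A B mA mB; apply: indU => //.
  exact: ((measurable_wrtP _ (sF n)).2 mGF).
- exact: symU.
- by apply: eq_integrable icross => // w _; rewrite mulrA.
Qed.

End martingale_transform_moment.

Lemma ler_sum_integral_cells (R : realType) (g : nat -> R) (n : nat) (r : nat -> R)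
    (rho : R -> \bar R) :
  (forall l, (l < n)%N -> g l <= g l.+1) -> (forall l, (l < n)%N -> 0 <= r l) ->
  measurable_fun `]g 0%N, g n] rho -> (forall s, (0 <= rho s)%E) ->
  (forall l s, (l < n)%N -> s \in `]g l, g l.+1] -> ((r l)%:E <= rho s)%E) ->
  ((\sum_(l < n) (g l.+1 - g l) * r l)%:E <=
    \int[lebesgue_measure]_(s in `]g 0%N, g n]) rho s)%E.
Proof.
move=> + + + rho0; elim: n => [|n ih] gnd r0 mrho rr.
  by rewrite big_ord0 integral_ge0.
have g0n : g 0%N <= g n.
  elim: {ih mrho rr r0} n gnd => // n ih h.
  by apply: (le_trans (ih _)) => [l ln|]; apply: h => //; rewrite ltnS ltnW.
have gnS : g n <= g n.+1 by exact: gnd.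
have e : `]g 0%N, g n.+1]%classic = `]g 0%N, g n] `|` `]g n, g n.+1].
  by rewrite -itv_bndbnd_setU// bnd_simp.
rewrite e in mrho *; rewrite ge0_integral_setU//; last first.
  rewrite disj_set2E; apply/eqP/seteqP; split => // x [] /=.
  by rewrite !in_itv/= => /andP[_ xn] /andP[]; rewrite ltNge xn.
rewrite big_ord_recr/= EFinD; apply: leeD.
  apply: ih => [l ln|l ln||l s ln].
  - by apply: gnd; exact: ltnW.
  - by apply: r0; exact: ltnW.
  - by apply: measurable_funS mrho => //; exact: measurableU.
  - by apply: rr; exact: ltnW.
apply: (@le_trans _ _ (\int[lebesgue_measure]_(s in `]g n, g n.+1]) (r n)%:E)%E).
  rewrite integral_cst//= lebesgue_measure_itv/= lte_fin.
  have [gg|gg] := ltP (g n) (g n.+1); first by rewrite -EFinB -EFinM mulrC.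
  by rewrite (_ : g n.+1 = g n) ?subrr ?mul0r ?mule0//; apply/le_anti/andP.
apply: ge0_le_integral => //.
- by move=> s _; rewrite lee_fin r0.
- by apply: measurable_funS mrho => //; exact: measurableU.
- by move=> s sn; apply: rr.
Qed.

(** * Integrals of elementary processes *)

Section brownian_increments.
Context {disp : measure_display} {Omega : measurableType disp} {R : realType}.
Variables (P : probability Omega R) (F : R -> set (set Omega)) (m : nat)
  (W : R -> Omega -> 'cV[R]_m).
Hypotheses (FU : usual_filtration P F) (WB : brownian_motion P F W).
Variables (s t : R) (j : 'I_m).
Hypotheses (s0 : 0 <= s) (st : s < t).

Let U (w : Omega) : R := W t w j 0 - W s w j 0.

Let t0 : 0 <= t. Proof. by rewrite (le_trans s0)// ltW. Qed.

Lemma brownian_increment_adapted : measurable_wrt (F t) U.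
Proof.
have sF := filtration_sigma_algebra FU t0.
apply/(measurable_wrtP _ sF); apply: measurable_funB;
  apply: (measurableT_comp (measurable_coord j 0)); apply/measurable_wrtP => //.
  exact: (bm_adapted WB t0).
apply: sub_measurable_wrt (bm_adapted WB s0).
by apply: (filtration_nondecreasing FU) => //; exact: ltW.
Qed.

Lemma measurable_brownian_increment : measurable_fun setT U.
Proof.
apply: measurable_wrt_fun brownian_increment_adapted.
exact: (filtration_sub FU).
Qed.

Let UE (B : set R) :
  U @^-1` B = [set w | [set A : 'cV[R]_m | B (A j 0)] (W t w - W s w)].
Proof. by rewrite /U; apply/seteqP; split => w /=; rewrite !mxE. Qed.

Lemma brownian_increment_independent (A : set Omega) (B : set R) :
  F s A -> measurable B -> P (A `&` U @^-1` B) = (P A * P (U @^-1` B))%E.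
Proof.
move=> FA mB; rewrite UE; apply: (bm_independent_increments WB) => //.
  exact: ltW.
rewrite (_ : [set _ | _] = (fun M : 'cV[R]_m => M j 0) @^-1` B)//.
by rewrite -[X in measurable X]setTI; exact: measurable_coord.
Qed.

Lemma brownian_increment_law (B : set R) : measurable B ->
  P (U @^-1` B) = normal_prob 0 (Num.sqrt (t - s)) B.
Proof.
(* Only coordinate [j] is constrained, so the other factors of the product are 1. *)
move=> mB; pose C i := if i == j then B else setT.
have mC i : measurable (C i) by rewrite /C; case: ifP.
have := bm_gaussian_increments WB s0 st mC.
rewrite (bigD1 j)//= big1 ?mule1; last first.
  by move=> i ij; rewrite /C (negbTE ij) probability_setT.
rewrite {2}/C eqxx => <-; congr (P _).
rewrite UE; apply/seteqP; split => w /= Bw.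
  by move=> i; rewrite /C; case: eqP => // ->.
by have := Bw j; rewrite /C eqxx.
Qed.

Lemma brownian_increment_symmetric (B : set R) : measurable B ->
  P (U @^-1` (-%R @^-1` B)) = P (U @^-1` B).
Proof.
move=> mB; rewrite !brownian_increment_law//.
  by rewrite normal_prob_opp// gt_eqF// sqrtr_gt0 subr_gt0.
by rewrite -[X in measurable X]setTI; apply: (@oppr_measurable R setT).
Qed.

Lemma brownian_increment_integral (f : R -> \bar R) :
  measurable_fun setT f -> (forall x, (0 <= f x)%E) ->
  (\int[P]_w f (U w) = \int[normal_prob 0 (Num.sqrt (t - s))]_x f x)%E.
Proof.
move=> mf f0; pose V : Omega -> measurableTypeR R := U.
have mV : measurable_fun setT V := measurable_brownian_increment.
rewrite -(@ge0_integral_pushforward _ _ _ _ _ _ mV P setT f)//.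
by apply: eq_measure_integral => A mA _; exact: brownian_increment_law.
Qed.

End brownian_increments.

Section elementary_integral.
Context {disp : measure_display} {Omega : measurableType disp} {R : realType}.
Variables (P : probability Omega R) (F : R -> set (set Omega)) (m : nat)
  (W : R -> Omega -> 'cV[R]_m).
Hypotheses (FU : usual_filtration P F) (WB : brownian_motion P F W).

(** The value of [V] on the cell []g l, g l.+1]] is read at the right end point but is measurable at
    the left one, as for a predictable process. The function [rho] is any majorant of
    [(E|V_s|^p)^(2/p)], so that callers may supply one that is easy to integrate. *)
Lemma elementary_integral_moment (p : R) : 2 <= p -> exists2 k : R, 0 < k &
  forall (g : nat -> R) (n : nat) (V : R -> Omega -> R) (j : 'I_m) (rho : R -> \bar R)
    (N B : R),
  0 <= g 0%N -> (forall l, (l < n)%N -> g l < g l.+1) ->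
  (forall l, (l < n)%N -> measurable_wrt (F (g l)) (V (g l.+1))) ->
  (forall l w, (l < n)%N -> `|V (g l.+1) w| <= N) ->
  measurable_fun `]g 0%N, g n] rho -> (forall s, (0 <= rho s)%E) ->
  (forall l s, (l < n)%N -> s \in `]g l, g l.+1] ->
    ((fine (\int[P]_w (`|V (g l.+1) w| `^ p)%:E) `^ (p / 2)^-1)%:E <= rho s)%E) ->
  0 < B -> (\int[lebesgue_measure]_(s in `]g 0%N, g n]) rho s <= B%:E)%E ->
  (\int[P]_w (`|\sum_(l < n) V (g l.+1) w * (W (g l.+1) w j 0 - W (g l) w j 0)%R| `^ p)%:E
     <= ((k * B) `^ (p / 2))%:E)%E.
Proof.
move=> p2; have [k k0 K] := martingale_transform_moment P p2.
have p0 : 0 < p by lra.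
have q0 : 0 < p / 2 by lra.
have q1 : p / 2 != 0 by rewrite gt_eqF.
have [c c0 hc] := @normal_abs_moment R p p0.
pose c' := c `^ (p / 2)^-1; have c'0 : 0 < c' by rewrite powR_gt0.
exists (1 + 2 * (k * c')); first by rewrite addr_gt0// !mulr_gt0.
move=> g n V j rho N B g0 gnd aV bV mrho rho0 Vrho B0 iB.
have g_le l1 l2 : (l1 <= l2 <= n)%N -> g l1 <= g l2.
  elim: l2 => [|l2 ih]; first by rewrite leqn0 => /andP[/eqP ->].
  move=> /andP[]; rewrite leq_eqVlt => /predU1P[-> //|l12 l2n].
  by rewrite (le_trans (ih _)) ?(ltW (gnd _ _))// -ltnS l12 ltnW.
have g_ge0 l : (l <= n)%N -> 0 <= g l by move=> ln; rewrite (le_trans g0)// g_le.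
pose M l := (\int[P]_w (`|V (g l.+1) w| `^ p)%:E)%E.
pose r l := fine (M l) `^ (p / 2)^-1.
have r0 l : 0 <= r l by rewrite powR_ge0.
have mV l : (l < n)%N -> measurable_fun setT (V (g l.+1)).
  move=> ln; apply: measurable_wrt_fun (aV l ln).
  by apply: (filtration_sub FU); apply: g_ge0; exact: ltnW.
have M0 l : (0 <= M l)%E by apply: integral_ge0 => w _; rewrite lee_fin powR_ge0.
have Mfin l : (l < n)%N -> M l = (r l `^ (p / 2))%:E.
  move=> ln; rewrite /r -powRrM mulVf// powRr1 ?fine_ge0// fineK// ge0_fin_numE//.
  apply: (@le_lt_trans _ _ (\int[P]_w (N `^ p)%:E)%E).
    apply: ge0_le_integral => //.
    - by apply/measurable_EFinP/measurable_abs_powR; exact: mV.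
    - move=> w _; rewrite lee_fin; have VN := bV l w ln.
      by apply: ge0_ler_powR; rewrite ?nnegrE ?(ltW p0)// (le_trans _ VN).
  by rewrite integral_cst//= probability_setT mule1 ltry.
have rB : \sum_(l < n) (g l.+1 - g l) * r l <= B.
  rewrite -lee_fin; apply: le_trans iB; apply: ler_sum_integral_cells => //.
  by move=> l ln; exact/ltW/gnd.
(* [e] serves as the offset of the martingale transform and makes every [v l] positive. Its
   denominator gives both [e <= B] and [e * (g n - g 0) <= B], so it costs only a constant
   factor. *)
pose e := B / (1 + (g n - g 0%N)).
have gn0 : 0 <= g n - g 0%N by rewrite subr_ge0 g_le// leq0n leqnn.
have e0 : 0 < e by rewrite divr_gt0// ltr_wpDr.
have eB : e <= B by rewrite ler_pdivrMr ?ltr_wpDr// ler_peMr ?lerDl// ltW.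
have egB : e * (g n - g 0%N) <= B.
  by rewrite /e mulrAC ler_pdivrMr ?ltr_wpDr// ler_wpM2l ?lerDr// ltW.
(* By independence [E|V U|^p] is at most [r^(p/2)] times the Gaussian moment
   [c (g l.+1 - g l)^(p/2)]. Taking the power [2/p] gives the factor [c' = c^(2/p)]. *)
pose v l := c' * ((g l.+1 - g l) * (r l + e)).
(* The martingale lemma wants a filtration indexed by all natural numbers; the grid is frozen after
   [n]. *)
pose gm l := g (minn l n).
have gmE l : (l <= n)%N -> gm l = g l by move=> /minn_idPl ln; rewrite /gm ln.
have gm_ge0 l : 0 <= gm l by apply: g_ge0; rewrite geq_minr.
have v0 l : (l < n)%N -> 0 < v l.
  by move=> ln; rewrite !mulr_gt0 ?subr_gt0 ?gnd// ltr_wpDl.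
have Uadapted l (ln : (l < n)%N) :=
  brownian_increment_adapted FU WB j (g_ge0 l (ltnW ln)) (gnd l ln).
have Uindep l (ln : (l < n)%N) :=
  brownian_increment_independent WB j (g_ge0 l (ltnW ln)) (gnd l ln).
have mU l (ln : (l < n)%N) :=
  measurable_brownian_increment FU WB j (g_ge0 l (ltnW ln)) (gnd l ln).
have H : (\int[P]_w (`|\sum_(l < n) V (g l.+1) w *
    (W (g l.+1) w j 0 - W (g l) w j 0)| `^ p)%:E <=
  ((e + k * \sum_(l < n) v l) `^ (p / 2))%:E)%E.
  apply: (K (fun l => F (gm l)) (fun l => V (g l.+1))
    (fun l w => W (g l.+1) w j 0 - W (g l) w j 0) v n) => //.
  - by move=> l; exact: (filtration_sigma_algebra FU (gm_ge0 l)).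
  - by move=> l; exact: (filtration_sub FU (gm_ge0 l)).
  - move=> l1 l2 l12; apply: (filtration_nondecreasing FU) => //.
    by apply: g_le; rewrite geq_minr andbT leq_min geq_minr andbT (leq_trans (geq_minl _ _) l12).
  - by move=> l ln; rewrite gmE ?(ltnW ln)//; exact: aV.
  - by move=> l ln; rewrite gmE//; exact: Uadapted.
  - by move=> l ln A D; rewrite gmE ?(ltnW ln)//; exact: Uindep.
  - move=> l ln D mD.
    exact: (brownian_increment_symmetric WB j (g_ge0 l (ltnW ln)) (gnd l ln)).
  - move=> l ln.
    under eq_integral do rewrite normrM powRM//.
    rewrite (independent_integralM (G := V (g l.+1))
      (U := fun w => W (g l.+1) w j 0 - W (g l) w j 0)
      (f := fun x => `|x| `^ p) (g := fun x => `|x| `^ p)) //.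
    + rewrite -/(M l) Mfin//.
      rewrite (brownian_increment_integral FU WB j (g_ge0 l (ltnW ln)) (gnd l ln)
        (f := fun x => (`|x| `^ p)%:E))//; last first.
        by apply/measurable_EFinP/measurable_abs_powR.
      have D0 : 0 < g l.+1 - g l by rewrite subr_gt0 gnd.
      apply: (@le_trans _ _ ((r l `^ (p / 2))%:E * (c * Num.sqrt (g l.+1 - g l) `^ p)%:E)%E).
        apply: lee_wpmul2l; first by rewrite lee_fin powR_ge0.
        by apply: hc; rewrite sqrtr_gt0.
      rewrite -EFinM lee_fin.
      have -> : Num.sqrt (g l.+1 - g l) `^ p = (g l.+1 - g l) `^ (p / 2).
        by rewrite -powR12_sqrt ?(ltW D0)// -powRrM mulrC.
      have -> : c = c' `^ (p / 2) by rewrite /c' -powRrM mulVf// powRr1// ltW.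
      have re0 : 0 <= r l + e by rewrite addr_ge0// ltW.
      rewrite /v (powRM _ (ltW c'0) (mulr_ge0 (ltW D0) re0)) (powRM _ (ltW D0) re0).
      have : r l `^ (p / 2) <= (r l + e) `^ (p / 2).
        by apply: ge0_ler_powR; rewrite ?nnegrE ?(ltW q0)// lerDl ltW.
      move: (r l `^ _) ((r l + e) `^ _) (powR_ge0 c' (p / 2))
        (powR_ge0 (g l.+1 - g l) (p / 2)) => x y cq0 gq0 xy.
      by rewrite mulrC -mulrA; apply: (ler_wpM2l cq0); apply: (ler_wpM2l gq0).
    + exact: mV.
    + exact: mU.
    + move=> A D mA mD; apply: Uindep => //.
      exact: aV.
    + exact: measurable_abs_powR.
    + exact: measurable_abs_powR.
apply: (le_trans H); rewrite lee_fin; apply: ge0_ler_powR.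
- exact: ltW.
- by rewrite nnegrE addr_ge0 ?(ltW e0)// mulr_ge0 ?(ltW k0)// sumr_ge0// => l _; rewrite ltW ?v0.
- by rewrite nnegrE !mulr_ge0 ?addr_ge0 ?mulr_ge0 ?(ltW B0) ?(ltW k0) ?(ltW c'0).
have -> : \sum_(l < n) v l = c' * (\sum_(l < n) (g l.+1 - g l) * r l + e * (g n - g 0%N)).
  rewrite /v -mulr_sumr; congr (_ * _).
  under eq_bigr do rewrite mulrDr.
  rewrite big_split/=; congr (_ + _).
  rewrite -mulr_suml mulrC; congr (_ * _).
  by rewrite -(big_mkord xpredT (fun l => g l.+1 - g l)) telescope_sumr.
rewrite mulrDl mul1r lerD// mulrA -[leRHS]mulrA -mulrA.
rewrite [leLHS]mulrA [leRHS](_ : _ = k * c' * (2 * B)); last by ring.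
by rewrite ler_wpM2l ?mulr_ge0 ?(ltW k0) ?(ltW c'0)//; lra.
Qed.

End elementary_integral.

(** Provides a common refinement of the break times. It must be strict because the law of a Brownian
    increment is prescribed for [s < t] only. *)
Lemma strict_grid_exists (R : realType) (T : R) (s : seq R) : 0 <= T ->
  (forall x, x \in s -> 0 <= x <= T) ->
  exists (g : nat -> R) (n : nat), [/\ g 0%N = 0, g n = T,
    forall l1 l2, (l1 < l2 <= n)%N -> g l1 < g l2 &
    forall x, x \in s -> exists2 l, (l <= n)%N & g l = x].
Proof.
move=> T0 sT; pose G := sort <=%R (undup [:: 0, T & s]).
have inG x : (x \in G) = (x \in [:: 0, T & s]) by rewrite mem_sort mem_undup.
have sG : sorted <%R G by rewrite sort_lt_sorted undup_uniq.
have G0 : (0 < size G)%N.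
  by rewrite lt0n size_eq0; apply/eqP => Gnil; have := inG 0; rewrite Gnil !inE eqxx.
pose g l := nth T G l; pose n := (size G).-1.
have nS : n.+1 = size G by rewrite prednK.
have mono l1 l2 : (l1 < l2 <= n)%N -> g l1 < g l2.
  move=> /andP[l12 l2n]; apply: (sorted_ltn_nth lt_trans) => //; rewrite inE -nS ltnS//.
  by rewrite (leq_trans (ltnW l12)).
have gG x : x \in G -> exists2 l, (l <= n)%N & g l = x.
  by move=> xG; exists (index x G); rewrite ?/g ?nth_index// -ltnS nS index_mem.
have gT l : (l <= n)%N -> 0 <= g l <= T.
  move=> ln; have : g l \in G by rewrite mem_nth// -nS ltnS.
  rewrite inG !inE => /or3P[/eqP ->|/eqP ->|/sT//]; by rewrite lexx T0.
exists g, n; split => //.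
- have [|l ln gl] := gG 0; first by rewrite inG inE eqxx.
  have [l0|l0] := posnP l; first by rewrite -gl l0.
  have := mono 0%N l; rewrite l0 ln => /(_ isT); rewrite gl ltNge.
  by have /andP[->] := gT 0%N (leq0n _).
- have [|l ln gl] := gG T; first by rewrite inG !inE eqxx orbT.
  move: ln; rewrite leq_eqVlt => /predU1P[ln|ln]; first by rewrite -ln.
  have := mono l n; rewrite ln leqnn => /(_ isT); rewrite gl ltNge.
  by have /andP[_ ->] := gT n (leqnn _).
- by move=> x xs; apply: gG; rewrite inG !inE xs !orbT.
Qed.

(** Clamping the index to [[a, b]] makes the terms outside the range zero and the whole sum an
    unrestricted telescoping one. *)
Lemma telescope_indicator (R : realType) (V : zmodType) (g : nat -> R) (n a b : nat)
    (f : R -> V) :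
  (forall l1 l2, (l1 < l2 <= n)%N -> g l1 < g l2) -> (a <= b <= n)%N ->
  \sum_(l < n | g a < g l.+1 <= g b) (f (g l.+1) - f (g l)) = f (g b) - f (g a).
Proof.
move=> gmono /andP[ab bn].
have gle l1 l2 : (l1 <= n)%N -> (l2 <= n)%N -> (g l1 <= g l2) = (l1 <= l2)%N.
  move=> l1n l2n; have [] := ltngtP l1 l2 => [l12|l21|->]; last by rewrite lexx.
    by rewrite ltW// gmono// l12.
  by rewrite leNgt gmono// l21.
pose c l := maxn a (minn l b).
transitivity (\sum_(l < n) (f (g (c l.+1)) - f (g (c l)))).
  rewrite big_mkcond/=; apply: eq_bigr => l _.
  have ln := ltn_ord l.
  rewrite ltNge !gle ?(leq_trans ab bn)// -ltnNge ltnS.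
  case: ifPn => [/andP[al lb]|].
    by rewrite /c (minn_idPl lb) (minn_idPl (ltnW lb)) (maxn_idPr al) (maxn_idPr (leqW al)).
  rewrite negb_and -!ltnNge => /orP[la|bl].
    rewrite /c !(maxn_idPl _) ?subrr//.
      by rewrite (leq_trans (geq_minl _ _))// ltnW.
    by rewrite (leq_trans (geq_minl _ _)).
  by rewrite ltnS in bl; rewrite /c (minn_idPr bl) (minn_idPr (leqW bl)) subrr.
rewrite -(big_mkord xpredT (fun l => f (g (c l.+1)) - f (g (c l)))) telescope_sumr//.
by rewrite /c min0n maxn0 (minn_idPr bn) (maxn_idPr ab).
Qed.

Section stopped_value.
Context {disp : measure_display} {Omega : measurableType disp} {R : realType}.
Variables (P : probability Omega R) (F : R -> set (set Omega)) (d m : nat).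
Hypothesis FU : usual_filtration P F.
Variable S : simple_process F d m.
Variable t : R.

(** The integrand that [simple_integral W S t] really integrates, as a process on the whole line: it
    agrees with [simple_value] up to [t] and is zero afterwards. This allows subtracting integrals
    that end at different times. *)
Definition stopped_value (s : R) (w : Omega) : 'M[R]_(d, m) :=
  \sum_(i < sp_size S)
    (if Num.min (sp_time S i) t < s <= Num.min (sp_time S i.+1) t
     then sp_coef S i w else 0).

Lemma stopped_value_le s w : s <= t -> stopped_value s w = simple_value S s w.
Proof.
move=> st; apply: eq_bigr => i _; rewrite indicE mem_setE in_itv/= gt_min le_min st andbT.
by rewrite [t < s]ltNge st orbF; case: ifP => _; rewrite ?scale1r ?scale0r.
Qed.

Lemma stopped_value_gt s w : t < s -> stopped_value s w = 0.
Proof.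
move=> ts; apply: big1 => i _; rewrite le_min [s <= t]leNgt ts andbF.
by rewrite andbF.
Qed.

Lemma stopped_value_bounded : exists N : R, forall s w i j, `|stopped_value s w i j| <= N.
Proof.
have [M HM] := sp_coef_bounded S; exists ((sp_size S)%:R * `|M|) => s w i j.
rewrite summxE (le_trans (ler_norm_sum _ _ _))//.
apply: (@le_trans _ _ (\sum_(l < sp_size S) `|M|)); last first.
  by rewrite sumr_const card_ord mulr_natl.
apply: ler_sum => l _; case: ifP => _; last by rewrite mxE normr0.
apply: (le_trans _ (le_trans (HM l w (ltn_ord l)) (ler_norm M))).
rewrite -(@sqrtr_sqr _ (sp_coef S l w i j)) /hsnorm ler_sqrt; last first.
  by rewrite sumr_ge0// => k _; rewrite sumr_ge0// => k' _; rewrite sqr_ge0.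
rewrite (bigD1 i)//= (bigD1 j)//= -addrA lerDl addr_ge0 ?sumr_ge0// => k _.
  by rewrite sqr_ge0.
by rewrite sumr_ge0// => k' _; rewrite sqr_ge0.
Qed.

Variables (g : nat -> R) (n : nat).
Hypothesis g0 : g 0%N = 0.
Hypothesis gmono : forall l1 l2, (l1 < l2 <= n)%N -> g l1 < g l2.
Hypothesis gS : forall i, (i <= sp_size S)%N ->
  exists2 l, (l <= n)%N & g l = Num.min (sp_time S i) t.

Let gle l1 l2 : (l1 <= n)%N -> (l2 <= n)%N -> (g l1 <= g l2) = (l1 <= l2)%N.
Proof.
move=> l1n l2n; have [] := ltngtP l1 l2 => [l12|l21|->]; last by rewrite lexx.
  by rewrite ltW// gmono// l12.
by rewrite leNgt gmono// l21.
Qed.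

Lemma stopped_value_cell l s w : (l < n)%N -> s \in `]g l, g l.+1] ->
  stopped_value s w = stopped_value (g l.+1) w.
Proof.
rewrite in_itv/= => ln /andP[ls sl]; apply: eq_bigr => i _.
have [a an ga] := gS (ltnW (ltn_ord i)); have [b bn gb] := gS (ltn_ord i).
congr (if _ then _ else _); rewrite -ga -gb; congr andb.
  apply/idP/idP => [h|]; first exact: lt_le_trans sl.
  by rewrite !ltNge gle// -!ltNge -leqNgt => al; apply: le_lt_trans ls; rewrite gle// ltnW.
apply/idP/idP => [h|]; last exact: le_trans.
by rewrite gle// ltnNge -gle ?(ltnW ln)// -ltNge (lt_le_trans ls).
Qed.

Lemma stopped_value_adapted l i j : (l < n)%N ->
  measurable_wrt (F (g l)) (fun w => stopped_value (g l.+1) w i j).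
Proof.
move=> ln.
have gl0 : 0 <= g l by rewrite -g0 gle// ltnW.
have sF := filtration_sigma_algebra FU gl0.
apply/(measurable_wrtP _ sF); rewrite /stopped_value.
under eq_fun do rewrite summxE.
apply: measurable_sum => k.
have [a an ga] := gS (ltnW (ltn_ord k)); have [b bn gb] := gS (ltn_ord k).
case: (boolP (_ < g l.+1 <= _)) => [|_]; last by under eq_fun do rewrite mxE; exact: measurable_cst.
rewrite -ga => /andP[al lb].
apply: (measurableT_comp (measurable_coord i j)); apply/(measurable_wrtP _ sF).
(* An active coefficient forces [g l.+1 <= t], so the bound of the minimum by [g l] cannot come from
   [t]. *)
have kl : sp_time S k <= g l.
  have : g a <= g l by rewrite gle ?(ltnW ln)// -ltnS ltnNge -gle// -ltNge.
  rewrite ga ge_min => /orP[//|tl].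
  have : g l.+1 <= t by rewrite (le_trans lb)// ge_min lexx orbT.
  by rewrite leNgt (le_lt_trans tl)// gmono// ltnSn.
apply: sub_measurable_wrt (sp_coef_adapted (ltn_ord k)).
apply: (filtration_nondecreasing FU) => //.
by rewrite (le_trans (sp_time_ge0 S))// sp_time_nondecreasing.
Qed.

(** Refining the partition leaves the integral unchanged, since each increment of [W] telescopes
    over the cells that it covers. *)
Lemma simple_integral_grid (W : R -> Omega -> 'cV[R]_m) w (k : 'I_d) :
  simple_integral W S t w k 0 =
  \sum_(j < m) \sum_(l < n)
    stopped_value (g l.+1) w k j * (W (g l.+1) w j 0 - W (g l) w j 0).
Proof.
rewrite /simple_integral summxE exchange_big/=.
transitivity (\sum_(l < n) \sum_(i < sp_size S) \sum_(j < m)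
   (if Num.min (sp_time S i) t < g l.+1 <= Num.min (sp_time S i.+1) t
     then sp_coef S i w k j * (W (g l.+1) w j 0 - W (g l) w j 0) else 0)); last first.
  apply: eq_bigr => l _; rewrite exchange_big/=; apply: eq_bigr => j _.
  rewrite summxE mulr_suml; apply: eq_bigr => i _.
  by case: ifP => // _; rewrite mxE mul0r.
rewrite exchange_big/=; apply: eq_bigr => i _; rewrite mxE exchange_big/=.
apply: eq_bigr => j _; rewrite !mxE.
have [a an ga] := gS (ltnW (ltn_ord i)); have [b bn gb] := gS (ltn_ord i).
rewrite -big_mkcond/= -mulr_sumr -ga -gb; congr (_ * _).
rewrite (telescope_indicator (fun s => W s w j 0) gmono)// bn andbT -gle// ga gb.
by rewrite le_min !ge_min lexx orbT andbT sp_time_nondecreasing.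
Qed.

End stopped_value.

(** * Truncation and limits *)

Section clamp.
Context {R : realType}.
Implicit Types N x y : R.

Definition clamp N x := Num.max (- N) (Num.min x N).

Lemma clamp_lipschitz N x y : 0 <= N -> `|clamp N x - clamp N y| <= `|x - y|.
Proof.
move=> N0; rewrite /clamp.
have h u v : u <= v -> 0 <= Num.max (- N) (Num.min v N) - Num.max (- N) (Num.min u N) <= v - u.
  by move=> uv; case: (leP u N) => uN; case: (leP v N) => vN; case: (leP (- N) u) => ?;
    case: (leP (- N) v) => ?; case: (leP (- N) N) => ?; apply/andP; split; lra.
have [xy|yx] := leP x y.
  have /andP[h1 h2] := h _ _ xy.
  by rewrite distrC [`|x - y|]distrC !ger0_norm ?subr_ge0// -subr_ge0.
have /andP[h1 h2] := h _ _ (ltW yx).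
by rewrite !ger0_norm ?subr_ge0 ?(ltW yx)// -subr_ge0.
Qed.

Lemma clamp_bounded N x : 0 <= N -> `|clamp N x| <= N.
Proof. by move=> N0; rewrite /clamp ler_norml; case: (leP x N) => ?;
  case: (leP (- N) x) => ?; case: (leP (- N) N) => ? //; do ?[apply/andP; split]; lra. Qed.

Lemma clamp_id N x : `|x| <= N -> clamp N x = x.
Proof.
by rewrite ler_norml /clamp => /andP[h1 h2]; case: (leP x N) => ?;
  case: (leP (- N) x) => ?; case: (leP (- N) N) => ? //; do ?[apply/andP; split]; lra.
Qed.

Lemma clamp0 N : 0 <= N -> clamp N 0 = 0.
Proof. by move=> N0; rewrite clamp_id// normr0. Qed.

Lemma le_clamp N x : 0 <= N -> `|clamp N x| <= `|x|.
Proof. by move=> N0; have := clamp_lipschitz x 0 N0; rewrite clamp0// !subr0. Qed.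

Lemma clamp_tail N x : 0 <= N -> `|x - clamp N x| <= `|x|.
Proof.
move=> N0; rewrite /clamp; case: (leP x N) => xN;
  case: (leP (- N) x) => h; case: (leP (- N) N) => h'; rewrite ?subrr ?normr0//; try lra.
- by rewrite opprK !ler0_norm; lra.
- by rewrite !ger0_norm; lra.
Qed.

Lemma measurable_clamp N : measurable_fun setT (clamp N).
Proof. by apply: measurable_maxr => //; exact: measurable_minr. Qed.

End clamp.

(* Truncating at a level [M] trades the [p]-th power of the error for its square. *)
Lemma ler_powR_minr (R : realType) (p M x z : R) : 2 <= p -> 0 <= M ->
  Num.min `|x| M `^ p <= 2 `^ p * `|z| `^ p + 4 * M `^ (p - 2) * `|x - z| `^ 2.
Proof.
move=> p2 M0; have p0 : 0 <= p by lra.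
have m0 : 0 <= Num.min `|x| M by rewrite le_min normr_ge0.
have [xz|zx] := leP `|x - z| `|z|.
  rewrite -[leLHS]addr0 lerD ?mulr_ge0 ?powR_ge0// -powRM//.
  apply: ge0_ler_powR; rewrite ?nnegrE ?mulr_ge0// ge_min; apply/orP; left.
  by rewrite -[X in `|X|](subrK z) (le_trans (ler_normD _ _))//; lra.
rewrite -[leLHS]add0r lerD ?mulr_ge0 ?powR_ge0//.
have [->|m1] := eqVneq (Num.min `|x| M) 0.
  by rewrite powR0 ?mulr_ge0 ?powR_ge0// gt_eqF//; lra.
have {1}-> : p = (p - 2) + 2 by ring.
rewrite powRD ?m1 ?implybT// mulrAC mulrC; apply: ler_pM; rewrite ?powR_ge0//.
  rewrite (_ : 4 = 2 `^ 2); last by rewrite powR_mulrn//; ring.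
  rewrite -powRM//; apply: ge0_ler_powR; rewrite ?nnegrE ?mulr_ge0// ge_min; apply/orP; left.
  by rewrite -[X in `|X| <= _](subrK z) (le_trans (ler_normD _ _))//; lra.
by apply: ge0_ler_powR; rewrite ?nnegrE// ?ge_min ?lexx ?orbT//; lra.
Qed.

Section Lp_closure.
Context {disp : measure_display} {Omega : measurableType disp} {R : realType}.
Variable P : probability Omega R.
Local Open Scope ereal_scope.

(** Truncating [f] at a level [n] replaces the passage to an almost everywhere convergent
    subsequence, at the price of the factor [2^p]. The approximant [z] is chosen after [n], and
    monotone convergence finally removes the level. *)
Lemma Lp_ball_closed_L2 (p A : R) (f : Omega -> R) : (2 <= p)%R ->
  measurable_fun setT f ->
  (forall e : R, (0 < e)%R -> exists z : Omega -> R,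
     [/\ measurable_fun setT z, \int[P]_w (`|z w| `^ p)%:E <= A%:E &
         \int[P]_w (`|f w - z w| `^ 2)%:E <= e%:E]) ->
  \int[P]_w (`|f w| `^ p)%:E <= (2 `^ p * A)%:E.
Proof.
move=> p2 mf H.
pose g (n : nat) w := (Num.min `|f w| n%:R `^ p)%:E.
have mg n : measurable_fun setT (g n).
  apply/measurable_EFinP; apply: (measurableT_comp (measurable_powR p)).
  by apply: measurable_minr => //; exact: measurableT_comp.
have p0 : (0 <= p)%R by lra.
have m0 w (n : nat) : (0 <= Num.min `|f w| n%:R)%R by rewrite le_min normr_ge0 ler0n.
have gmono w a b : (a <= b)%N -> g a w <= g b w.
  move=> ab; rewrite lee_fin; apply: ge0_ler_powR; rewrite ?nnegrE//.
  by rewrite le_min !ge_min lexx/= ler_nat ab orbT.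
have gA n : \int[P]_w g n w <= (2 `^ p * A)%:E.
  apply/lee_addgt0Pr => e e0.
  pose c := (4 * n%:R `^ (p - 2))%R.
  have c0 : (0 <= c)%R by rewrite mulr_ge0 ?powR_ge0.
  have e'0 : (0 < e / (c + 1))%R by rewrite divr_gt0// ltr_wpDl.
  have [z [mz zA fz]] := H _ e'0.
  have mz1 : measurable_fun setT (fun w => (`|z w| `^ p)%:E).
    exact/measurable_EFinP/measurable_abs_powR.
  have mz2 : measurable_fun setT (fun w => (`|f w - z w| `^ 2)%:E).
    by apply/measurable_EFinP/measurable_abs_powR/measurable_funB.
  apply: (@le_trans _ _ (\int[P]_w
    ((2 `^ p)%:E * (`|z w| `^ p)%:E + c%:E * (`|f w - z w| `^ 2)%:E))).
    apply: ge0_le_integral => //.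
    - by move=> w _; rewrite lee_fin powR_ge0.
    - by apply: emeasurable_funD; apply: emeasurable_funM.
    - by move=> w _; rewrite -!EFinM -EFinD lee_fin; exact: ler_powR_minr.
  rewrite ge0_integralD//;
    do ?[by move=> w _; rewrite -EFinM lee_fin mulr_ge0 ?powR_ge0|by apply: emeasurable_funM].
  rewrite !ge0_integralZl_EFin ?powR_ge0//;
    do ?[by move=> w _; rewrite lee_fin powR_ge0].
  apply: leeD; first by rewrite EFinM lee_wpmul2l// lee_fin powR_ge0.
  apply: (@le_trans _ _ (c%:E * (e / (c + 1))%:E)).
    by rewrite lee_wpmul2l.
  rewrite -EFinM lee_fin mulrA ler_pdivrMr ?ltr_wpDl// mulrC ler_wpM2l ?(ltW e0)//.
  by rewrite lerDl.
have gf w : g n w @[n --> \oo] --> (`|f w| `^ p)%:E.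
  apply: cvg_near_cst.
  exists `|Num.truncn `|f w| |.+1 => // n /= fn; rewrite /g; congr (_ `^ _)%:E.
  apply/min_idPl; apply: ltW.
  by apply: lt_le_trans (truncnS_gt _) _; rewrite ler_nat.
rewrite (_ : \int[P]_w _ = limn (fun n => \int[P]_w g n w)); last first.
  rewrite -monotone_convergence//.
  - by apply: eq_integral => w _; apply/esym/cvg_lim.
  - by move=> n w _; rewrite lee_fin powR_ge0.
  - by move=> w _ a b; exact: gmono.
apply: lime_le; last exact: nearW.
apply: ereal_nondecreasing_is_cvgn => a b ab; apply: ge0_le_integral => //.
  by move=> w _; rewrite lee_fin powR_ge0.
by move=> w _; exact: gmono.
Qed.

End Lp_closure.

Section tonelli_on_interval.
Context {disp : measure_display} {Omega : measurableType disp} {R : realType}.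
Variable P : probability Omega R.
Local Open Scope ereal_scope.
Variables (D : set R) (f : R * Omega -> \bar R).
Hypotheses (mD : measurable D) (mf : measurable_fun setT f) (f0 : forall z, 0 <= f z).

Lemma measurable_section_integral : measurable_fun D (fun s => \int[P]_w f (s, w)).
Proof.
apply: measurable_funTS.
exact: (@measurable_fun_fubini_tonelli_F _ _ (measurableTypeR R) _ _ P _ mf).
Qed.

(** Extending by zero reduces integrals over [D] to Tonelli's theorem on the full product space. *)
Let h := f \_ (D `*` setT).

Let mDT : measurable (D `*` [set: Omega]). Proof. exact: measurableX. Qed.

Let mh : measurable_fun setT h.
Proof. by apply/(measurable_restrictT _ _).1 => //; exact: measurable_funTS. Qed.

Let h0 z : 0 <= h z. Proof. exact: erestrict_ge0. Qed.

Let hE s : \int[P]_w h (s, w) = ((fun s => \int[P]_w f (s, w)) \_ D) s.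
Proof.
rewrite patchE; case: ifPn => [sD|sD].
  apply: eq_integral => w _; by rewrite /h patchE in_setX/= sD in_setT.
by rewrite integral0_eq// => w _; rewrite /h patchE in_setX/= (negbTE sD).
Qed.

Lemma tonelli_on : \int[P]_w \int[lebesgue_measure]_(s in D) f (s, w) =
  \int[lebesgue_measure]_(s in D) \int[P]_w f (s, w).
Proof.
have e := @fubini_tonelli _ _ (measurableTypeR R) _ R lebesgue_measure P h mh h0.
transitivity (\int[P]_y \int[lebesgue_measure]_x h (x, y)).
  apply: eq_integral => w _; rewrite integral_mkcond; apply: eq_integral => s _.
  by rewrite /h !patchE in_setX in_setT andbT.
rewrite -e; apply: esym; rewrite [LHS]integral_mkcond; apply: eq_integral => s _.
by rewrite hE.
Qed.

Lemma integral_prod_on :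
  \int[(lebesgue_measure : {measure set (measurableTypeR R) -> \bar R}) \x P]_(z in D `*` setT)
    f z =
  \int[lebesgue_measure]_(s in D) \int[P]_w f (s, w).
Proof.
rewrite [LHS]integral_mkcond.
rewrite (@fubini_tonelli1 _ _ (measurableTypeR R) _ R lebesgue_measure P h mh h0).
rewrite [RHS]integral_mkcond; apply: eq_integral => s _.
exact: hE.
Qed.

End tonelli_on_interval.

Section elementary_process.
Context {disp : measure_display} {Omega : measurableType disp} {R : realType}.
Variables (P : probability Omega R) (F : R -> set (set Omega)) (m : nat)
  (W : R -> Omega -> 'cV[R]_m).
Hypotheses (FU : usual_filtration P F) (WB : brownian_motion P F W).

(* [V] is an adapted process, constant on the cells of a grid of [[0, T]], and
   [J] is its integral [sum_j int_0^T V_j dW^j]. *)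
Definition elementary_process (T : R) (V : 'I_m -> R -> Omega -> R) (J : Omega -> R) :=
  exists (g : nat -> R) (n : nat),
  [/\ g 0%N = 0 /\ g n = T,
      forall l1 l2, (l1 < l2 <= n)%N -> g l1 < g l2,
      (forall l j, (l < n)%N -> measurable_wrt (F (g l)) (V j (g l.+1))) /\
      (forall l j s w, (l < n)%N -> s \in `]g l, g l.+1] -> V j s w = V j (g l.+1) w),
      exists N, forall j s w, `|V j s w| <= N &
      J = fun w => \sum_(j < m) \sum_(l < n)
            V j (g l.+1) w * (W (g l.+1) w j 0 - W (g l) w j 0)].

Lemma elementary_process_measurable T V J : elementary_process T V J ->
  measurable_fun setT J.
Proof.
move=> [g [n [[g0 gn] gmono [aV cV] bV ->]]].
have gl0 l : (l <= n)%N -> 0 <= g l.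
  by rewrite -g0; case: l => // l ln; rewrite ltW// gmono.
apply: measurable_sum => j; apply: measurable_sum => l.
have ln := ltn_ord l.
apply: measurable_funM.
  apply: measurable_wrt_fun (aV l j ln).
  by apply: (filtration_sub FU); apply: gl0; exact: ltnW.
apply: (measurable_brownian_increment FU WB j (gl0 l (ltnW ln))).
by apply: gmono; rewrite ltnSn.
Qed.

(** Truncation acts on the values, so the truncated process and the remainder are adapted and
    constant on the cells of the same grid, and their integrals add up to [J]. *)
Lemma elementary_process_clamp T V J N : 0 <= N -> elementary_process T V J ->
  exists J', elementary_process T (fun j s w => clamp N (V j s w)) J' /\
    elementary_process T (fun j s w => V j s w - clamp N (V j s w))
      (fun w => J w - J' w).
Proof.
move=> N0 [g [n [[g0 gn] gmono [aV cV] [M bV] ->]]].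
have gl0 l : (l <= n)%N -> 0 <= g l.
  by rewrite -g0; case: l => // l ln; rewrite ltW// gmono.
have aVF l j (ln : (l < n)%N) : measurable_fun setT
    (V j (g l.+1) : g_sigma_algebraType (F (g l)) -> R).
  apply/measurable_wrtP; last exact: aV.
  exact: (filtration_sigma_algebra FU (gl0 l (ltnW ln))).
have mc (l : nat) j (ln : (l < n)%N) : measurable_fun setT
    ((fun w => clamp N (V j (g l.+1) w)) : g_sigma_algebraType (F (g l)) -> R).
  by apply: (measurableT_comp (measurable_clamp N)); exact: aVF.
exists (fun w => \sum_(j < m) \sum_(l < n)
  clamp N (V j (g l.+1) w) * (W (g l.+1) w j 0 - W (g l) w j 0)); split;
  exists g, n; split => //.
- split => [l j ln|l j s w ln sl]; last by rewrite (cV l).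
  apply/measurable_wrtP; last exact: mc.
  exact: (filtration_sigma_algebra FU (gl0 l (ltnW ln))).
- by exists N => j s w; exact: clamp_bounded.
- split => [l j ln|l j s w ln sl]; last by rewrite (cV l).
  apply/measurable_wrtP; last by apply: measurable_funB; [exact: aVF|exact: mc].
  exact: (filtration_sigma_algebra FU (gl0 l (ltnW ln))).
- by exists M => j s w; rewrite (le_trans (clamp_tail _ N0)).
apply/funext => w; rewrite -sumrB; apply: eq_bigr => j _.
by rewrite -sumrB; apply: eq_bigr => l _; rewrite -mulrBl.
Qed.

Lemma elementary_process_moment (p : R) : 2 <= p -> exists2 k : R, 0 < k &
  forall T V J (rho : R -> \bar R) (B : R),
  elementary_process T V J ->
  measurable_fun `]0, T] rho -> (forall s, (0 <= rho s)%E) ->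
  (forall j s, s \in `]0, T] ->
    ((fine (\int[P]_w (`|V j s w| `^ p)%:E) `^ (p / 2)^-1)%:E <= rho s)%E) ->
  0 < B -> (\int[lebesgue_measure]_(s in `]0%R, T]) rho s <= B%:E)%E ->
  (\int[P]_w (`|J w| `^ p)%:E <= ((k * B) `^ (p / 2))%:E)%E.
Proof.
move=> p2; have [k k0 K] := elementary_integral_moment FU WB p2.
have p0 : 0 < p by lra.
have q0 : 0 < p / 2 by lra.
(* The cost of summing over the coordinates of [W]. The [+ 1] keeps it positive for [m = 0]; its
   power [2/p] can then be moved inside the bound as [c']. *)
pose c : R := (2 `^ p) ^+ m * m%:R + 1.
have c0 : 0 < c by rewrite ltr_wpDl// mulr_ge0// exprn_ge0// powR_ge0.
pose c' := c `^ (p / 2)^-1.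
have c'E : c' `^ (p / 2) = c.
  by rewrite /c' -powRrM mulVf ?gt_eqF// powRr1// ltW.
exists (c' * k); first by rewrite mulr_gt0// powR_gt0.
move=> T V J rho B EV mrho rho0 Vrho B0 iB.
have mJ := elementary_process_measurable EV.
move: EV mJ => [g [n [[g0 gn] gmono [aV cV] [M bV] ->]]] mJ.
have gl0 l : (l <= n)%N -> 0 <= g l.
  by rewrite -g0; case: l => // l ln; rewrite ltW// gmono.
have lnS l : (l < n)%N -> (l < l.+1 <= n)%N by move=> ->; rewrite ltnSn.
have mj j : measurable_fun setT (fun w => \sum_(l < n)
    V j (g l.+1) w * (W (g l.+1) w j 0 - W (g l) w j 0)).
  apply: measurable_sum => l; have ln := ltn_ord l; apply: measurable_funM.
    apply: measurable_wrt_fun (aV l j ln).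
    by apply: (filtration_sub FU); apply: gl0; exact: ltnW.
  apply: (measurable_brownian_increment FU WB j (gl0 l (ltnW ln))).
  by apply: gmono; exact: lnS.
have Kj j : (\int[P]_w (`|\sum_(l < n)
    V j (g l.+1) w * (W (g l.+1) w j 0 - W (g l) w j 0)%R| `^ p)%:E <=
    ((k * B) `^ (p / 2))%:E)%E.
  apply: (K g n (V j) j rho M B); rewrite ?g0 ?gn//.
  - by move=> l ln; apply: gmono; exact: lnS.
  - by move=> l; exact: aV.
  - move=> l s ln sl.
    rewrite (_ : V j (g l.+1) = V j s); last by apply/funext => w; rewrite (cV l).
    apply: Vrho; move: sl; rewrite !in_itv/= => /andP[ls sl].
    rewrite (le_lt_trans (gl0 l (ltnW ln)) ls)/= (le_trans sl)// -gn.
    by move: ln; rewrite leq_eqVlt => /predU1P[->//|ln]; rewrite ltW// gmono// ln/=.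
apply: (@le_trans _ _ (\int[P]_w (((2 `^ p) ^+ m)%:E * \sum_(j < m)
  (`|\sum_(l < n) V j (g l.+1) w * (W (g l.+1) w j 0 - W (g l) w j 0)%R| `^ p)%:E))%E).
  apply: ge0_le_integral => //;
    do ?[by move=> w _; rewrite lee_fin powR_ge0|exact/measurable_EFinP/measurable_abs_powR].
    apply: emeasurable_funM => //; apply: emeasurable_sum => j.
    exact/measurable_EFinP/measurable_abs_powR.
  by move=> w _; rewrite sumEFin -EFinM lee_fin; exact: ler_powR_sum.
rewrite ge0_integralZl_EFin ?exprn_ge0 ?powR_ge0//;
  do ?[by move=> w _; apply: sume_ge0 => j _; rewrite lee_fin powR_ge0|
       by apply: emeasurable_sum => j; exact/measurable_EFinP/measurable_abs_powR].
rewrite ge0_integral_sum//;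
  do ?[by move=> j; exact/measurable_EFinP/measurable_abs_powR|
       by move=> j w _; rewrite lee_fin powR_ge0].
apply: (@le_trans _ _ (((2 `^ p) ^+ m)%:E * \sum_(j < m) ((k * B) `^ (p / 2))%:E)%E).
  rewrite lee_wpmul2l ?lee_fin ?exprn_ge0 ?powR_ge0//.
  by apply: lee_sum => j _.
rewrite sumEFin sumr_const card_ord -EFinM lee_fin -mulrA.
rewrite [leRHS]powRM ?mulr_ge0 ?(ltW k0) ?(ltW B0) ?powR_ge0// c'E /c mulrDl mul1r.
by rewrite -[X in _ * X <= _]mulr_natl mulrA lerDl powR_ge0.
Qed.

End elementary_process.

Lemma cvge0_near (R : realType) (u : nat -> \bar R) (e : R) :
  (u n @[n --> \oo] --> 0)%E -> 0 < e -> \forall n \near \oo, (u n <= e%:E)%E.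
Proof.
move=> u0 e0; have e0' : (0 < e%:E)%E by rewrite lte_fin.
have h : \forall n \near \oo, (u n < e%:E)%E := u0 _ (open_ereal_lt' e0').
by near=> n; apply: ltW; near: n.
Unshelve. all: by end_near.
Qed.

Section ito_limit.
Context {disp : measure_display} {Omega : measurableType disp} {R : realType}.
Variables (P : probability Omega R).
Local Notation leb := (@lebesgue_measure R).

(** Dominated convergence on the product space: at each point the remainder is zero once [N >= |D|],
    and it never exceeds [|D|]. *)
Lemma clamp_tail_integral (A : set R) (D : R * Omega -> R) : measurable A ->
  measurable_fun setT D ->
  (\int[leb]_(s in A) \int[P]_w (`|D (s, w)| `^ 2)%:E < +oo)%E ->
  forall e : R, 0 < e -> \forall N \near \oo,
  (\int[leb]_(s in A) \int[P]_w (`|D (s, w) - clamp N%:R (D (s, w))| `^ 2)%:E <= e%:E)%E.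
Proof.
move=> mA mD D2 e e0.
have mD2 : measurable_fun setT (fun z => (`|D z| `^ 2)%:E).
  exact/measurable_EFinP/measurable_abs_powR.
have mT N : measurable_fun setT (fun z => (`|D z - clamp N%:R (D z)| `^ 2)%:E).
  apply/measurable_EFinP/measurable_abs_powR/measurable_funB => //.
  exact: (measurableT_comp (measurable_clamp _)).
have mAT : measurable (A `*` [set: Omega]) by exact: measurableX.
pose mu := ((leb : {measure set (measurableTypeR R) -> \bar R}) \x P)%E.
have cvgT : ((fun N => \int[mu]_(z in A `*` setT) (`|D z - clamp N%:R (D z)| `^ 2)%:E)
    @ \oo --> \int[mu]_(z in A `*` [set: Omega]) cst 0 z)%E.
  have [] := @dominated_convergence _ (measurableTypeR R * Omega)%type R mu (A `*` setT) mAT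
    (fun N z => (`|D z - clamp N%:R (D z)| `^ 2)%:E) (cst 0%E) (fun z => (`|D z| `^ 2)%:E) => //.
  - by move=> N; exact: measurable_funTS (mT N).
  - apply: aeW => z _; apply: cvg_near_cst.
    exists (Num.truncn `|D z|).+1 => // n /= Dn.
    rewrite clamp_id ?subrr ?normr0 ?powR0//.
    by apply/ltW/(lt_le_trans (truncnS_gt _)); rewrite ler_nat.
  - apply/integrableP; split; first exact: measurable_funTS.
    rewrite -[X in (X < _)%E](_ : (\int[mu]_(z in A `*` setT) (`|D z| `^ 2)%:E)%E = _).
      by rewrite integral_prod_on// => z; rewrite lee_fin powR_ge0.
    by apply: eq_integral => z _; rewrite gee0_abs// lee_fin powR_ge0.
  apply: aeW => z n _; rewrite gee0_abs ?lee_fin ?powR_ge0//.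
  apply: ge0_ler_powR; rewrite ?nnegrE//; exact: clamp_tail.
rewrite integral0 in cvgT.
near=> N; rewrite -[leLHS](@integral_prod_on _ _ _ P A
  (fun z => (`|D z - clamp N%:R (D z)| `^ 2)%:E) mA (mT N)); last first.
  by move=> z; rewrite lee_fin powR_ge0.
near: N; exact: cvge0_near.
Unshelve. all: by end_near.
Qed.

End ito_limit.

Section clamp_moment.
Context {disp : measure_display} {Omega : measurableType disp} {R : realType}.
Variable P : probability Omega R.

(* Truncation makes the [p]-th moment of the error small, because on bounded
   processes [|x|^p <= (2N)^(p-2) |x|^2]. *)
Lemma clamp_moment (p : R) : 2 <= p -> forall (V D : Omega -> R) (N : nat) (e K : R),
  measurable_fun setT V -> measurable_fun setT D -> 0 < e -> 0 <= K ->
  (\int[P]_w (`|D w| `^ p)%:E <= (K `^ (p / 2))%:E)%E ->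
  ((fine (\int[P]_w (`|clamp N%:R (V w)| `^ p)%:E) `^ (p / 2)^-1)%:E <=
    8%:E * (e%:E + (e `^ (1 - p / 2) * (2 * N%:R) `^ (p - 2) + 1)%:E *
       (\int[P]_w (`|V w - D w| `^ 2)%:E) + K%:E))%E.
Proof.
move=> p2 V D N e K mV mD e0 K0 DK.
have p0 : 0 < p by lra.
set q := p / 2; have q0 : 0 < q by rewrite /q; lra.
have q1 : 1 <= q by rewrite /q; lra.
have qi : 0 <= q^-1 by rewrite invr_ge0 ltW.
have qi1 : q^-1 <= 1 by rewrite invf_le1.
pose u := (\int[P]_w (`|V w - D w| `^ 2)%:E)%E.
have u0 : (0 <= u)%E by apply: integral_ge0 => w _; rewrite lee_fin powR_ge0.
(* The [+ 1] makes the coefficient positive even for [N = 0], so that an infinite [L^2] distance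
   gives an infinite right side. *)
have c0 : 0 < e `^ (1 - q) * (2 * N%:R) `^ (p - 2) + 1.
  by rewrite ltr_wpDl// mulr_ge0 ?powR_ge0.
have [uoo|ufin] := eqVneq u +oo%E.
  rewrite -/u uoo gt0_muley ?lte_fin// addey// addye// gt0_muley ?lte_fin//.
  by rewrite leey.
have uE : u = (fine u)%:E.
  by rewrite fineK// ge0_fin_numE// lt_neqAle ufin leey.
have mc (f : Omega -> R) : measurable_fun setT f ->
    measurable_fun setT (fun w => clamp N%:R (f w)).
  by move=> mf; apply: (measurableT_comp (measurable_clamp _)).
have M1 : (\int[P]_w (`|clamp N%:R (V w)| `^ p)%:E <=
   (2 `^ p)%:E * (((2 * N%:R) `^ (p - 2))%:E * u + (K `^ q)%:E))%E.
  have mu2 : measurable_fun setT (fun w => (`|V w - D w| `^ 2)%:E).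
    by apply/measurable_EFinP/measurable_abs_powR/measurable_funB.
  have mDp : measurable_fun setT (fun w => (`|D w| `^ p)%:E).
    exact/measurable_EFinP/measurable_abs_powR.
  apply: (@le_trans _ _ (\int[P]_w ((2 `^ p)%:E *
     (((2 * N%:R) `^ (p - 2))%:E * (`|V w - D w| `^ 2)%:E + (`|D w| `^ p)%:E)))%E).
    apply: ge0_le_integral => //;
      do ?[by move=> w _; rewrite lee_fin powR_ge0|
           by apply/measurable_EFinP/measurable_abs_powR; exact: mc].
      by apply: emeasurable_funM => //; apply: emeasurable_funD => //; apply: emeasurable_funM.
    - move=> w _; rewrite /= lee_fin.
      rewrite -[X in `|X|](subrK (clamp N%:R (D w))).
      apply: (le_trans (ler_powRD _ _ (ltW p0))); rewrite ler_wpM2l ?powR_ge0//.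
      apply: lerD; last first.
        by apply: ge0_ler_powR; rewrite ?nnegrE ?(ltW p0)// le_clamp.
      have [->|x0] := eqVneq (clamp N%:R (V w) - clamp N%:R (D w)) 0.
        by rewrite normr0 powR0 ?mulr_ge0 ?powR_ge0// gt_eqF.
      have {1}-> : p = (p - 2) + 2 by ring.
      rewrite powRD ?normr_eq0 ?x0 ?implybT//; apply: ler_pM; rewrite ?powR_ge0//.
        apply: ge0_ler_powR; rewrite ?nnegrE ?mulr_ge0 ?subr_ge0//.
        rewrite (le_trans (ler_normB _ _))// mulrDl mul1r.
        by apply: lerD; exact: clamp_bounded.
      by apply: ge0_ler_powR; rewrite ?nnegrE// clamp_lipschitz.
  rewrite ge0_integralZl_EFin ?powR_ge0//; do ?[
    by move=> w _; rewrite adde_ge0// ?mule_ge0// lee_fin powR_ge0|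
    by apply: emeasurable_funD => //; apply: emeasurable_funM].
  rewrite lee_wpmul2l ?lee_fin ?powR_ge0// ge0_integralD//; do ?[
    by move=> w _; rewrite ?mule_ge0// lee_fin powR_ge0|by apply: emeasurable_funM].
  rewrite ge0_integralZl_EFin ?powR_ge0//; do ?[by move=> w _; rewrite lee_fin powR_ge0].
  exact: leeD.
rewrite uE -!(EFinM, EFinD) in M1 *; rewrite -/u uE -!(EFinM, EFinD) lee_fin.
have M2 : fine (\int[P]_w (`|clamp N%:R (V w)| `^ p)%:E)%E <=
    2 `^ p * ((2 * N%:R) `^ (p - 2) * fine u + K `^ q).
  have I0 : (0 <= \int[P]_w (`|clamp N%:R (V w)| `^ p)%:E)%E.
    by apply: integral_ge0 => w _; rewrite lee_fin powR_ge0.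
  rewrite -lee_fin fineK// ge0_fin_numE//; apply: le_lt_trans M1 _.
  exact: ltry.
have V0 : 0 <= fine (\int[P]_w (`|clamp N%:R (V w)| `^ p)%:E)%E.
  by apply: fine_ge0; apply: integral_ge0 => w _; rewrite lee_fin powR_ge0.
move: (fine (\int[P]_w (`|clamp N%:R (V w)| `^ p)%:E)%E) M2 V0 => Vp M2 V0.
have fu0 : 0 <= fine u by rewrite fine_ge0.
have c1 : 0 <= (2 * N%:R) `^ (p - 2) * fine u by rewrite mulr_ge0 ?powR_ge0.
apply: (@le_trans _ _ ((2 `^ p * ((2 * N%:R) `^ (p - 2) * fine u + K `^ q)) `^ q^-1)).
  apply: ge0_ler_powR; rewrite ?nnegrE//.
  by rewrite mulr_ge0 ?addr_ge0 ?powR_ge0.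
rewrite powRM ?addr_ge0 ?powR_ge0//.
(* The constant [8] of the statement is [(2^p)^(2/p) = 4] times [2^(2/p) <= 2], one factor for each
   use of [ler_powRD]. *)
have -> : (2 `^ p) `^ q^-1 = 4 :> R.
  rewrite -powRrM (_ : p / q = 2); last by rewrite /q; field; rewrite gt_eqF.
  by rewrite powR_mulrn//; ring.
have h1 := @ler_powRD R ((2 * N%:R) `^ (p - 2) * fine u) (K `^ q) q^-1 qi.
rewrite ger0_norm ?addr_ge0 ?powR_ge0// !ger0_norm ?powR_ge0// in h1.
have h2 : 2 `^ q^-1 <= 2 :> R by rewrite ler1_powR// ler1n.
have h3 : (K `^ q) `^ q^-1 = K by rewrite -powRrM divff ?gt_eqF// powRr1.
rewrite h3 in h1.
have h4 := powRV_le_linear q1 e0 c1.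
have X0 := powR_ge0 ((2 * N%:R) `^ (p - 2) * fine u) q^-1.
have h5 : 2 `^ q^-1 * (((2 * N%:R) `^ (p - 2) * fine u) `^ q^-1 + K) <=
  2 * (e + (e `^ (1 - q) * (2 * N%:R) `^ (p - 2) + 1) * fine u + K).
  apply: ler_pM; rewrite ?powR_ge0 ?addr_ge0//.
  by rewrite lerD2r (le_trans h4)// lerD2l [leRHS]mulrDl mul1r -mulrA lerDl.
have := le_trans h1 h5; lra.
Qed.

End clamp_moment.

Lemma ge0_integral_lincomb (disp : measure_display) (T : measurableType disp)
    (R : realType) (mu : {measure set T -> \bar R}) (A : set T) (f g : T -> \bar R)
    (a b : R) :
  measurable A -> measurable_fun A f -> measurable_fun A g ->
  (forall x, (0 <= f x)%E) -> (forall x, (0 <= g x)%E) -> 0 <= a -> 0 <= b ->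
  (\int[mu]_(x in A) (a%:E * f x + b%:E * g x) =
   a%:E * (\int[mu]_(x in A) f x) + b%:E * \int[mu]_(x in A) g x)%E.
Proof.
move=> mA mf mg f0 g0 a0 b0.
rewrite ge0_integralD//; first by rewrite !ge0_integralZl_EFin.
- by move=> x _; rewrite mule_ge0.
- exact: measurable_funeM.
- by move=> x _; rewrite mule_ge0.
- exact: measurable_funeM.
Qed.

Lemma lincombe_ge0 (R : realType) (a b : R) (x y : \bar R) :
  0 <= a -> 0 <= b -> (0 <= x)%E -> (0 <= y)%E -> (0 <= a%:E * x + b%:E * y)%E.
Proof. by move=> a0 b0 x0 y0; rewrite adde_ge0// mule_ge0. Qed.

Section ito_limit_moment.
Context {disp : measure_display} {Omega : measurableType disp} {R : realType}.
Variables (P : probability Omega R) (F : R -> set (set Omega)) (m : nat)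
  (W : R -> Omega -> 'cV[R]_m).
Hypotheses (FU : usual_filtration P F) (WB : brownian_motion P F W).
Local Notation leb := (@lebesgue_measure R).

Let mpow (D : R * Omega -> R) (r : R) : measurable_fun setT D ->
  measurable_fun setT (fun z => (`|D z| `^ r)%:E).
Proof. by move=> mD; exact/measurable_EFinP/measurable_abs_powR. Qed.

Let mint (D : R * Omega -> R) (A : set R) (r : R) : measurable_fun setT D ->
  measurable_fun A (fun s => (\int[P]_w (`|D (s, w)| `^ r)%:E)%E).
Proof.
move=> mD; apply: (@measurable_section_integral _ _ _ P _ (fun z => (`|D z| `^ r)%:E)).
  exact: mpow.
by move=> z; rewrite lee_fin powR_ge0.
Qed.

Let mV1 (D : R * Omega -> R) s : measurable_fun setT D ->
  measurable_fun setT (fun w => D (s, w)).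
Proof. by move=> mD; apply: (measurableT_comp mD); exact: measurable_pair1. Qed.

(** The approximant handed to [Lp_ball_closed_L2] is the integral [J'] of [clamp N (V n)]. Its
    [p]-th moment is controlled by [clamp_moment]. It is close to [f] in [L^2] because the remainder
    of [V n] is close to that of [D], which is small for large [N]. *)
Lemma ito_limit_moment (p : R) : 2 <= p -> exists2 k : R, 0 < k &
  forall (T : R) (D : 'I_m -> R * Omega -> R) (V : nat -> 'I_m -> R * Omega -> R)
    (J : nat -> Omega -> R) (f : Omega -> R) (K : R -> R) (B : R),
  0 < T ->
  (forall j, measurable_fun setT (D j)) ->
  (forall n j, measurable_fun setT (V n j)) ->
  (forall n, elementary_process F W T (fun j s w => V n j (s, w)) (J n)) ->
  measurable_fun setT f ->
  (forall j, (\int[leb]_(s in `]0%R, T]) \int[P]_w (`|D j (s, w)| `^ 2)%:E < +oo)%E) ->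
  (forall e : R, 0 < e -> exists n,
    (forall j, (\int[leb]_(s in `]0%R, T])
       \int[P]_w (`|V n j (s, w) - D j (s, w)| `^ 2)%:E <= e%:E)%E) /\
    (\int[P]_w (`|J n w - f w| `^ 2)%:E <= e%:E)%E) ->
  measurable_fun `]0%R, T] K -> (forall s, s \in `]0%R, T] -> 0 <= K s) ->
  (forall j s, s \in `]0%R, T] ->
     (\int[P]_w (`|D j (s, w)| `^ p)%:E <= (K s `^ (p / 2))%:E)%E) ->
  0 < B -> (\int[leb]_(s in `]0%R, T]) (K s)%:E <= B%:E)%E ->
  (\int[P]_w (`|f w| `^ p)%:E <= ((k * B) `^ (p / 2))%:E)%E.
Proof.
move=> p2.
have [k k0 HK] := elementary_process_moment FU WB p2.
(* The estimate at exponent [2] stands in for the Ito isometry when the integrals of [V n] and of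
   its truncation are compared. *)
have [k2 k20 HK2] := elementary_process_moment FU WB (lexx 2).
have p0 : 0 < p by lra.
(* The [4] becomes [4^(p/2) = 2^p], the loss in [Lp_ball_closed_L2]. The [24] is the [8] of
   [clamp_moment] times three terms that each integrate to at most [B]. *)
exists (4 * (k * 24)); first by rewrite !mulr_gt0.
move=> T D V J f K B T0 mD mV EV mf D2 lim mK K0 DK B0 iK.
rewrite -mulrA (powRM _ (ler0n _ 4)) ?mulr_ge0 ?(ltW k0) ?(ltW B0)//.
have -> : 4 `^ (p / 2) = 2 `^ p :> R.
  have {1}-> : 4 = 2 `^ 2 :> R by rewrite powR_mulrn//; ring.
  by rewrite -powRrM mulrCA divff// mulr1.
apply: Lp_ball_closed_L2 => // e e0.
have mJ n := elementary_process_measurable FU WB (EV n).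
pose u n j s := (\int[P]_w (`|V n j (s, w) - D j (s, w)| `^ 2)%:E)%E.
pose z (N : nat) j s := (\int[P]_w (`|D j (s, w) - clamp N%:R (D j (s, w))| `^ 2)%:E)%E.
have mVD n j : measurable_fun setT (fun x => V n j x - D j x) by exact: measurable_funB.
have mcl (N : nat) (g : R * Omega -> R) : measurable_fun setT g ->
    measurable_fun setT (fun x => clamp N%:R (g x)).
  by move=> mg; apply: (measurableT_comp (measurable_clamp _)).
have mDc (N : nat) j : measurable_fun setT (fun x => D j x - clamp N%:R (D j x)).
  by apply: measurable_funB => //; exact: mcl.
have mu n j A : measurable_fun A (u n j) := @mint _ A 2 (mVD n j).
have mz N j A : measurable_fun A (z N j) := @mint _ A 2 (mDc N j).
have u0 n j s : (0 <= u n j s)%E.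
  by apply: integral_ge0 => w _; rewrite lee_fin powR_ge0.
have z0 N j s : (0 <= z N j s)%E.
  by apply: integral_ge0 => w _; rewrite lee_fin powR_ge0.
(* Chosen so that the final error [4 * eta0 + 4 * k2 * 20 * (m + 1) * eta0] equals [e]. *)
pose eta0 := e / (4 + 80 * k2 * (m%:R + 1)).
have den0 : 0 < 4 + 80 * k2 * (m%:R + 1).
  by rewrite addr_gt0// !mulr_gt0// ltr_wpDl.
have eta00 : 0 < eta0 by rewrite divr_gt0.
have [N HN] : exists N : nat, forall j,
    (\int[leb]_(s in `]0%R, T]) z N j s <= eta0%:E)%E.
  have h : \forall N \near \oo, forall j,
      (\int[leb]_(s in `]0%R, T]) z N j s <= eta0%:E)%E.
    by apply: filter_forall => j; exact: clamp_tail_integral.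
  by have [N _ h'] := h; exists N; apply: h' => /=.
(* The constant [ep] integrates to [B] over []0, T]]. *)
pose ep := B / T.
have ep0 : 0 < ep by rewrite divr_gt0.
pose c := ep `^ (1 - p / 2) * (2 * N%:R) `^ (p - 2) + 1.
have c0 : 0 < c by rewrite ltr_wpDl// mulr_ge0 ?powR_ge0.
(* The coefficient [c] grows with the level [N], which is fixed by now. The second entry gives
   [c * m * eta <= B], and the index [n] is picked last. *)
pose eta := Num.min eta0 (B / (c * (m%:R + 1))).
have m10 : 0 < m%:R + 1 :> R by rewrite ltr_wpDl.
have eta_gt0 : 0 < eta by rewrite lt_min eta00 divr_gt0// mulr_gt0.
have [n [Hu Hf]] := lim _ eta_gt0.
have [J' [EJ' EJJ']] := elementary_process_clamp FU (ler0n R N) (EV n).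
have mJ' := elementary_process_measurable FU WB EJ'.
exists J'; split => //.
(* One majorant serves all coordinates [j], hence the sum. The absolute value is there because [K]
   is known to be nonnegative on []0, T]] only. *)
- pose rho s := (8%:E * (ep%:E + c%:E * (\sum_(j < m) u n j s)) + 8%:E * `|K s|%:E)%E.
  have su0 s : (0 <= \sum_(j < m) u n j s)%E by apply: sume_ge0.
  have msu A : measurable_fun A (fun s => \sum_(j < m) u n j s)%E.
    by apply: emeasurable_sum => j; exact: mu.
  have mr1 : measurable_fun `]0, T] (fun s => 8%:E * (ep%:E + c%:E * (\sum_(j < m) u n j s)))%E.
    apply: emeasurable_funM => //; apply: emeasurable_funD => //.
    by apply: emeasurable_funM.
  have mr2 : measurable_fun `]0, T] (fun s => 8%:E * `|K s|%:E)%E.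
    by apply: emeasurable_funM => //; apply/measurable_EFinP; exact: measurableT_comp.
  have r10 s : (0 <= 8%:E * (ep%:E + c%:E * (\sum_(j < m) u n j s)))%E.
    by rewrite mule_ge0// adde_ge0 ?lee_fin ?(ltW ep0)// mule_ge0// lee_fin ltW.
  have r20 s : (0 <= 8%:E * `|K s|%:E)%E by rewrite mule_ge0.
  rewrite -[k * 24 * B]mulrA; apply: (HK T _ J' rho (24 * B) EJ') => //.
  + exact: emeasurable_funD.
  + by move=> s; rewrite adde_ge0.
  + move=> j s sT.
    apply: (le_trans (@clamp_moment _ _ _ P p p2 (fun w => V n j (s, w))
      (fun w => D j (s, w)) N ep (K s) _ _ ep0 (K0 s sT) (DK j s sT))).
    * exact: mV1.
    * exact: mV1.
    rewrite -/c -/(u n j s) /rho ger0_norm ?K0// -muleDr//; last first.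
      by rewrite ge0_adde_def// inE ?lee_fin ?K0// adde_ge0 ?lee_fin ?(ltW ep0)// mule_ge0// lee_fin ltW.
    rewrite lee_wpmul2l//; apply: leeD => //; apply: leeD => //.
    rewrite lee_wpmul2l ?lee_fin ?(ltW c0)// (bigD1 j)//= leeDl//.
    exact: sume_ge0.
  + by rewrite mulr_gt0.
  have mcs A : measurable_fun A (fun s => c%:E * (\sum_(j < m) u n j s))%E.
    by apply: emeasurable_funM.
  have cs0 s : (0 <= c%:E * (\sum_(j < m) u n j s))%E by rewrite mule_ge0// lee_fin ltW.
  have mKe : measurable_fun `]0, T] (fun s => `|K s|%:E).
    by apply/measurable_EFinP; exact: measurableT_comp.
  rewrite ge0_integralD// !ge0_integralZl_EFin//; do ?[
    by apply: emeasurable_funD => //; exact: mcs|by move=> s _; rewrite adde_ge0// lee_fin ltW].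
  rewrite ge0_integralD//; do ?[by move=> s _; rewrite lee_fin ltW|exact: mcs].
  rewrite ge0_integralZl_EFin ?(ltW c0)//; do ?[exact: msu].
  rewrite (@ge0_integral_sum _ _ R leb _ _ _ (u n))//; do ?[by move=> j; exact: mu].
  rewrite integral_cst//= lebesgue_measure_itv/= lte_fin T0 oppr0 adde0.
  have h1 : (\sum_(j < m) \int[leb]_(s in `]0%R, T]) u n j s <= (m%:R * eta)%:E)%E.
    rewrite mulr_natl -[X in (_ *+ X)%R]card_ord -sumr_const -sumEFin.
    by apply: lee_sum => j _; exact: Hu.
  have h2 : (\int[leb]_(s in `]0%R, T]) `|K s|%:E <= B%:E)%E.
    apply: le_trans iK; rewrite le_eqVlt; apply/orP; left; apply/eqP.
    by apply: eq_integral => s; rewrite inE => sT; rewrite ger0_norm ?K0.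
  apply: (@le_trans _ _ (8%:E * (ep%:E * T%:E + c%:E * (m%:R * eta)%:E) + 8%:E * B%:E)%E).
    apply: leeD; apply: lee_wpmul2l => //; apply: leeD => //.
    by rewrite lee_wpmul2l// lee_fin ltW.
  rewrite -!(EFinM, EFinD) lee_fin.
  have -> : ep * T = B by rewrite /ep divfK ?gt_eqF.
  have h3 : c * (m%:R * eta) <= B.
    apply: (@le_trans _ _ (c * ((m%:R + 1) * (B / (c * (m%:R + 1)))))).
      rewrite ler_wpM2l ?(ltW c0)//; apply: ler_pM; rewrite ?(ltW eta_gt0)//.
        by rewrite lerDl.
      by rewrite ge_min lexx orbT.
    by rewrite le_eqVlt; apply/orP; left; apply/eqP; field; rewrite !gt_eqF.
  lra.
have HJJ : (\int[P]_w (`|J n w - J' w| `^ 2)%:E <= (k2 * (20 * (m%:R + 1) * eta0))%:E)%E.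
  (* The coefficients in [|V - clamp V|^2 <= 16 |V - D|^2 + 4 |D - clamp D|^2], which holds because
     [clamp] is 1-Lipschitz. Their sum is the [20] in the bound. *)
  have [c1 c1E] : {c : R | c = 16} by exists 16.
  have [c2 c2E] : {c : R | c = 4} by exists 4.
  have c10 : 0 <= c1 by rewrite c1E.
  have c20 : 0 <= c2 by rewrite c2E.
  pose rr j s := (c1%:E * u n j s + c2%:E * z N j s)%E.
  pose rho s := (\sum_(j < m) rr j s)%E.
  have m20 : 0 < 20 * (m%:R + 1) * eta0.
    by apply: mulr_gt0 eta00; apply: mulr_gt0 m10.
  have r0 j s : (0 <= rr j s)%E.
    exact: (lincombe_ge0 c10 c20 (u0 n j s) (z0 N j s)).
  have mr j A : measurable_fun A (rr j).
    by apply: emeasurable_funD; apply: measurable_funeM; [exact: mu|exact: mz].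
  rewrite -[leRHS]/(_%:E) -[X in X%:E](powRr1 (ltW (mulr_gt0 k20 m20))).
  rewrite -[X in _ `^ X](@divff R 2)//.
  apply: (HK2 T _ _ rho _ EJJ') => //.
  + exact: emeasurable_sum.
  + by move=> s; exact: sume_ge0.
  + move=> j s sT; rewrite divff// invr1 powRr1; last first.
      by rewrite fine_ge0// integral_ge0// => w _; rewrite lee_fin powR_ge0.
    have mR : measurable_fun setT (fun x => V n j x - clamp N%:R (V n j x)).
      by apply: measurable_funB => //; exact: mcl.
    apply: (@le_trans _ _ (\int[P]_w (`|V n j (s, w) - clamp N%:R (V n j (s, w))| `^ 2)%:E)%E).
      have : (0 <= \int[P]_w (`|V n j (s, w) - clamp N%:R (V n j (s, w))| `^ 2)%:E)%E.
        by apply: integral_ge0 => w _; rewrite lee_fin powR_ge0.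
      case: (\int[P]_w _)%E => [r| |]//=.
    apply: (@le_trans _ _ (c1%:E * u n j s + c2%:E * z N j s)%E); last first.
      by rewrite /rho (bigD1 j)//= leeDl// sume_ge0.
    have mus : measurable_fun setT (fun w => (`|V n j (s, w) - D j (s, w)| `^ 2)%:E).
      by apply/measurable_EFinP/measurable_abs_powR; exact: mV1 (mVD n j).
    have mzs : measurable_fun setT (fun w => (`|D j (s, w) - clamp N%:R (D j (s, w))| `^ 2)%:E).
      by apply/measurable_EFinP/measurable_abs_powR; exact: mV1 (mDc N j).
    have mrs : measurable_fun setT (fun w => (`|V n j (s, w) - clamp N%:R (V n j (s, w))| `^ 2)%:E).
      by apply/measurable_EFinP/measurable_abs_powR; exact: mV1 mR.
    rewrite /u /z -ge0_integral_lincomb//; do ?[by move=> w; rewrite lee_fin powR_ge0].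
    apply: ge0_le_integral => //;
      do ?[by move=> w _; rewrite lee_fin powR_ge0|
           by apply: emeasurable_funD; apply: emeasurable_funM].
    move=> w _; rewrite /= lee_fin.
    set a := V n j (s, w); set b := D j (s, w).
    rewrite (_ : a - clamp _ a = ((a - b) + (clamp N%:R b - clamp N%:R a)) + (b - clamp N%:R b)); last by ring.
    rewrite !(powR_mulrn 2)// !real_normK ?num_real//.
    have h : (clamp N%:R b - clamp N%:R a) ^+ 2 <= (a - b) ^+ 2.
      rewrite -(real_normK (num_real (a - b))) -(real_normK (num_real (_ - clamp _ a))).
      by rewrite ler_sqr ?nnegrE// distrC clamp_lipschitz.
    move: (clamp N%:R b - clamp N%:R a) (a - b) (b - clamp N%:R b) h => x y t h.
    have := sqr_ge0 (x - y); have := sqr_ge0 (x + y - t); rewrite c1E c2E; nra.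
  rewrite (@ge0_integral_sum _ _ R leb _ _ _ rr)//; do ?[by move=> j; exact: mr].
  rewrite -[leRHS]/((20 * (m%:R + 1) * eta0)%:E).
  apply: (@le_trans _ _ (\sum_(j < m) (20 * eta0)%:E)%E).
    apply: lee_sum => j _.
    rewrite /rr (@ge0_integral_lincomb _ (measurableTypeR R) R leb _ (u n j) (z N j)
      c1 c2 (measurable_itv _) (mu n j _) (mz N j _) (u0 n j) (z0 N j) c10 c20).
    apply: (@le_trans _ _ (c1%:E * eta0%:E + c2%:E * eta0%:E)%E).
      apply: leeD; apply: lee_wpmul2l => //.
      by apply: (le_trans (Hu j)); rewrite lee_fin ge_min lexx.
    by rewrite -!EFinM -EFinD lee_fin c1E c2E; lra.
  rewrite sumEFin sumr_const card_ord lee_fin -[leLHS]mulr_natl mulrA [leRHS]mulrAC.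
  rewrite [m%:R * 20]mulrC [leRHS]mulrAC ler_wpM2r ?(ltW eta00)//.
  by rewrite ler_wpM2l ?lerDl.
have m1 : measurable_fun setT (fun w => (`|J n w - f w| `^ 2)%:E).
  by apply/measurable_EFinP/measurable_abs_powR/measurable_funB.
have m2 : measurable_fun setT (fun w => (`|J n w - J' w| `^ 2)%:E).
  by apply/measurable_EFinP/measurable_abs_powR/measurable_funB.
apply: (@le_trans _ _ (\int[P]_w (4%:E * (`|J n w - f w| `^ 2)%:E
   + 4%:E * (`|J n w - J' w| `^ 2)%:E))%E).
  apply: ge0_le_integral => //;
    do ?[by move=> w _; rewrite lee_fin powR_ge0|
         by apply: emeasurable_funD; apply: emeasurable_funM|
         by apply/measurable_EFinP/measurable_abs_powR/measurable_funB].
  move=> w _; rewrite /= lee_fin.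
  rewrite !(powR_mulrn 2)// !real_normK ?num_real//.
  have := sqr_ge0 ((J n w - f w) + (J n w - J' w)).
  have := sqr_ge0 (J n w - f w); have := sqr_ge0 (J n w - J' w); lra.
rewrite ge0_integral_lincomb//; do ?[by move=> w; rewrite lee_fin powR_ge0].
apply: (@le_trans _ _ (4%:E * eta0%:E + 4%:E * (k2 * (20 * (m%:R + 1) * eta0))%:E)%E).
  apply: leeD; apply: lee_wpmul2l => //.
  by apply: (le_trans Hf); rewrite lee_fin ge_min lexx.
rewrite -!EFinM -EFinD lee_fin le_eqVlt; apply/orP; left; apply/eqP.
by rewrite /eta0; field; rewrite gt_eqF.
Qed.

End ito_limit_moment.

(** * Increments of Ito integrals *)

Section hsnorm_lemmas.
Context {R : realType} (d m : nat).
Implicit Types A : 'M[R]_(d, m).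

Lemma sqr_hsnorm A : hsnorm A ^+ 2 = \sum_(i < d) \sum_(j < m) A i j ^+ 2.
Proof.
by rewrite sqr_sqrtr// sumr_ge0// => i _; rewrite sumr_ge0// => j _; rewrite sqr_ge0.
Qed.

Lemma hsnorm_ge0 A : 0 <= hsnorm A. Proof. exact: sqrtr_ge0. Qed.

Lemma sqr_coord_hsnorm A i j : A i j ^+ 2 <= hsnorm A ^+ 2.
Proof.
rewrite sqr_hsnorm (bigD1 i)//= (bigD1 j)//= -addrA lerDl addr_ge0 ?sumr_ge0// => k _.
  by rewrite sqr_ge0.
by rewrite sumr_ge0// => k' _; rewrite sqr_ge0.
Qed.

Lemma ler_coord_hsnorm A i j : `|A i j| <= hsnorm A.
Proof.
rewrite -[leRHS]ger0_norm ?hsnorm_ge0//.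
by rewrite -ler_sqr ?nnegrE// !real_normK ?num_real// sqr_coord_hsnorm.
Qed.

Lemma hsnorm_le_sum A : hsnorm A <= \sum_(i < d) \sum_(j < m) `|A i j|.
Proof.
have s0 : 0 <= \sum_(i < d) \sum_(j < m) `|A i j|.
  by rewrite sumr_ge0// => i _; rewrite sumr_ge0.
rewrite -[leLHS]ger0_norm ?hsnorm_ge0// -[leRHS]ger0_norm//.
rewrite -ler_sqr ?nnegrE// !real_normK ?num_real// sqr_hsnorm.
have h (n : nat) (f : 'I_n -> R) : (forall i, 0 <= f i) ->
    \sum_(i < n) f i ^+ 2 <= (\sum_(i < n) f i) ^+ 2.
  elim: n f => [|n ih] f f0; first by rewrite !big_ord0 expr0n.
  rewrite !big_ord_recr/=.
  have := ih (fun i => f (widen_ord (leqnSn n) i)) (fun i => f0 _).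
  have : 0 <= \sum_(i < n) f (widen_ord (leqnSn n) i) by apply: sumr_ge0.
  have := f0 ord_max; nra.
apply: le_trans (h _ _ _) => [|i]; last exact: sumr_ge0.
apply: ler_sum => i _; apply: le_trans (h _ _ _) => //.
by rewrite le_eqVlt; apply/orP; left; apply/eqP; apply: eq_bigr => j _;
  rewrite real_normK ?num_real.
Qed.

Lemma measurable_sqr_hsnorm (disp : measure_display) (T : measurableType disp)
    (D : set T) (G : T -> 'M[R]_(d, m)) :
  (forall i j, measurable_fun D (fun x => G x i j)) ->
  measurable_fun D (fun x => hsnorm (G x) ^+ 2).
Proof.
move=> mG; under eq_fun do rewrite sqr_hsnorm.
by apply: measurable_sum => i; apply: measurable_sum => j; exact: measurable_funX.
Qed.

End hsnorm_lemmas.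

Section ito_increment.
Context {disp : measure_display} {Omega : measurableType disp} {R : realType}.
Variables (P : probability Omega R) (F : R -> set (set Omega)) (d m : nat)
  (W : R -> Omega -> 'cV[R]_m).
Hypotheses (FU : usual_filtration P F) (WB : brownian_motion P F W).
Local Notation leb := (@lebesgue_measure R).

Lemma measurable_sp_coef (S : simple_process F d m) l : (l < sp_size S)%N ->
  forall i j, measurable_fun setT (fun w => sp_coef S l w i j).
Proof.
move=> lS i j; apply: (measurableT_comp (measurable_coord i j)).
apply: (@measurable_wrt_fun _ Omega _ _ (F (sp_time S l))); last exact: sp_coef_adapted.
apply: (filtration_sub FU); rewrite (le_trans (sp_time_ge0 S))//.
exact: sp_time_nondecreasing.
Qed.

Lemma measurable_simple_value (S : simple_process F d m) i j :
  measurable_fun setT (fun z : R * Omega => simple_value S z.1 z.2 i j).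
Proof.
rewrite /simple_value; under eq_fun do rewrite summxE.
apply: measurable_sum => l; under eq_fun do rewrite mxE.
apply: measurable_funM.
  have mI (A : set R) : measurable A -> measurable_fun setT (fun z : R * Omega => \1_A z.1 : R).
    move=> mA; have mf : measurable_fun setT (\1_A : R -> R) by exact: measurable_indic.
    exact: (measurableT_comp mf measurable_fst).
  by apply: mI.
exact: (measurableT_comp (measurable_sp_coef (ltn_ord l) i j) measurable_snd).
Qed.

Lemma measurable_stopped_value (S : simple_process F d m) t i j :
  measurable_fun setT (fun z : R * Omega => stopped_value S t z.1 z.2 i j).
Proof.
rewrite (_ : (fun _ => _) = fun z : R * Omega => \sum_(l < sp_size S)
    \1_(`]Num.min (sp_time S l) t, Num.min (sp_time S l.+1) t]%classic) z.1 *
    sp_coef S l z.2 i j); last first.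
  apply/funext => z; rewrite /stopped_value summxE; apply: eq_bigr => l _.
  rewrite indicE mem_setE in_itv/=.
  by case: ifP => _; rewrite ?mul1r// mul0r mxE.
apply: measurable_sum => l; apply: measurable_funM.
  have mI (A : set R) : measurable A -> measurable_fun setT (fun z : R * Omega => \1_A z.1 : R).
    move=> mA; have mf : measurable_fun setT (\1_A : R -> R) by exact: measurable_indic.
    exact: (measurableT_comp mf measurable_fst).
  by apply: mI.
exact: (measurableT_comp (measurable_sp_coef (ltn_ord l) i j) measurable_snd).
Qed.

Lemma measurable_simple_integral (S : simple_process F d m) t i : 0 <= t ->
  measurable_fun setT (fun w => simple_integral W S t w i 0).
Proof.
move=> t0; rewrite /simple_integral; under eq_fun do rewrite summxE.
apply: measurable_sum => l; under eq_fun do rewrite mxE.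
have mW s (j : 'I_m) : 0 <= s -> measurable_fun setT (fun w => W s w j 0).
  move=> s0; apply: (measurableT_comp (measurable_coord j 0)).
  by apply: measurable_wrt_fun (bm_adapted WB s0); exact: (filtration_sub FU).
have tau0 k : 0 <= Num.min (sp_time S k) t.
  by rewrite le_min t0 andbT (le_trans (sp_time_ge0 S))// sp_time_nondecreasing.
apply: measurable_sum => j; under eq_fun do rewrite !mxE.
apply: measurable_funM; first exact: (measurable_sp_coef (ltn_ord l)).
by apply: measurable_funB; exact: mW.
Qed.

(** Extension by zero: integrands over [[0, t]] and over [[0, t']] become functions on one space and
    can be subtracted. *)
Definition restricted_entry (G : R -> Omega -> 'M[R]_(d, m)) (t : R) (i : 'I_d) (j : 'I_m) :=
  (fun z : R * Omega => G z.1 z.2 i j) \_ (`[0, t] `*` setT).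

Lemma restricted_entryE (G : R -> Omega -> 'M[R]_(d, m)) (t : R) i j s w :
  restricted_entry G t i j (s, w) = if 0 <= s <= t then G s w i j else 0.
Proof. by rewrite /restricted_entry patchE in_setX in_setT andbT mem_setE in_itv/=. Qed.

Lemma measurable_restricted_entry (G : R -> Omega -> 'M[R]_(d, m)) (t : R) i j :
  measurable_fun (`[0, t] `*` [set: Omega]) (fun z : R * Omega => G z.1 z.2 i j) ->
  measurable_fun setT (restricted_entry G t i j).
Proof.
move=> mG; apply/(measurable_restrictT _ _).1 => //.
by apply: measurableX => //; exact: measurable_itv.
Qed.

(** The interval on the left is arbitrary because the entry vanishes off [[0, t]]. The two sides
    integrate in opposite orders, to pass from the convention of [ito_integral] to that of
    [ito_limit_moment]. *)
Lemma restricted_entry_L2 (G : R -> Omega -> 'M[R]_(d, m)) (t t' : R) i j :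
  (forall i j, measurable_fun (`[0, t] `*` [set: Omega]) (fun z : R * Omega => G z.1 z.2 i j)) ->
  (\int[leb]_(s in `]0%R, t']) \int[P]_w (`|restricted_entry G t i j (s, w)| `^ 2)%:E <=
   \int[P]_w \int[leb]_(s in `[0%R, t]) (hsnorm (G s w) ^+ 2)%:E)%E.
Proof.
move=> mG.
pose A := `[0, t] `*` [set: Omega].
have mA : measurable A by apply: measurableX => //; exact: measurable_itv.
pose q := (fun z : R * Omega => (hsnorm (G z.1 z.2) ^+ 2)%:E) \_ A.
have mq : measurable_fun setT q.
  apply/(measurable_restrictT _ _).1 => //; apply/measurable_EFinP.
  exact: measurable_sqr_hsnorm.
have q0 z : (0 <= q z)%E by apply: erestrict_ge0 => y _; rewrite lee_fin sqr_ge0.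
have mr := measurable_restricted_entry (mG i j).
have mr2 : measurable_fun setT (fun z => (`|restricted_entry G t i j z| `^ 2)%:E).
  exact/measurable_EFinP/measurable_abs_powR.
have ms : measurable_fun setT (fun s => \int[P]_w (`|restricted_entry G t i j (s, w)| `^ 2)%:E)%E.
  apply: (@measurable_section_integral _ _ _ P _
    (fun z => (`|restricted_entry G t i j z| `^ 2)%:E) mr2) => z.
  by rewrite lee_fin powR_ge0.
have mqs : measurable_fun setT (fun s => \int[P]_w q (s, w))%E.
  exact: (@measurable_section_integral _ _ _ P _ q mq q0).
have s0 s : (0 <= \int[P]_w (`|restricted_entry G t i j (s, w)| `^ 2)%:E)%E.
  by apply: integral_ge0 => w _; rewrite lee_fin powR_ge0.
apply: (@le_trans _ _ (\int[leb]_(s in setT) \int[P]_w q (s, w))%E).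
  apply: (@le_trans _ _ (\int[leb]_(s in setT) \int[P]_w
      (`|restricted_entry G t i j (s, w)| `^ 2)%:E)%E).
    exact: ge0_subset_integral.
  apply: ge0_le_integral => // s _; apply: ge0_le_integral => //; do ?[
    by move=> w _; rewrite lee_fin powR_ge0|
    by apply: (measurableT_comp mr2); exact: measurable_pair1|
    by apply: (measurableT_comp mq); exact: measurable_pair1].
  move=> w _; rewrite /q /restricted_entry !patchE -/A.
  case: ifP => _; last by rewrite normr0 powR0.
  by rewrite lee_fin powR_mulrn// real_normK ?num_real// sqr_coord_hsnorm.
rewrite -(@tonelli_on _ _ _ P setT q)// le_eqVlt; apply/orP; left; apply/eqP.
apply: eq_integral => w _; rewrite [RHS]integral_mkcond; apply: eq_integral => s _.
by rewrite /q !patchE in_setX in_setT andbT.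
Qed.

End ito_increment.

Lemma lincombe_lty (R : realType) (a b : R) (x y : \bar R) :
  0 <= a -> 0 <= b -> (0 <= x)%E -> (0 <= y)%E -> (x < +oo)%E -> (y < +oo)%E ->
  (a%:E * x + b%:E * y < +oo)%E.
Proof. by move=> *; apply: lte_add_pinfty; apply: lte_mul_pinfty. Qed.

Section ito_increment_moment.
Context {disp : measure_display} {Omega : measurableType disp} {R : realType}.
Variables (P : probability Omega R) (F : R -> set (set Omega)) (d m : nat)
  (W : R -> Omega -> 'cV[R]_m).
Hypotheses (FU : usual_filtration P F) (WB : brownian_motion P F W).
Local Notation leb := (@lebesgue_measure R).

(** A grid containing the break times of [S'] cut at [t'] and those of [S] cut at [t] makes both
    stopped processes constant on its cells. *)
Lemma stopped_value_elementary (S S' : simple_process F d m) (t t' : R) (i : 'I_d) :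
  0 <= t -> t <= t' ->
  elementary_process F W t'
    (fun j s w => stopped_value S' t' s w i j - stopped_value S t s w i j)
    (fun w => simple_integral W S' t' w i 0 - simple_integral W S t w i 0).
Proof.
move=> t0 tt'; have t'0 := le_trans t0 tt'.
pose times (Z : simple_process F d m) (r : R) :=
  [seq Num.min (sp_time Z l) r | l <- iota 0 (sp_size Z).+1].
have timesP Z r l : (l <= sp_size Z)%N -> Num.min (sp_time Z l) r \in times Z r.
  by move=> lZ; apply/mapP; exists l => //; rewrite mem_iota add0n ltnS.
have times_range Z r : 0 <= r -> r <= t' -> forall x, x \in times Z r -> 0 <= x <= t'.
  move=> r0 rt' x /mapP[l _ ->]; rewrite le_min r0 andbT ge_min rt' orbT andbT.
  by rewrite (le_trans (sp_time_ge0 Z))// sp_time_nondecreasing.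
have [|g [n [g0 gn gmono gS]]] := @strict_grid_exists R t' (times S' t' ++ times S t) t'0.
  by move=> x; rewrite mem_cat => /orP[]; apply: times_range.
have gS' l : (l <= sp_size S')%N ->
    exists2 k, (k <= n)%N & g k = Num.min (sp_time S' l) t'.
  by move=> lS; apply: gS; rewrite mem_cat timesP.
have {}gS l : (l <= sp_size S)%N ->
    exists2 k, (k <= n)%N & g k = Num.min (sp_time S l) t.
  by move=> lS; apply: gS; rewrite mem_cat timesP// orbT.
have gl0 l : (l <= n)%N -> 0 <= g l.
  by rewrite -g0; case: l => // l ln; rewrite ltW// gmono.
exists g, n; split => //.
- split => [l j ln|l j s w ln sl]; last first.
    by rewrite (stopped_value_cell gmono gS' _ ln sl) (stopped_value_cell gmono gS _ ln sl).
  have sF := filtration_sigma_algebra FU (gl0 l (ltnW ln)).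
  apply/(measurable_wrtP _ sF); apply: measurable_funB; apply/(measurable_wrtP _ sF).
    exact: (stopped_value_adapted FU g0 gmono gS').
  exact: (stopped_value_adapted FU g0 gmono gS).
- have [N1 HN1] := stopped_value_bounded S' t'; have [N2 HN2] := stopped_value_bounded S t.
  by exists (N1 + N2) => j s w; rewrite (le_trans (ler_normB _ _))// lerD.
apply/funext => w; rewrite (simple_integral_grid gmono gS') (simple_integral_grid gmono gS).
rewrite -sumrB; apply: eq_bigr => j _; rewrite -sumrB; apply: eq_bigr => l _.
by rewrite -mulrBl.
Qed.

(** The increment is treated as a single integral over [[0, t']], with integrand [H' - H 1_[0, t]].
    Differences of stopped simple processes approximate it, even though [H] and [H'] come with
    unrelated approximating sequences. *)
Lemma ito_increment_moment (p : R) : 2 <= p -> exists2 k : R, 0 < k &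
  forall (t t' : R) (H H' : R -> Omega -> 'M[R]_(d, m)) (I I' : Omega -> 'cV[R]_d)
    (i : 'I_d) (K : R -> R) (B : R),
  0 <= t -> t <= t' -> 0 < t' ->
  ito_integral P F W H t I -> ito_integral P F W H' t' I' ->
  measurable_fun `]0, t'] K -> (forall s, s \in `]0, t'] -> 0 <= K s) ->
  (forall j s, s \in `]0, t'] ->
     (\int[P]_w (`|H' s w i j - (if (s <= t)%R then H s w i j else 0)| `^ p)%:E <=
      (K s `^ (p / 2))%:E)%E) ->
  0 < B -> (\int[leb]_(s in `]0%R, t']) (K s)%:E <= B%:E)%E ->
  (\int[P]_w (`|I' w i 0 - I w i 0| `^ p)%:E <= ((k * B) `^ (p / 2))%:E)%E.
Proof.
move=> p2; have [k k0 HK] := ito_limit_moment FU WB p2.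
exists k => // t t' H H' I I' i K B t0 tt' t'0 IH IH' mK K0 DK B0 iK.
have [mH _ H2 mI [S [SH SI]]] := IH.
have [mH' _ H2' mI' [S' [SH' SI']]] := IH'.
have mHe (r : R) (G : R -> Omega -> 'M[R]_(d, m)) a b :
    measurable_fun (`[0, r] `*` [set: Omega]) (fun z : R * Omega => G z.1 z.2) ->
    measurable_fun (`[0, r] `*` [set: Omega]) (fun z : R * Omega => G z.1 z.2 a b).
  by move=> mG; exact: (measurableT_comp (measurable_coord a b) mG).
have mr := measurable_restricted_entry (mHe _ _ i _ mH).
have mr' := measurable_restricted_entry (mHe _ _ i _ mH').
have msq (f : R * Omega -> R) : measurable_fun setT f ->
    measurable_fun setT (fun z => (`|f z| `^ 2)%:E).
  by move=> mf; exact/measurable_EFinP/measurable_abs_powR.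
have lemsq (f g1 g2 : R * Omega -> R) (b1 b2 : \bar R) :
  measurable_fun setT f -> measurable_fun setT g1 -> measurable_fun setT g2 ->
  (forall s w, s \in `]0, t'] -> f (s, w) = g1 (s, w) - g2 (s, w)) ->
  (\int[leb]_(s in `]0%R, t']) \int[P]_w (`|g1 (s, w)| `^ 2)%:E <= b1)%E ->
  (\int[leb]_(s in `]0%R, t']) \int[P]_w (`|g2 (s, w)| `^ 2)%:E <= b2)%E ->
  (\int[leb]_(s in `]0%R, t']) \int[P]_w (`|f (s, w)| `^ 2)%:E <= 2%:E * b1 + 2%:E * b2)%E.
  move=> mf mg1 mg2 fE h1 h2.
  have ms (h : R * Omega -> R) : measurable_fun setT h ->
    measurable_fun `]0, t'] (fun s => \int[P]_w (`|h (s, w)| `^ 2)%:E)%E.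
    move=> mh; apply: (@measurable_section_integral _ _ _ P _ (fun z => (`|h z| `^ 2)%:E)).
      exact: msq.
    by move=> z; rewrite lee_fin powR_ge0.
  have m1 (h : R * Omega -> R) s : measurable_fun setT h ->
    measurable_fun setT (fun w => (`|h (s, w)| `^ 2)%:E).
    by move=> mh; apply: (measurableT_comp (msq _ mh)); exact: measurable_pair1.
  have s0 (h : R * Omega -> R) s : (0 <= \int[P]_w (`|h (s, w)| `^ 2)%:E)%E.
    by apply: integral_ge0 => w _; rewrite lee_fin powR_ge0.
  apply: (@le_trans _ _ (\int[leb]_(s in `]0%R, t'])
    (2%:E * (\int[P]_w (`|g1 (s, w)| `^ 2)%:E) + 2%:E * (\int[P]_w (`|g2 (s, w)| `^ 2)%:E)))%E).
    apply: ge0_le_integral => //; do ?[exact: ms|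
      by apply: emeasurable_funD; apply: emeasurable_funM => //; exact: ms].
    move=> s /= st'.
    rewrite -ge0_integral_lincomb//; do ?[by move=> w; rewrite lee_fin powR_ge0|exact: m1].
    apply: ge0_le_integral => //; do ?[by move=> w _; rewrite lee_fin powR_ge0|exact: m1|
      by apply: emeasurable_funD; apply: emeasurable_funM => //; exact: m1].
    move=> w _; rewrite /= lee_fin fE//.
    rewrite !(powR_mulrn 2)// !real_normK ?num_real//.
    have := sqr_ge0 (g1 (s, w) + g2 (s, w)); nra.
  rewrite ge0_integral_lincomb//; do ?[exact: ms|exact: s0].
  by apply: leeD; apply: lee_wpmul2l.
pose D j := (fun z => restricted_entry H' t' i j z - restricted_entry H t i j z).
pose V n j := (fun z : R * Omega =>
  stopped_value (S' n) t' z.1 z.2 i j - stopped_value (S n) t z.1 z.2 i j).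
have mD j : measurable_fun setT (D j) by exact: measurable_funB.
have mV n j : measurable_fun setT (V n j).
  by apply: measurable_funB; exact: (measurable_stopped_value FU).
apply: (HK t' D V (fun n w => simple_integral W (S' n) t' w i 0 - simple_integral W (S n) t w i 0)
  (fun w => I' w i 0 - I w i 0) K B) => //.
- by move=> n; exact: stopped_value_elementary.
- by apply: measurable_funB; apply: (measurableT_comp (measurable_coord i 0)).
- move=> j.
  have h1 := restricted_entry_L2 P t' i j (fun a b => mHe _ _ a b mH').
  have h2 := restricted_entry_L2 P t' i j (fun a b => mHe _ _ a b mH).
  apply: (le_lt_trans (lemsq _ _ _ _ _ (mD j) (mr' j) (mr j) (fun _ _ _ => erefl) h1 h2)).
  have hs0 (G : R -> Omega -> 'M[R]_(d, m)) r :
      (0 <= \int[P]_w \int[leb]_(s in `[0%R, r]) (hsnorm (G s w) ^+ 2)%:E)%E.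
    by apply: integral_ge0 => w _; apply: integral_ge0 => s _; rewrite lee_fin sqr_ge0.
  exact: (lincombe_lty (ler0n _ 2) (ler0n _ 2) (hs0 _ _) (hs0 _ _) H2' H2).
- move=> e e0.
  (* Both the integrand and the integral have two errors, each entering with the factor [2]. *)
  have e8 : 0 < e / 4 by rewrite divr_gt0.
  have [n [h1 h2 h3 h4]] : exists n,
    [/\ (\int[P]_w \int[leb]_(s in `[0%R, t]) (hsnorm (simple_value (S n) s w - H s w) ^+ 2)%:E
          <= (e / 4)%:E)%E,
        (\int[P]_w \int[leb]_(s in `[0%R, t']) (hsnorm (simple_value (S' n) s w - H' s w) ^+ 2)%:E
          <= (e / 4)%:E)%E,
        (\int[P]_w (hsnorm (simple_integral W (S n) t w - I w) ^+ 2)%:E <= (e / 4)%:E)%E &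
        (\int[P]_w (hsnorm (simple_integral W (S' n) t' w - I' w) ^+ 2)%:E <= (e / 4)%:E)%E].
    have a1 := cvge0_near SH e8; have a2 := cvge0_near SH' e8.
    have a3 := cvge0_near SI e8; have a4 := cvge0_near SI' e8.
    have [n _ /(_ n (leqnn n))[[b1 b2] [b3 b4]]] := filterI (filterI a1 a2) (filterI a3 a4).
    by exists n; split; [exact: b1|exact: b2|exact: b3|exact: b4].
  exists n; split => [j|].
    have mG (r : R) (Z : simple_process F d m) (G : R -> Omega -> 'M[R]_(d, m)) a b :
      measurable_fun (`[0, r] `*` [set: Omega]) (fun z : R * Omega => G z.1 z.2) ->
      measurable_fun (`[0, r] `*` [set: Omega])
        (fun z : R * Omega => (simple_value Z z.1 z.2 - G z.1 z.2) a b).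
      move=> mG; rewrite (_ : (fun _ => _) = fun z : R * Omega =>
        simple_value Z z.1 z.2 a b - G z.1 z.2 a b); last first.
        by apply/funext => z; rewrite !mxE.
      apply: measurable_funB; last exact: mHe.
      by apply: measurable_funTS; exact: (measurable_simple_value FU).
    have k1 := le_trans (restricted_entry_L2 P t' i j (fun a b => mG _ (S n) _ a b mH)) h1.
    have k2 := le_trans (restricted_entry_L2 P t' i j (fun a b => mG _ (S' n) _ a b mH')) h2.
    have := lemsq (fun z => V n j z - D j z) _ _ _ _ _
      (measurable_restricted_entry (mG _ (S' n) _ i j mH'))
      (measurable_restricted_entry (mG _ (S n) _ i j mH)) _ k2 k1.
    rewrite -!EFinM -!EFinD (_ : 2 * (e / 4) + 2 * (e / 4) = e); last by field.
    apply; first exact: measurable_funB.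
    move=> s w /[!in_itv]/= /andP[s0 st'].
    rewrite /V /D/= !restricted_entryE (ltW s0) st'/= stopped_value_le//.
    have [st|ts] := leP s t; first by rewrite stopped_value_le// !mxE; ring.
    by rewrite stopped_value_gt// !mxE; ring.
  have mSI (r : R) (Z : simple_process F d m) (G : Omega -> 'cV[R]_d) : 0 <= r ->
      measurable_fun setT G ->
      measurable_fun setT (fun w => (hsnorm (simple_integral W Z r w - G w) ^+ 2)%:E).
    move=> r0 mG; apply/measurable_EFinP/measurable_sqr_hsnorm => a b.
    rewrite (_ : (fun _ => _) = fun w => simple_integral W Z r w a 0 - G w a 0); last first.
      by apply/funext => w; rewrite !mxE (ord1 b).
    apply: measurable_funB; first exact: (measurable_simple_integral FU WB).
    exact: (measurableT_comp (measurable_coord a 0) mG).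
  have m1 := mSI _ (S n) _ t0 mI.
  have m2 := mSI _ (S' n) _ (ltW t'0) mI'.
  apply: (@le_trans _ _ (\int[P]_w (2%:E * (hsnorm (simple_integral W (S' n) t' w - I' w) ^+ 2)%:E
     + 2%:E * (hsnorm (simple_integral W (S n) t w - I w) ^+ 2)%:E))%E).
    apply: ge0_le_integral => //; do ?[by move=> w _; rewrite lee_fin powR_ge0|
      by apply: emeasurable_funD; apply: emeasurable_funM].
      apply/measurable_EFinP/measurable_abs_powR; apply: measurable_funB.
        by apply: measurable_funB; apply: (measurable_simple_integral FU WB) => //; exact: ltW.
      by apply: measurable_funB; apply: (measurableT_comp (measurable_coord i 0)).
    move=> w _; rewrite /= lee_fin (powR_mulrn 2)// real_normK ?num_real//.
    have := sqr_coord_hsnorm (simple_integral W (S' n) t' w - I' w) i 0.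
    have := sqr_coord_hsnorm (simple_integral W (S n) t w - I w) i 0.
    rewrite !mxE; move: (simple_integral W (S' n) t' w i 0) (simple_integral W (S n) t w i 0).
    move=> a b; have := sqr_ge0 ((a - I' w i 0) + (b - I w i 0)); nra.
  rewrite ge0_integral_lincomb//; do ?[by move=> w; rewrite lee_fin sqr_ge0].
  apply: (@le_trans _ _ (2%:E * (e / 4)%:E + 2%:E * (e / 4)%:E)%E).
    by apply: leeD; apply: lee_wpmul2l.
  by rewrite -!EFinM -!EFinD lee_fin; lra.
- move=> j s sT; rewrite (_ : integral _ _ _ = \int[P]_w
    (`|H' s w i j - (if (s <= t)%R then H s w i j else 0)| `^ p)%:E)%E; first exact: DK.
  move: (sT); rewrite in_itv/= => /andP[s0 st'].
  by apply: eq_integral => w _; rewrite /D !restricted_entryE (ltW s0) st'.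
Qed.

End ito_increment_moment.

(** * Kolmogorov's continuity criterion *)

(** Adding the geometric tail [c n] makes the sequence nonincreasing, subtracting it makes it
    nondecreasing. The two monotone sequences enclose the limit and give the rate. *)
Lemma geometric_increments_cvg (R : realType) (u : nat -> R) (M r : R) :
  0 <= M -> 0 <= r < 1 -> (forall n, `|u n.+1 - u n| <= M * r ^+ n) ->
  cvgn u /\ forall n, `|limn u - u n| <= M * r ^+ n / (1 - r).
Proof.
move=> M0 /andP[r0 r1] du.
have r10 : 0 < 1 - r by rewrite subr_gt0.
pose c n := M * r ^+ n / (1 - r).
have c0 n : 0 <= c n by rewrite divr_ge0 ?mulr_ge0 ?exprn_ge0 ?(ltW r10).
have cS n : c n.+1 = c n - M * r ^+ n.
  by rewrite /c exprS; field; rewrite gt_eqF.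
pose v n := u n + c n; pose v' n := u n - c n.
have vd : nonincreasing_seq v.
  apply/nonincreasing_seqP => n; rewrite /v cS.
  by have := du n; rewrite ler_norml => /andP[]; lra.
have v'i : nondecreasing_seq v'.
  apply/nondecreasing_seqP => n; rewrite /v' cS.
  by have := du n; rewrite ler_norml => /andP[]; lra.
have cv : cvgn v.
  apply: nonincreasing_is_cvgn => //; exists (v' 0%N) => _ [n _ <-].
  rewrite (le_trans (v'i _ _ (leq0n n)))// /v /v'; have := c0 n; lra.
have cc : c @ \oo --> 0.
  have /cvg_geometric h : `|r| < 1 by rewrite ger0_norm.
  by have := h (M / (1 - r)); apply: cvg_trans; apply: near_eq_cvg; near=> n;
    rewrite /c /geometric/= mulrAC.
have uE : u = v - c by apply/funext => n; rewrite /v /= !fctE addrK.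
have v'E : v' = u - c by [].
have uv : u @ \oo --> limn v.
  by rewrite [X in X @ _ --> _]uE -[limn v]subr0; apply: cvgB.
have cu : cvgn u by apply/cvg_ex; exists (limn v).
have limu : limn u = limn v by apply/cvg_lim.
have v'l : v' @ \oo --> limn v.
  by rewrite v'E -[limn v]subr0; apply: cvgB.
split => // n; rewrite limu ler_norml -/(c n); apply/andP; split.
  have := nondecreasing_cvgn_le v'i (cvgP _ v'l) n.
  by rewrite (cvg_lim _ v'l)// /v'; lra.
by have := nonincreasing_cvgn_ge vd cv n; rewrite {2}/v; lra.
Unshelve. all: by end_near.
Qed.

Section bounded_by_summable.
Context {disp : measure_display} {Omega : measurableType disp} {R : realType}.
Variable P : probability Omega R.
Local Open Scope ereal_scope.

(** The series of the [f n] has a finite integral, so it is finite almost everywhere, and its sum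
    bounds each term. The good set [G] is measurable so that a modification can be defined by cases
    on it. *)
Lemma summable_moments_bounded (f : nat -> Omega -> R) (K r : R) :
  (forall n, measurable_fun setT (f n)) -> (forall n w, (0 <= f n w)%R) ->
  (0 <= K)%R -> (0 <= r < 1)%R ->
  (forall n, \int[P]_w (f n w)%:E <= (K * r ^+ n)%:E) ->
  exists G : set Omega, [/\ measurable G, P (~` G) = 0 &
    forall w, G w -> exists s : R, forall n, (f n w <= s)%R].
Proof.
move=> mf f0 K0 /andP[r0 r1] fK.
have r10 : (0 < 1 - r)%R by rewrite subr_gt0.
pose S w := \sum_(n <oo) (f n w)%:E.
have mfE n : measurable_fun setT (fun w => (f n w)%:E) by exact/measurable_EFinP.
have mS : measurable_fun setT S.
  by apply: ge0_emeasurable_sum => // n w _ _; rewrite lee_fin.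
have S0 w : 0 <= S w by apply: nneseries_ge0 => n _ _; rewrite lee_fin.
have iS : \int[P]_w S w <= (K / (1 - r))%:E.
  rewrite integral_nneseries//; last by move=> n w _; rewrite lee_fin.
  apply: lime_le.
    by apply: is_cvg_nneseries => n _ _; apply: integral_ge0 => w _; rewrite lee_fin.
  apply: nearW => n.
  apply: (@le_trans _ _ (\sum_(0 <= i < n) (K * r ^+ i)%:E)); first exact: lee_sum.
  rewrite sumEFin lee_fin -mulr_sumr ler_wpM2l// -[leRHS]mul1r ler_pdivlMr//.
  have -> : ((\sum_(0 <= i < n) r ^+ i) * (1 - r) = 1 - r ^+ n)%R.
    elim: n => [|n ih]; first by rewrite big_nil mul0r expr0 subrr.
    by rewrite big_nat_recr//= mulrDl ih exprS; ring.
  by rewrite gerBl exprn_ge0.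
have intS : P.-integrable setT S.
  apply/integrableP; split => //.
  under eq_integral do rewrite gee0_abs//.
  exact: le_lt_trans iS (ltry _).
pose G := [set w | S w \is a fin_num].
have mG : measurable G.
  by have := emeasurable_fin_num measurableT mS; rewrite setTI.
exists G; split => //.
  have [N [mN N0 sub]] := integrable_ae measurableT intS.
  apply/eqP; rewrite eq_le measure_ge0 andbT -N0.
  apply: le_measure; rewrite ?inE//; first exact: measurableC.
  by move=> w /= nG; apply: sub => /(_ I).
move=> w Gw; exists (fine (S w)) => n.
rewrite -lee_fin fineK//.
apply: (le_trans _ (nneseries_lim_ge n.+1 _)) => [|k _ _]; last by rewrite lee_fin.
rewrite big_nat_recr//= leeDr// sume_ge0// => k _.
by rewrite lee_fin.
Qed.

End bounded_by_summable.

Lemma exprn_powR (R : realType) (x y : R) n : 0 <= x -> (x ^+ n) `^ y = (x `^ y) ^+ n.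
Proof.
move=> x0; rewrite -(powR_mulrn n x0) -(powR_mulrn n (powR_ge0 x y)).
exact: powRAC.
Qed.

Section kolmogorov_continuity.
Context {disp : measure_display} {Omega : measurableType disp} {R : realType}.
Variable P : probability Omega R.

(** For [0 <= t < T] this is the index of the half-open dyadic cell containing [t]; at [t = T] it is
    [2 ^ n], the last grid point. *)
Let dyadic_index (T t : R) n := Num.truncn (t / T * 2 ^+ n).
Let dyadic_point (T : R) n (k : nat) : R := T * k%:R / 2 ^+ n.

Let dyadic_indexP (T t : R) n : 0 < T -> 0 <= t <= T ->
  (dyadic_index T t n)%:R <= t / T * 2 ^+ n < (dyadic_index T t n).+1%:R.
Proof.
by move=> T0 /andP[t0 _]; apply: truncn_itv; rewrite mulr_ge0 ?exprn_ge0// divr_ge0// ltW.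
Qed.

Let dyadic_index_le (T t : R) n : 0 < T -> 0 <= t <= T -> (dyadic_index T t n <= 2 ^ n)%N.
Proof.
move=> T0 tT; have /andP[h _] := dyadic_indexP n T0 tT.
rewrite -(ler_nat R) natrX (le_trans h)// ler_piMl ?exprn_ge0//.
by rewrite ler_pdivrMr// mul1r; case/andP: tT.
Qed.

Let dyadic_point_itv (T : R) n k : 0 < T -> (k <= 2 ^ n)%N -> 0 <= dyadic_point T n k <= T.
Proof.
move=> T0 kn; rewrite divr_ge0 ?mulr_ge0 ?exprn_ge0 ?(ltW T0)//=.
by rewrite ler_pdivrMr ?exprn_gt0// ler_pM2l// -natrX ler_nat.
Qed.

Let dyadic_point_dist (T t : R) n : 0 < T -> 0 <= t <= T ->
  0 <= t - dyadic_point T n (dyadic_index T t n) <= T / 2 ^+ n.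
Proof.
move=> T0 tT; have /andP[h1 h2] := dyadic_indexP n T0 tT.
have e0 : 0 < 2 ^+ n :> R by rewrite exprn_gt0.
have tE : t = T * (t / T * 2 ^+ n) / 2 ^+ n by field; rewrite !gt_eqF.
rewrite /dyadic_point {1 3}tE -mulrBl -mulrBr.
move: (t / T * _) h1 h2 => y h1 h2; rewrite divr_ge0 ?mulr_ge0 ?subr_ge0 ?(ltW T0) ?(ltW e0)//=.
rewrite ler_pM2r ?invr_gt0// -[leRHS]mulr1 ler_pM2l//.
by move: h2; rewrite -natr1; lra.
Qed.

Let dyadic_point_double (T : R) n k : dyadic_point T n.+1 k.*2 = dyadic_point T n k.
Proof. by rewrite /dyadic_point -muln2 natrM exprS; field; rewrite expf_neq0. Qed.

Let dyadic_index_double (T t : R) n : 0 < T -> 0 <= t <= T ->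
  dyadic_index T t n.+1 = (dyadic_index T t n).*2 \/
  dyadic_index T t n.+1 = (dyadic_index T t n).*2.+1.
Proof.
move=> T0 tT; have /andP[h1 h2] := dyadic_indexP n T0 tT.
have /andP[h3 h4] := dyadic_indexP n.+1 T0 tT.
have e : t / T * 2 ^+ n.+1 = 2 * (t / T * 2 ^+ n) by rewrite exprS; ring.
rewrite e in h3 h4; move: (dyadic_index T t n) (dyadic_index T t n.+1) (t / T * 2 ^+ n) h1 h2 h3 h4.
move=> k l y h1 h2 h3 h4.
have a : (l < k.*2.+2)%N.
  by rewrite -(ltr_nat R) -addn2 -muln2 natrD natrM; move: h2; rewrite -natr1; lra.
have b : (k.*2 < l.+1)%N by rewrite -(ltr_nat R) -muln2 natrM; lra.
by move: a b; rewrite !ltnS leq_eqVlt => /predU1P[->|];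
  [right|rewrite ltnS => a b; left; apply/eqP; rewrite eqn_leq a].
Qed.

Let dyadic_index_close (T s t : R) n : 0 < T -> 0 <= s <= T -> 0 <= t <= T ->
  s <= t -> t - s <= T / 2 ^+ n ->
  dyadic_index T t n = dyadic_index T s n \/ dyadic_index T t n = (dyadic_index T s n).+1.
Proof.
move=> T0 sT tT st ts; have /andP[h1 h2] := dyadic_indexP n T0 sT.
have /andP[h3 h4] := dyadic_indexP n T0 tT.
have e0 : 0 < 2 ^+ n :> R by rewrite exprn_gt0.
have e : s / T * 2 ^+ n <= t / T * 2 ^+ n <= s / T * 2 ^+ n + 1.
  rewrite ler_pM2r// ler_pM2r ?invr_gt0// st/=.
  have -> : t / T * 2 ^+ n = s / T * 2 ^+ n + (t - s) / T * 2 ^+ n by ring.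
  rewrite lerD2l -ler_pdivlMr// ler_pdivrMr// mulrC.
  by rewrite mulrA mulr1.
move: e h1 h2 h3 h4.
move: (dyadic_index T s n) (dyadic_index T t n) (t / T * _) (s / T * _).
move=> k l y x /andP[e1 e2] h1 h2 h3 h4.
have a : (l < k.+2)%N by rewrite -(ltr_nat R) -natr1; lra.
have b : (k < l.+1)%N by rewrite -(ltr_nat R); lra.
by move: a b; rewrite !ltnS leq_eqVlt => /predU1P[->|];
  [right|rewrite ltnS => a b; left; apply/eqP; rewrite eqn_leq a].
Qed.

(** Chaining along dyadic points: almost surely all increments of level [n] are of order
    [2^(- n delta)], because a weighted sum of their [p]-th powers has summable expectations. *)
Lemma kolmogorov_continuity (T p b C : R) (X : R -> Omega -> R) :
  0 < T -> 1 <= p -> 1 < b -> 0 <= C ->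
  (forall t, 0 <= t <= T -> measurable_fun setT (X t)) ->
  (forall s t, 0 <= s -> s <= t -> t <= T ->
    (\int[P]_w (`|X t w - X s w| `^ p)%:E <= (C * (t - s) `^ b)%:E)%E) ->
  forall delta, 0 < delta -> delta < (b - 1) / p ->
  exists Y : R -> Omega -> R,
    (forall t, 0 <= t <= T -> measurable_fun setT (Y t) /\ {ae P, forall w, Y t w = X t w}) /\
    forall w, exists c : R, forall s t, 0 <= s -> s <= t -> t <= T ->
      `|Y t w - Y s w| <= c * (t - s) `^ delta.
Proof.
move=> T0 p1 b1 C0 mX hX delta d0 db.
have p0 : 0 < p by lra.
have dpb : delta * p < b - 1 by rewrite -ltr_pdivlMr.
(* If [a^n |u|^p] is bounded then [|u|] is of order [r^n] with [r = 2^(- delta)]. Level [n] has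
   [2^n] increments, each with moment of order [2^(- n b)], so the weighted expectations decay like
   [rho^n]; [rho < 1] says exactly [delta * p < b - 1]. *)
pose a : R := 2 `^ (delta * p).
have a0 : 0 < a by rewrite powR_gt0.
pose r : R := 2 `^ (- delta).
have r0 : 0 < r by rewrite powR_gt0.
have pow2_lt1 z : z < 0 -> 2 `^ z < 1 :> R.
  move=> z0; rewrite -[z]opprK powRN invf_lt1 ?powR_gt0//.
  rewrite -[ltLHS](_ : 1 `^ (- z) = 1); last by rewrite powR1.
  by apply: gt0_ltr_powR; rewrite ?nnegrE ?ltr1n// oppr_gt0.
have r1 : r < 1 by apply: pow2_lt1; rewrite oppr_lt0.
pose rho : R := 2 `^ (delta * p + 1 - b).
have rho0 : 0 <= rho by rewrite powR_ge0.
have rho1 : rho < 1 by apply: pow2_lt1; lra.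
have pow2n n : (2 ^+ n) `^ b = (2 `^ b) ^+ n :> R.
  exact: exprn_powR.
have Tb n : a ^+ n * (2 ^+ n * (C * (T / 2 ^+ n) `^ b)) = C * T `^ b * rho ^+ n.
  rewrite powRM ?(ltW T0) ?invr_ge0 ?exprn_ge0//.
  have -> : (2 ^+ n)^-1 `^ b = ((2 `^ b) ^+ n)^-1 :> R.
    by rewrite -pow2n -powR_inv1 ?exprn_ge0// -powRrM mulN1r powRN.
  have -> : rho = a * 2 / 2 `^ b.
    have h (y z : R) : 2 `^ (y + z) = 2 `^ y * 2 `^ z :> R.
      by rewrite powRD// pnatr_eq0 implybT.
    by rewrite /rho !h powRr1// powRN.
  by rewrite !exprMn exprVn; ring.
have inc_le n (u s : R) : 0 <= u -> a ^+ n * u `^ p <= s -> u <= s `^ p^-1 * r ^+ n.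
  move=> u0 us; have s0 : 0 <= s by apply: le_trans us;
    rewrite mulr_ge0 ?powR_ge0 ?exprn_ge0 ?(ltW a0).
  have an0 : 0 < a ^+ n by rewrite exprn_gt0.
  have up : u `^ p <= s / a ^+ n by rewrite ler_pdivlMr// mulrC.
  have -> : u = (u `^ p) `^ p^-1 by rewrite -powRrM divff ?gt_eqF// powRr1.
  apply: (@le_trans _ _ ((s / a ^+ n) `^ p^-1)).
    apply: ge0_ler_powR; rewrite ?nnegrE ?powR_ge0 ?invr_ge0 ?(ltW p0)//.
    by rewrite divr_ge0 ?(ltW an0).
  rewrite powRM ?invr_ge0 ?(ltW an0)// ler_wpM2l ?powR_ge0// le_eqVlt; apply/orP; left; apply/eqP.
  rewrite -exprVn exprn_powR ?invr_ge0 ?(ltW a0)//; congr (_ ^+ n).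
  by rewrite /a -powRN -powRrM /r; congr (_ `^ _); rewrite mulNr mulfK// gt_eqF.
pose x n k := dyadic_point T n k.
have xT n k : (k <= 2 ^ n)%N -> 0 <= x n k <= T by exact: dyadic_point_itv.
have xS n k : x n k.+1 - x n k = T / 2 ^+ n.
  by rewrite /x /dyadic_point -natr1; field; rewrite expf_neq0.
pose inc n (k : nat) w := `|X (x n k.+1) w - X (x n k) w| `^ p.
have minc n k : (k < 2 ^ n)%N -> measurable_fun setT (inc n k).
  move=> kn; apply: measurable_abs_powR; apply: measurable_funB; apply: mX; apply: xT => //.
  exact: ltnW.
pose f n w := a ^+ n * \sum_(k < 2 ^ n) inc n k w.
have inc0 n k w : 0 <= inc n k w by exact: powR_ge0.
have [G [mG PG HG]] : exists G : set Omega, [/\ measurable G, P (~` G) = 0%E &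
    forall w, G w -> exists s : R, forall n, f n w <= s].
  apply: (@summable_moments_bounded _ _ _ P f (C * T `^ b) rho).
  - move=> n; apply: measurable_funM => //; apply: measurable_sum => k; exact: minc.
  - by move=> n w; rewrite mulr_ge0 ?exprn_ge0 ?(ltW a0)// sumr_ge0.
  - by rewrite mulr_ge0 ?powR_ge0.
  - by rewrite rho0.
  move=> n; rewrite -Tb /f; under eq_integral do rewrite EFinM -sumEFin.
  have mi (k : 'I_(2 ^ n)) : measurable_fun setT (fun w => (inc n k w)%:E).
    by apply/measurable_EFinP; exact: minc.
  rewrite ge0_integralZl_EFin ?exprn_ge0 ?(ltW a0)//; last 2 first.
  - by move=> w _; apply: sume_ge0 => k _; rewrite lee_fin.
  - exact: emeasurable_sum.
  rewrite EFinM lee_wpmul2l ?lee_fin ?exprn_ge0 ?(ltW a0)//.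
  rewrite ge0_integral_sum//; last by move=> k w _; rewrite lee_fin.
  apply: (@le_trans _ _ (\sum_(k < 2 ^ n) (C * (T / 2 ^+ n) `^ b)%:E)%E).
    apply: lee_sum => k _; rewrite -(xS n k).
    have /andP[x0 _] := xT n k (ltnW (ltn_ord k)); have /andP[_ x1] := xT n k.+1 (ltn_ord k).
    apply: hX => //; rewrite -subr_ge0 xS divr_ge0 ?exprn_ge0// ltW//.
  by rewrite sumEFin sumr_const card_ord lee_fin -[leLHS]mulr_natl natrX.
pose Xn n t w := X (x n (dyadic_index T t n)) w.
have mXn n t : 0 <= t <= T -> measurable_fun setT (Xn n t).
  by move=> tT; apply: mX; apply: xT; exact: dyadic_index_le.
have HM w : G w -> exists2 M : R, 0 <= M & forall n k, (k < 2 ^ n)%N ->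
    `|X (x n k.+1) w - X (x n k) w| <= M * r ^+ n.
  move=> /HG[s Hs]; exists (s `^ p^-1) => [|n k kn]; first exact: powR_ge0.
  apply: inc_le => //; apply: le_trans (Hs n).
  rewrite /f ler_wpM2l ?exprn_ge0 ?(ltW a0)// (bigD1 (Ordinal kn))//= lerDl.
  exact: sumr_ge0.
have Xn_inc w t (M : R) : 0 <= M -> (forall n k, (k < 2 ^ n)%N ->
    `|X (x n k.+1) w - X (x n k) w| <= M * r ^+ n) -> 0 <= t <= T ->
    forall n, `|Xn n.+1 t w - Xn n t w| <= M * r ^+ n.
  move=> M0 H tT n; rewrite /Xn.
  have := dyadic_index_le n.+1 T0 tT.
  rewrite -[x n _](dyadic_point_double T n).
  have [->|->] := dyadic_index_double n T0 tT => le2.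
    by rewrite subrr normr0 mulr_ge0 ?exprn_ge0 ?(ltW r0).
  apply: (le_trans (H n.+1 _ le2)).
  by rewrite ler_wpM2l// exprS ler_piMl ?exprn_ge0 ?(ltW r0) ?(ltW r1).
have r01 : 0 <= r < 1 by rewrite r1 ltW.
(* Setting [Y] to zero off the good set makes every path Holder continuous, not only almost every
   one. *)
pose Y t w := if w \in G then limn (fun n => Xn n t w) else 0.
exists Y; split.
- move=> t tT; have YG w : G w -> Xn n t w @[n --> \oo] --> Y t w.
    move=> Gw; rewrite /Y mem_set//; have [M M0 H] := HM w Gw.
    by have [] := geometric_increments_cvg M0 r01 (Xn_inc w t M M0 H tT).
  split.
    apply: (@measurable_fun_cvg _ _ _ setT (fun n w => \1_G w * Xn n t w)) => //.
      by move=> n; apply: measurable_funM; [exact: measurable_indic|exact: mXn].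
    move=> w _; rewrite indicE; have [wG|wG] := boolP (w \in G).
      by under eq_fun do rewrite mul1r; apply: YG; rewrite inE in wG.
    by under eq_fun do rewrite mul0r; rewrite /Y (negbTE wG); exact: cvg_cst.
  (* The same summability argument for the distance from [t] to its left dyadic neighbour; here the
     exceptional set depends on [t]. *)
  pose g n w := a ^+ n * `|X t w - Xn n t w| `^ p.
  have [Gt [mGt PGt HGt]] : exists G : set Omega, [/\ measurable G, P (~` G) = 0%E &
      forall w, G w -> exists s : R, forall n, g n w <= s].
    have mg n : measurable_fun setT (fun w => (`|X t w - Xn n t w| `^ p)).
      by apply: measurable_abs_powR; apply: measurable_funB; [exact: mX|exact: mXn].
    apply: (@summable_moments_bounded _ _ _ P g (C * T `^ b) rho).
    - by move=> n; apply: measurable_funM.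
    - by move=> n w; rewrite mulr_ge0 ?powR_ge0 ?exprn_ge0 ?(ltW a0).
    - by rewrite mulr_ge0 ?powR_ge0.
    - by rewrite rho0.
    move=> n; rewrite /g; under eq_integral do rewrite EFinM.
    rewrite ge0_integralZl_EFin ?exprn_ge0 ?(ltW a0)//;
      do ?[by move=> w _; rewrite lee_fin powR_ge0|by apply/measurable_EFinP].
    rewrite -Tb [leRHS]EFinM lee_wpmul2l ?lee_fin ?exprn_ge0 ?(ltW a0)//.
    have /andP[d1 d2] := dyadic_point_dist n T0 tT.
    have /andP[x0 x1] := xT n _ (dyadic_index_le n T0 tT).
    rewrite /Xn; apply: (le_trans (hX (x n (dyadic_index T t n)) t _ _ _)) => //.
    + by rewrite -subr_ge0.
    + by case/andP: tT.
    rewrite lee_fin -[leLHS]mul1r; apply: ler_pM; rewrite ?mulr_ge0 ?powR_ge0 ?exprn_ege1 ?ler1n//.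
    rewrite ler_wpM2l//; apply: ge0_ler_powR; rewrite ?nnegrE//; first lra.
    by rewrite divr_ge0 ?exprn_ge0 ?(ltW T0).
  have nG : P.-negligible (~` G `|` ~` Gt).
    by apply: negligibleU; apply/negligibleP => //; exact: measurableC.
  apply: negligibleS nG => w /= YX; apply: contrapT => /not_orP[/contrapT Gw /contrapT Gtw].
  apply: YX; have [s Hs] := HGt w Gtw.
  rewrite -(cvg_lim _ (YG w Gw))//; apply/cvg_lim => //.
  apply/cvgrPdist_le => e e0.
  have nr : `|r| < 1 by rewrite ger0_norm ?(ltW r0).
  have /cvgrPdist_le/(_ e e0) h := @cvg_geometric _ (s `^ p^-1) _ nr.
  near=> n.
  have h1 : `|X t w - Xn n t w| <= s `^ p^-1 * r ^+ n by apply: inc_le => //; exact: Hs.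
  apply: (le_trans h1).
  have : `|0 - geometric (s `^ p^-1) r n| <= e by near: n.
  rewrite sub0r normrN /geometric/=; apply: le_trans.
  exact: ler_norm.
move=> w; have [wG|wG] := boolP (w \in G); last first.
  by exists 0 => s t _ _ _; rewrite /Y (negbTE wG) subrr normr0 mul0r.
have Gw : G w by rewrite inE in wG.
have [M M0 H] := HM w Gw.
have YX t n : 0 <= t <= T -> `|Y t w - Xn n t w| <= M * r ^+ n / (1 - r).
  move=> tT; rewrite /Y wG.
  by have [_ ->] := geometric_increments_cvg M0 r01 (Xn_inc w t M M0 H tT).
have r10 : 0 < 1 - r by rewrite subr_gt0.
(* Two tails [M r^n / (1 - r)], at [s] and at [t], and one increment [M r^n] between them. *)
pose c := M * (1 + 2 / (1 - r)).
have c0 : 0 <= c by rewrite mulr_ge0// addr_ge0// divr_ge0// ltW.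
exists (c * (2 / T) `^ delta) => s t s0 st tT.
have sT : 0 <= s <= T by rewrite s0 (le_trans st).
have {}tT : 0 <= t <= T by rewrite (le_trans s0).
have [->|neq_st] := eqVneq s t.
  by rewrite subrr normr0 mulr_ge0 ?powR_ge0// mulr_ge0 ?powR_ge0.
have ts0 : 0 < t - s by rewrite subr_gt0 lt_neqAle neq_st.
(* At this level [s] and [t] lie in the same or in adjacent cells, while [2^(- n)] is still
   comparable to [t - s]. *)
have [n [n1 n2]] : exists n, T / 2 ^+ n.+1 < t - s /\ t - s <= T / 2 ^+ n.
  have ex : exists n, T / 2 ^+ n.+1 < t - s.
    exists (Num.truncn (T / (t - s))); rewrite ltr_pdivrMr ?exprn_gt0// mulrC -ltr_pdivrMr//.
    apply: (lt_le_trans (truncnS_gt _)); rewrite -natrX ler_nat.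
    by apply: ltnW; exact: ltn_expl.
  have n1 := ex_minnP ex; case: n1 => n n1 nmin; exists n; split => //.
  case: n n1 nmin => [|n] n1 nmin.
    by rewrite expr0 divr1; case/andP: tT => _; lra.
  by rewrite leNgt; apply/negP => /nmin; rewrite ltnn.
have Xst : `|Xn n t w - Xn n s w| <= M * r ^+ n.
  have le2 := dyadic_index_le n T0 tT; rewrite /Xn.
  have [->|e] := dyadic_index_close T0 sT tT st n2.
    by rewrite subrr normr0 mulr_ge0 ?exprn_ge0 ?(ltW r0).
  by rewrite e in le2 *; exact: H.
have Yst : `|Y t w - Y s w| <= c * r ^+ n.
  have := YX t n tT; have := YX s n sT; rewrite [`|Y s w - _|]distrC => h1 h2.
  rewrite (_ : Y t w - Y s w = (Y t w - Xn n t w) + (Xn n t w - Xn n s w) + (Xn n s w - Y s w)); last by ring.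
  apply: (le_trans (ler_normD _ _)); apply: (le_trans (lerD (ler_normD _ _) (lexx _))).
  apply: (le_trans (lerD (lerD h2 Xst) h1)).
  by rewrite /c le_eqVlt; apply/orP; left; apply/eqP; field; rewrite gt_eqF.
apply: (le_trans Yst); rewrite -mulrA ler_wpM2l// -powRM ?divr_ge0 ?(ltW T0) ?(ltW ts0)//.
have -> : r ^+ n = (2 ^+ n)^-1 `^ delta.
  rewrite -exprVn exprn_powR ?invr_ge0//; congr (_ ^+ n).
  by rewrite -(powR_inv1 (ler0n R 2)) -powRrM mulN1r.
apply: ge0_ler_powR; rewrite ?nnegrE ?invr_ge0 ?exprn_ge0 ?mulr_ge0 ?(ltW d0) ?(ltW ts0) ?invr_ge0 ?(ltW T0)//.
have : T / 2 ^+ n.+1 * (2 / T) < (t - s) * (2 / T) by rewrite ltr_pM2r// divr_gt0.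
rewrite (_ : T / 2 ^+ n.+1 * (2 / T) = (2 ^+ n)^-1); last first.
  have Tn : T != 0 by rewrite gt_eqF.
  have e2 : 2 ^+ n != 0 :> R by rewrite expf_neq0// pnatr_eq0.
  by rewrite exprS; move: (2 ^+ n) e2 => y y0; field; rewrite ?y0 ?Tn.
by rewrite mulrC; apply: ltW.
Unshelve. all: by end_near.
Qed.

End kolmogorov_continuity.

(** * The equation *)

Section W2_delta0.
Context {R : realType} (d : nat).

(** The image of [mu] under [x |-> (x, 0)] is a coupling whose cost is the second moment. In
    particular the infimum is finite, so [fine] in [W2] is faithful here. *)
Lemma sqr_W2_delta0 (mu : P2 R d) :
  ((W2 mu (delta0 R d) ^+ 2)%:E <= second_moment (sval mu))%E.
Proof.
pose Q : probability 'cV[R]_d R := sval mu.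
have mpair : measurable_fun setT (fun x : 'cV[R]_d => (x, 0 : 'cV[R]_d)).
  exact: measurable_fun_pair.
pose X : {mfun 'cV[R]_d >-> ('cV[R]_d * 'cV[R]_d)%type} := mfun_Sub (mem_set mpair : _ \in mfun).
pose pi : probability ('cV[R]_d * 'cV[R]_d)%type R := distribution Q X.
have piE : coupling (sval mu) (sval (delta0 R d)) pi.
  move=> A mA; split.
    rewrite [LHS](_ : _ = Q A)//; congr (Q _).
    by apply/seteqP; split => x //= [].
  have [A0|A0] := boolP ((0 : 'cV[R]_d) \in A).
    rewrite [RHS]/= /dirac indicE A0.
    rewrite [LHS](_ : _ = Q setT); first by rewrite probability_setT.
    congr (Q _).
    by apply/seteqP; split => x //= _; split => //; rewrite inE in A0.
  rewrite [RHS]/= /dirac indicE (negbTE A0).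
  rewrite [LHS](_ : _ = Q set0); first by rewrite measure0.
  congr (Q _).
  by apply/seteqP; split => x //= [_]; move: A0; rewrite notin_setE.
set S := [set (\int[pi]_z (hsnorm (z.1 - z.2) ^+ 2)%:E)%E |
  pi in coupling (sval mu) (sval (delta0 R d))].
have S0 : (0 <= ereal_inf S)%E.
  by apply: le_ereal_inf_tmp => _ [q _ <-]; apply: integral_ge0 => z _; rewrite lee_fin sqr_ge0.
have Ssm : (ereal_inf S <= second_moment (sval mu))%E.
  apply: ereal_inf_lbound; exists pi => //.
  have mh : measurable_fun setT
      (fun z : 'cV[R]_d * 'cV[R]_d => (hsnorm (z.1 - z.2) ^+ 2)%:E).
    apply/measurable_EFinP/measurable_sqr_hsnorm => i j.
    rewrite (_ : (fun _ => _) = fun z : 'cV[R]_d * 'cV[R]_d => z.1 i j - z.2 i j); last first.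
      by apply/funext => z; rewrite !mxE.
    apply: measurable_funB.
      exact: (measurableT_comp (measurable_coord i j) measurable_fst).
    exact: (measurableT_comp (measurable_coord i j) measurable_snd).
  rewrite (ge0_integral_distribution X mh); last by move=> z; rewrite lee_fin sqr_ge0.
  by apply: eq_integral => x _ /=; rewrite subr0.
have sm_fin := svalP mu.
rewrite /W2 sqr_sqrtr ?fine_ge0// fineK// ge0_fin_numE//.
exact: le_lt_trans Ssm sm_fin.
Qed.

End W2_delta0.

Section weighted_moment.
Context {disp : measure_display} {Omega : measurableType disp} {R : realType}.
Variable P : probability Omega R.
Local Notation leb := (@lebesgue_measure R).

(* Jensen's inequality for the measure [k ds] in the form [c^(p-1) z <= z^p + c^p]
   with [c = |y| / (2 a)]. *)
Lemma weighted_integral_powR (p a y : R) (A : set R) (k z : R -> R) :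
  1 <= p -> 0 < a -> measurable A -> measurable_fun A k -> measurable_fun A z ->
  (forall s, 0 <= k s) -> (forall s, 0 <= z s) ->
  (\int[leb]_(s in A) (k s)%:E <= a%:E)%E ->
  (`|y|%:E <= \int[leb]_(s in A) (k s * z s)%:E)%E ->
  ((`|y| `^ p)%:E <= (2 `^ p * a `^ (p - 1))%:E * \int[leb]_(s in A) (k s * z s `^ p)%:E)%E.
Proof.
move=> p1 a0 mA mk mz k0 z0 ka yz.
have p0 : 0 < p by lra.
have mzp : measurable_fun A (fun s => z s `^ p) by exact: (measurableT_comp (measurable_powR p) mz).
have mkz : measurable_fun A (fun s => (k s * z s)%:E).
  by apply/measurable_EFinP; exact: measurable_funM.
have mkzp : measurable_fun A (fun s => (k s * z s `^ p)%:E).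
  by apply/measurable_EFinP; exact: measurable_funM.
have mkE : measurable_fun A (fun s => (k s)%:E) by exact/measurable_EFinP.
set I := (\int[leb]_(s in A) (k s * z s `^ p)%:E)%E.
have I0 : (0 <= I)%E by apply: integral_ge0 => s _; rewrite lee_fin mulr_ge0 ?powR_ge0.
have [->|y0] := eqVneq y 0.
  by rewrite normr0 powR0 ?gt_eqF// mule_ge0// lee_fin mulr_ge0 ?powR_ge0.
have ny0 : 0 < `|y| by rewrite normr_gt0.
pose c := `|y| / (2 * a).
have c0 : 0 < c by rewrite divr_gt0// mulr_gt0.
have cp0 : 0 <= c `^ (p - 1) by exact: powR_ge0.
have yE : `|y| = 2 * a * c by rewrite /c mulrC divfK// mulf_neq0// gt_eqF.
clearbody c.
have h1 : ((c `^ (p - 1) * `|y|)%:E <= I + (c `^ p * a)%:E)%E.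
  apply: (@le_trans _ _ (\int[leb]_(s in A) ((k s * z s `^ p)%:E + (c `^ p)%:E * (k s)%:E))%E).
    rewrite EFinM; apply: (@le_trans _ _ ((c `^ (p - 1))%:E * \int[leb]_(s in A) (k s * z s)%:E)%E).
      by rewrite lee_wpmul2l// lee_fin.
    rewrite -ge0_integralZl_EFin//; last by move=> s _; rewrite lee_fin mulr_ge0.
    apply: ge0_le_integral => //.
    - by move=> s _; rewrite mule_ge0// lee_fin mulr_ge0.
    - exact: measurable_funeM.
    - by apply: emeasurable_funD => //; exact: measurable_funeM.
    move=> s _; rewrite /= lee_fin [c `^ p * _]mulrC -mulrDr mulrCA ler_wpM2l//.
    have := @powR_mul_le R c (z s) (p - 1) 1.
    rewrite subrK powRr1// => h; rewrite [leRHS]addrC; apply: h => //; last exact: ltW.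
    by rewrite subr_ge0.
  rewrite ge0_integralD//; last 3 first.
  - by move=> s _; rewrite lee_fin mulr_ge0 ?powR_ge0.
  - by move=> s _; rewrite mule_ge0// lee_fin ?powR_ge0.
  - exact: measurable_funeM.
  rewrite ge0_integralZl_EFin ?powR_ge0//; last by move=> s _; rewrite lee_fin.
  by rewrite leeD2l// EFinM lee_wpmul2l// lee_fin powR_ge0.
have cE : c `^ (p - 1) * `|y| = 2 * (c `^ p * a).
  by rewrite -(@mulr_powRB1 _ c p) ?(ltW c0)// yE; ring.
(* The left side of [h1] is [2 c^p a], so one [c^p a] is absorbed. The case of an infinite [I] is
   trivial. *)
have h2 : ((c `^ p * a)%:E <= I)%E.
  move: h1 I0; rewrite cE; case: I => [r h _|_ _|//]; last by rewrite leey.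
  by move: h; rewrite -EFinD !lee_fin; lra.
have -> : `|y| `^ p = 2 `^ p * a `^ (p - 1) * (c `^ p * a).
  rewrite yE (powRM p (mulr_ge0 (ler0n R 2) (ltW a0)) (ltW c0)) (powRM p (ler0n R 2) (ltW a0)).
  by rewrite -(@mulr_powRB1 _ a p) ?(ltW a0)//; ring.
by rewrite EFinM lee_wpmul2l// lee_fin mulr_ge0 ?powR_ge0.
Qed.

(** Minkowski's integral inequality for the measure [k ds], up to the factor [2^p]: the preceding
    lemma at almost every [w], then Tonelli. The missing factor [a] comes from integrating [k] once
    more. *)
Lemma weighted_integral_moment (p a M : R) (A : set R) (k : R -> R)
    (Z : R * Omega -> R) (y : Omega -> R) :
  1 <= p -> 0 < a -> 0 <= M -> measurable A -> measurable_fun setT k ->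
  measurable_fun setT Z -> measurable_fun setT y ->
  (forall s, 0 <= k s) -> (forall z, 0 <= Z z) ->
  (forall s, A s -> (\int[P]_w (Z (s, w) `^ p)%:E <= M%:E)%E) ->
  (\int[leb]_(s in A) (k s)%:E <= a%:E)%E ->
  {ae P, forall w, (`|y w|%:E <= \int[leb]_(s in A) (k s * Z (s, w))%:E)%E} ->
  (\int[P]_w (`|y w| `^ p)%:E <= (2 `^ p * a `^ p * M)%:E)%E.
Proof.
move=> p1 a0 M0 mA mk mZ my k0 Z0 ZM ka yZ.
have mZp : measurable_fun setT (fun z => Z z `^ p).
  exact: (measurableT_comp (measurable_powR p) mZ).
pose h (z : R * Omega) := (k z.1 * Z z `^ p)%:E.
have mh : measurable_fun setT h.
  apply/measurable_EFinP; apply: measurable_funM => //.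
  exact: (measurableT_comp mk measurable_fst).
have h0 z : (0 <= h z)%E by rewrite lee_fin mulr_ge0 ?powR_ge0.
have mZs w : measurable_fun setT (fun s => Z (s, w)).
  by apply: (measurableT_comp mZ); exact: measurable_pair2.
have mZw s : measurable_fun setT (fun w => Z (s, w)).
  by apply: (measurableT_comp mZ); exact: measurable_pair1.
pose cst0 := 2 `^ p * a `^ (p - 1).
have cst00 : 0 <= cst0 by rewrite mulr_ge0 ?powR_ge0.
have mI : measurable_fun setT (fun w => \int[leb]_(s in A) h (s, w))%E.
  have -> : (fun w => \int[leb]_(s in A) h (s, w))%E =
      (fun w => \int[leb]_s (h \_ (A `*` setT)) (s, w))%E.
    apply/funext => w; rewrite integral_mkcond; apply: eq_integral => s _.
    by rewrite !patchE in_setX in_setT andbT.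
  apply: (@measurable_fun_fubini_tonelli_G _ _ (measurableTypeR R) _ _ leb (h \_ (A `*` setT))).
    apply/(measurable_restrictT _ _).1; last exact: measurable_funTS.
    exact: measurableX.
  by move=> z; apply: erestrict_ge0.
have I0 w : (0 <= \int[leb]_(s in A) h (s, w))%E by apply: integral_ge0.
apply: (@le_trans _ _ (\int[P]_w (cst0%:E * \int[leb]_(s in A) h (s, w)))%E).
  apply: ae_ge0_le_integral => //.
  - exact/measurable_EFinP/measurable_abs_powR.
  - by move=> w _; rewrite mule_ge0.
  - exact: measurable_funeM.
  apply: filterS yZ => w yw _.
  apply: weighted_integral_powR => //; exact: measurable_funTS.
rewrite ge0_integralZl_EFin// (@tonelli_on _ _ _ P A h)//.
apply: (@le_trans _ _ (cst0%:E * \int[leb]_(s in A) (M%:E * (k s)%:E))%E).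
  rewrite lee_wpmul2l ?lee_fin//; apply: ge0_le_integral => //.
  - by move=> s _; apply: integral_ge0.
  - exact: measurable_section_integral.
  - by apply: measurable_funeM; apply/measurable_EFinP; exact: measurable_funTS.
  move=> s As; rewrite /h/=; under eq_integral do rewrite EFinM.
  rewrite ge0_integralZl_EFin//; last 2 first.
  - by move=> w _; rewrite lee_fin powR_ge0.
  - by apply/measurable_EFinP; exact: (measurableT_comp (measurable_powR p) (mZw s)).
  by rewrite muleC lee_wpmul2r ?lee_fin// ZM.
rewrite ge0_integralZl_EFin//; last 2 first.
- by move=> s _; rewrite lee_fin.
- by apply/measurable_EFinP; exact: measurable_funTS.
apply: (@le_trans _ _ (cst0%:E * (M%:E * a%:E))%E).
  by rewrite !lee_wpmul2l ?lee_fin.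
rewrite -!EFinM lee_fin /cst0 -(@mulr_powRB1 _ a p) ?(ltW a0)//; last lra.
by rewrite le_eqVlt; apply/orP; left; apply/eqP; ring.
Qed.

End weighted_moment.

(** Transfers measurability from [X t] to its vector-valued modification, which is built coordinate
    by coordinate. *)
Lemma ae_eq_measurable_complete (disp disp' : measure_display)
    (Omega : measurableType disp) (E : measurableType disp') (R : realType)
    (P : probability Omega R) (f g : Omega -> E) :
  measure_is_complete P -> measurable_fun setT f -> {ae P, forall w, g w = f w} ->
  measurable_fun setT g.
Proof.
move=> Pc mf [N [mN N0 sub]] _ B mB; rewrite setTI.
have -> : g @^-1` B = (f @^-1` B `&` ~` N) `|` (g @^-1` B `&` N).
  apply/seteqP; split => w /=.
    move=> gB; have [wN|wN] := pselect (N w); [by right|left; split => //].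
    by rewrite -(_ : g w = f w)//; apply: contrapT => gf; apply: wN; exact: sub.
  move=> [[fB wN]|[]//].
  by rewrite (_ : g w = f w)//; apply: contrapT => gf; apply: wN; exact: sub.
apply: measurableU.
  by apply: measurableI; [rewrite -[X in measurable X]setTI; exact: mf|exact: measurableC].
by apply: Pc; exists N; split => // w [].
Qed.

Section glued_kernel.
Context {R : realType}.
Local Notation leb := (@lebesgue_measure R).
Variables (t t' : R) (f g : R -> R).
Hypothesis tt' : t <= t'.
Hypotheses (f0 : forall s, 0 <= s -> s <= t -> 0 <= f s)
  (g0 : forall s, t < s -> s <= t' -> 0 <= g s).
Hypotheses (mf : measurable_fun `[0, t] f) (mg : measurable_fun `]t, t'] g).

(** The value is zero outside [[0, t']], so that positivity and measurability hold on the whole line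
    although [f] and [g] are controlled only on their intervals. *)
Definition glued_kernel (s : R) : R := (f \_ `[0, t]) s + (g \_ `]t, t']) s.

Lemma glued_kernel_left s : 0 <= s -> s <= t -> glued_kernel s = f s.
Proof.
move=> s0 st; rewrite /glued_kernel !patchE !mem_setE !in_itv/= s0 st/=.
by rewrite ltNge st addr0.
Qed.

Lemma glued_kernel_right s : t < s -> s <= t' -> glued_kernel s = g s.
Proof.
move=> ts st'; rewrite /glued_kernel !patchE !mem_setE !in_itv/= ts st'/=.
by rewrite [s <= t]leNgt ts andbF add0r.
Qed.

Let fp0 s : 0 <= (f \_ `[0, t]) s.
Proof. by rewrite patchE mem_setE in_itv/=; case: ifP => // /andP[]; exact: f0. Qed.

Let gp0 s : 0 <= (g \_ `]t, t']) s.
Proof. by rewrite patchE mem_setE in_itv/=; case: ifP => // /andP[]; exact: g0. Qed.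

Lemma glued_kernel_ge0 s : 0 <= glued_kernel s.
Proof. by rewrite addr_ge0. Qed.

Let mfp : measurable_fun setT (f \_ `[0, t]).
Proof. by apply/(measurable_restrictT _ _).1. Qed.

Let mgp : measurable_fun setT (g \_ `]t, t']).
Proof. by apply/(measurable_restrictT _ _).1. Qed.

Lemma measurable_glued_kernel : measurable_fun setT glued_kernel.
Proof. exact: measurable_funD. Qed.

Lemma glued_kernel_integral (A : set R) (a b : R) : measurable A ->
  (\int[leb]_(s in `[0%R, t]) (f s)%:E <= a%:E)%E ->
  (\int[leb]_(s in `]t, t']) (g s)%:E <= b%:E)%E ->
  (\int[leb]_(s in A) (glued_kernel s)%:E <= (a + b)%:E)%E.
Proof.
move=> mA fa gb.
have mfE : measurable_fun setT (fun s => ((f \_ `[0, t]) s)%:E) by exact/measurable_EFinP.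
have mgE : measurable_fun setT (fun s => ((g \_ `]t, t']) s)%:E) by exact/measurable_EFinP.
rewrite EFinD; apply: le_trans (leeD fa gb).
under eq_integral do rewrite EFinD.
rewrite ge0_integralD//; do ?[by move=> s _; rewrite lee_fin|exact: measurable_funTS].
have h (B : set R) (k : R -> R) : measurable_fun setT (fun s => ((k \_ B) s)%:E) ->
    (forall s, 0 <= (k \_ B) s) ->
    (\int[leb]_(s in A) ((k \_ B) s)%:E <= \int[leb]_(s in B) (k s)%:E)%E.
  move=> mk k0; apply: (@le_trans _ _ (\int[leb]_s ((k \_ B) s)%:E)%E).
    by apply: ge0_subset_integral => // s _; rewrite lee_fin.
  rewrite [leRHS]integral_mkcond le_eqVlt; apply/orP; left; apply/eqP.
  by apply: eq_integral => s _; rewrite !patchE; case: ifP.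
by apply: leeD; exact: h.
Qed.

End glued_kernel.

Lemma kernel_section_measurable (R : realType) (K : R -> R -> R) (t t' : R) :
  kernel_class K -> 0 <= t -> measurable_fun `]t, t'] (K t').
Proof.
move=> KK t0; have mK := kernel_measurable KK.
have mDelta : measurable (@Delta R).
  rewrite (_ : Delta = (fun z : R * R => z.2) @^-1` `[0, +oo[ `&`
                       (fun z : R * R => z.1 - z.2) @^-1` `[0, +oo[); last first.
    by apply/seteqP; split => z; rewrite /Delta/= !in_itv/= !andbT subr_ge0.
  apply: measurableI; rewrite -[X in measurable X]setTI.
    by apply: measurable_snd.
  have : measurable_fun setT (fun z : R * R => z.1 - z.2).
    by apply: measurable_funB; [exact: measurable_fst|exact: measurable_snd].
  exact.
apply: (@measurable_comp _ _ _ _ _ _ Delta (fun z => K z.1 z.2) `]t, t']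
  (fun s => (t', s)) mDelta _ mK).
  move=> _ [s /= st <-]; move: st; rewrite in_itv/= => /andP[ts st'].
  by split => //=; rewrite (le_trans t0)// ltW.
by apply: measurable_funTS; exact: measurable_pair1.
Qed.

(* [K <= K^2 / h^g + h^g] turns the hypothesis on [K^2] into a bound on [K]. *)
Lemma kernel_tail_integral (R : realType) (K : R -> R) (T C g t t' : R) :
  0 <= t -> t < t' -> t' <= T -> 0 < g ->
  measurable_fun `]t, t'] K -> (forall s, t < s -> s <= t' -> 0 <= K s) ->
  (\int[lebesgue_measure]_(s in `[t, t']) (`|K s| ^+ 2)%:E
       <= (C * `|t - t'| `^ (2 * g))%:E)%E ->
  (\int[lebesgue_measure]_(s in `]t, t']) (K s)%:E <= ((C + T) * (t' - t) `^ g)%:E)%E.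
Proof.
move=> t0 tt' t'T g0 mK K0.
have h0 : 0 < t' - t by rewrite subr_gt0.
rewrite distrC (gtr0_norm h0); set h := t' - t in h0 *.
have l0 : 0 < h `^ g by rewrite powR_gt0.
have li0 : 0 <= (h `^ g)^-1 by rewrite invr_ge0 ltW.
have mK2 : measurable_fun `]t, t'] (fun s => (`|K s| ^+ 2)%:E).
  by apply/measurable_EFinP/measurable_funX; exact: measurableT_comp.
rewrite -integral_itv_obnd_cbnd// => K2.
apply: (@le_trans _ _ (\int[lebesgue_measure]_(s in `]t, t'])
  ((h `^ g)^-1%:E * (`|K s| ^+ 2)%:E + (h `^ g)%:E * 1))%E).
  apply: ge0_le_integral => //.
  - by move=> s /=; rewrite in_itv/= lee_fin => /andP[]; exact: K0.
  - exact/measurable_EFinP.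
  - by apply: emeasurable_funD => //; exact: measurable_funeM.
  move=> s /=; rewrite in_itv/= => /andP[ts st']; rewrite lee_fin mulr1.
  rewrite (ger0_norm (K0 s ts st')) -[X in X <= _]mul1r -(mulVf (lt0r_neq0 l0)) -mulrA.
  rewrite -[X in _ <= _ + X]mul1r -{1}(mulVf (lt0r_neq0 l0)) -mulrA -mulrDr ler_wpM2l//.
  by have := K0 s ts st'; move: (h `^ g) l0 (K s) => l l0 x x0; nra.
rewrite (@ge0_integral_lincomb _ (measurableTypeR R) R lebesgue_measure _
  (fun s => (`|K s| ^+ 2)%:E) (cst 1%E))//; last exact: ltW.
rewrite integral_cst//= lebesgue_measure_itv/= lte_fin tt' mul1e -EFinB -/h.
(* The first term is [C * h^g]. In the second, the length [h] of the interval is at most [T]. *)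
apply: (@le_trans _ _ ((h `^ g)^-1%:E * (C * h `^ (2 * g))%:E + (h `^ g)%:E * h%:E)%E).
  by rewrite leeD2r// lee_wpmul2l.
rewrite -!EFinM -EFinD lee_fin mulrC [2 * g]mulrC powRrM powR_mulrn ?powR_ge0//.
rewrite expr2 mulrA mulfK ?lt0r_neq0// mulrDl lerD2l mulrC ler_wpM2r ?(ltW l0)//.
by rewrite /h; lra.
Qed.

(** The coordinates have a strictly larger exponent, hence a positive one, which gives continuity
    also for [delta = 0]. The excess is absorbed by [T^(delta' - delta)]. *)
Lemma holder_continuous_coordinates (R : realType) (d : nat) (delta delta' T : R)
    (f : R -> 'cV[R]_d) :
  0 < T -> 0 <= delta -> delta < delta' ->
  (forall i, exists c : R, forall s t, 0 <= s -> s <= t -> t <= T ->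
    `|f t i 0 - f s i 0| <= c * (t - s) `^ delta') ->
  holder_continuous delta T f.
Proof.
move=> T0 d0 dd' /choice[c Hc].
have d'0 : 0 < delta' by rewrite (le_lt_trans d0).
have Hi i s t : 0 <= s -> s <= T -> 0 <= t -> t <= T ->
    `|f t i 0 - f s i 0| <= c i * `|t - s| `^ delta'.
  move=> s0 sT t0 tT; have [st|/ltW ts] := leP s t.
    by rewrite (@ger0_norm _ (t - s)) ?subr_ge0//; exact: Hc.
  by rewrite distrC [`|t - s|]distrC (@ger0_norm _ (s - t)) ?subr_ge0//; exact: Hc.
split.
  apply/subspace_continuousP => x; rewrite /= in_itv/= => /andP[x0 xT].
  apply/cvg_ballP => e e0.
  pose M := 1 + \sum_i `|c i|.
  have M0 : 0 < M by rewrite ltr_pwDl// sumr_ge0.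
  pose eta := (e / M) `^ delta'^-1.
  have eta0 : 0 < eta by rewrite powR_gt0// divr_gt0.
  have nx : nbhs x (ball x eta) by exact: nbhsx_ballx.
  apply: filterS nx => y /= xy; rewrite in_itv/= => /andP[y0 yT].
  split => // i j; rewrite (ord1 j) /ball/=.
  apply: (le_lt_trans (Hi i y x y0 yT x0 xT)).
  have xyd : `|x - y| `^ delta' < e / M.
    rewrite -[ltRHS](@powRr1 _ _) ?divr_ge0 ?(ltW e0) ?(ltW M0)//.
    rewrite -[X in _ < _ `^ X](@mulVf _ delta') ?gt_eqF// powRrM.
    by apply: gt0_ltr_powR; rewrite ?nnegrE ?powR_ge0.
  apply: (@le_lt_trans _ _ (M * `|x - y| `^ delta')).
    rewrite ler_wpM2r ?powR_ge0// (le_trans (ler_norm _))// /M (bigD1 i)//=.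
    by have : 0 <= \sum_(k < d | k != i) `|c k| by [rewrite sumr_ge0]; lra.
  by rewrite mulrC -ltr_pdivlMr.
exists ((\sum_i `|c i|) * T `^ (delta' - delta)) => s t s0 sT t0 tT.
have [->|ts] := eqVneq t s.
  rewrite !subrr hsnorm0 mulr_ge0 ?powR_ge0// mulr_ge0 ?powR_ge0//.
  exact: sumr_ge0.
apply: (le_trans (hsnorm_le_sum _)).
have nts : 0 < `|t - s| by rewrite normr_gt0 subr_eq0.
have tsT : `|t - s| <= T by rewrite ler_norml; apply/andP; split; lra.
rewrite -mulrA mulr_suml; apply: ler_sum => i _; rewrite big_ord1 !mxE.
apply: (le_trans (Hi i s t s0 sT t0 tT)).
apply: (@le_trans _ _ (`|c i| * `|t - s| `^ delta')).
  by rewrite ler_wpM2r ?powR_ge0// ler_norm.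
have -> : `|t - s| `^ delta' = `|t - s| `^ (delta' - delta) * `|t - s| `^ delta.
  by rewrite -powRD ?subrK// (gt_eqF nts) implybT.
rewrite ler_wpM2l//; apply: ler_wpM2r; first exact: powR_ge0.
by apply: ge0_ler_powR; rewrite ?nnegrE ?subr_ge0 ?(ltW dd') ?(ltW T0).
Qed.

(** Extending [f] by zero to [[0, t']] turns the difference into one integral. The right side is an
    extended real because [g] may fail to be integrable. *)
Lemma Rintegral_glued_le (R : realType) (t t' : R) (f f' g : R -> R) :
  t <= t' ->
  lebesgue_measure.-integrable `[0, t] (EFin \o f) ->
  lebesgue_measure.-integrable `[0, t'] (EFin \o f') ->
  measurable_fun setT g ->
  (forall s, 0 <= s -> s <= t -> `|f' s - f s| <= g s) ->
  (forall s, 0 <= s -> t < s -> s <= t' -> `|f' s| <= g s) ->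
  (`|Rintegral lebesgue_measure `[0%R, t'] f' - Rintegral lebesgue_measure `[0%R, t] f|%:E
    <= \int[lebesgue_measure]_(s in `[0%R, t']) (g s)%:E)%E.
Proof.
move=> tt' fi fi' mg h1 h2.
have sub : `[0, t] `<=` `[0, t'] by apply: subset_itvl; rewrite bnd_simp.
have fpi : lebesgue_measure.-integrable `[0, t'] (EFin \o (f \_ `[0, t])).
  rewrite -restrict_EFin; apply/(integrable_mkcond _ _).2 => //.
  rewrite -patch_setI ((setIidPr _ _).2 sub).
  exact/(integrable_mkcond _ _).1.
have -> : Rintegral lebesgue_measure `[0, t] f =
          Rintegral lebesgue_measure `[0, t'] (f \_ `[0, t]).
  by rewrite -Rintegral_mkcondr ((setIidPr _ _).2 sub).
rewrite -RintegralB// -abse_EFin /Rintegral.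
have fB : lebesgue_measure.-integrable `[0, t']
    (fun s => (f' s - (f \_ `[0, t]) s)%:E).
  by have := integrableB _ fi' fpi; exact.
rewrite fineK; last exact: integrable_fin_num.
have mf := measurable_int _ fB.
apply: (le_trans (le_abse_integral _ _ mf)) => //.
apply: ge0_le_integral => //.
- exact: measurableT_comp.
- exact/measurable_EFinP/measurable_funTS.
move=> s; rewrite /= in_itv/= => /andP[s0 st']; rewrite lee_fin patchE mem_setE in_itv/= s0/=.
by have [st|ts] := leP s t; [exact: h1|rewrite subr0; exact: h2].
Qed.

Section law_moments.
Context {disp : measure_display} {Omega : measurableType disp} {R : realType}.
Context {P : probability Omega R} {d : nat}.

Lemma second_moment_law (Y : Omega -> 'cV[R]_d) (mu : P2 R d) :
  measurable_fun setT Y -> is_law P Y mu ->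
  second_moment (sval mu) = (\int[P]_w (hsnorm (Y w) ^+ 2)%:E)%E.
Proof.
move=> mY law; rewrite /second_moment.
rewrite (@eq_measure_integral _ _ _ setT (pushforward P Y)); last by move=> A mA _; exact: law.
rewrite (@ge0_integral_pushforward _ _ _ _ _ Y mY P setT (fun y => (hsnorm y ^+ 2)%:E))//.
  by apply/measurable_EFinP; apply: measurable_funX; exact: measurable_hsnorm.
by move=> y _; rewrite lee_fin sqr_ge0.
Qed.

(** Combines [x^2 <= 1 + x^p] with [W <= 1 + W^2], which avoids roots of moments. *)
Lemma W2_delta0_moment (Y : Omega -> 'cV[R]_d) (mu : P2 R d) (p M : R) :
  2 <= p -> 0 <= M -> measurable_fun setT Y -> is_law P Y mu ->
  (\int[P]_w (hsnorm (Y w) `^ p)%:E <= M%:E)%E ->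
  W2 mu (delta0 R d) <= 2 + M.
Proof.
move=> p2 M0 mY law YM; set W := W2 _ _.
have mhY : measurable_fun setT (fun w => hsnorm (Y w)).
  exact: (measurableT_comp (@measurable_hsnorm R d 1) mY).
suff : ((W ^+ 2)%:E <= (1 + M)%:E)%E.
  by rewrite lee_fin; nra.
apply: (le_trans (sqr_W2_delta0 mu)); rewrite (second_moment_law mY law).
apply: (@le_trans _ _ (\int[P]_w (1 + (hsnorm (Y w) `^ p)%:E))%E).
  apply: ge0_le_integral => //.
  - by move=> w _; rewrite lee_fin sqr_ge0.
  - by apply/measurable_EFinP; exact: measurable_funX.
  - apply: emeasurable_funD => //; apply/measurable_EFinP.
    exact: (measurableT_comp (measurable_powR p) mhY).
  move=> w _; rewrite -EFinD lee_fin.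
  have := hsnorm_ge0 (Y w); move: (hsnorm (Y w)) => x x0.
  have [x1|x1] := leP x 1.
    by apply: (@le_trans _ _ 1); [rewrite expr_le1|rewrite lerDl powR_ge0].
  rewrite -powR_mulrn//; apply: (@le_trans _ _ (x `^ p)); last by rewrite lerDr.
  by rewrite ler_powR// ltW.
rewrite ge0_integralD//.
- by rewrite integral_cst//= mul1e probability_setT EFinD leeD2l.
- by move=> w _; rewrite lee_fin powR_ge0.
by apply/measurable_EFinP; exact: (measurableT_comp (measurable_powR p) mhY).
Qed.

End law_moments.

Lemma solution_moment_bound (R : realType) (disp : measure_display)
    (Omega : measurableType disp) (P : probability Omega R)
    (F : R -> set (set Omega)) (d m : nat) (W : R -> Omega -> 'cV[R]_m)
    (T p : R) b sigma (X0 : Omega -> 'cV[R]_d) X L :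
  volterra_solution P F W T p b sigma X0 X L ->
  ('E_P[fun w => (hsnorm (X0 w) `^ p)%R] < +oo)%E ->
  exists2 M : R, 0 <= M & forall t, 0 <= t -> t <= T ->
    (\int[P]_w (hsnorm (X t w) `^ p)%:E <= M%:E)%E.
Proof.
move=> sol; rewrite expectation.unlock => X0p.
have [c] := solution_moment sol; rewrite expectation.unlock.
have X00 : (0 <= \int[P]_w (hsnorm (X0 w) `^ p)%:E)%E.
  by apply: integral_ge0 => w _; rewrite lee_fin powR_ge0.
have : (\int[P]_w (hsnorm (X0 w) `^ p)%:E \is a fin_num)%E by rewrite ge0_fin_numE.
move=> /fineK E0; rewrite -E0 in X00 *; move: (fine _) X00 => A; rewrite lee_fin => A0 h.
exists (`|c| * (A + 1)) => [|t t0 tT]; first by rewrite mulr_ge0// addr_ge0.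
apply: (le_trans (h t t0 tT)); rewrite -EFinD -EFinM lee_fin.
by rewrite ler_wpM2r ?ler_norm// addr_ge0.
Qed.

(** The distance to [delta0] is replaced by its uniform bound [2 + M], so that [Z] is jointly
    measurable whatever the dependence of [L s] on [s]. *)
Lemma solution_weight (R : realType) (disp : measure_display)
    (Omega : measurableType disp) (P : probability Omega R)
    (F : R -> set (set Omega)) (d m : nat) (W : R -> Omega -> 'cV[R]_m)
    (T p : R) b sigma (X0 : Omega -> 'cV[R]_d) X L :
  usual_filtration P F -> 0 <= T -> 2 <= p ->
  volterra_solution P F W T p b sigma X0 X L ->
  ('E_P[fun w => (hsnorm (X0 w) `^ p)%R] < +oo)%E ->
  exists (Z : R * Omega -> R) (A : R), [/\ 0 < A, measurable_fun setT Z,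
    (forall z, 0 <= Z z),
    (forall s w, 0 <= s -> s <= T ->
      1 + hsnorm (X s w) + W2 (L s) (delta0 R d) <= Z (s, w)) &
    forall s, 0 <= s -> s <= T -> (\int[P]_w (Z (s, w) `^ p)%:E <= A%:E)%E].
Proof.
move=> FU T0 p2 sol X0p; have p0 : 0 <= p by lra.
have [M M0 XM] := solution_moment_bound sol X0p.
have mX s : 0 <= s -> s <= T -> measurable_fun setT (X s).
  move=> s0 sT; apply: measurable_wrt_fun (solution_adapted sol s0 sT).
  exact: (filtration_sub FU s0).
pose D : set (R * Omega) := `[0, T] `*` setT.
have mD : measurable D by apply: measurableX => //; exact: measurable_itv.
pose N := (fun z : R * Omega => hsnorm (X z.1 z.2)) \_ D.
have mN : measurable_fun setT N.
  have mXD := measurableT_comp (@measurable_hsnorm R d 1) (solution_measurable sol).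
  exact: (measurable_restrictT _ mD).1 mXD.
have NE s w : 0 <= s -> s <= T -> N (s, w) = hsnorm (X s w).
  by move=> s0 sT; rewrite /N patchE mem_set//; split => //=; rewrite in_itv/= s0.
have N0 z : 0 <= N z by rewrite /N patchE; case: ifP => // _; exact: hsnorm_ge0.
exists (fun z => 1 + N z + (2 + M)), (2 `^ p * (M + (3 + M) `^ p)); split.
- by rewrite mulr_gt0 ?powR_gt0// ltr_wpDl// powR_gt0; lra.
- by apply: measurable_funD => //; apply: measurable_funD.
- by move=> z; rewrite !addr_ge0.
- move=> s w s0 sT; rewrite NE// lerD2l.
  exact: (W2_delta0_moment p2 M0 (mX s s0 sT) (solution_law sol s0 sT) (XM s s0 sT)).
move=> s s0 sT.
have mh : measurable_fun setT (fun w => (hsnorm (X s w) `^ p)%:E).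
  apply/measurable_EFinP; apply: (measurableT_comp (measurable_powR p)).
  exact: (measurableT_comp (@measurable_hsnorm R d 1) (mX s s0 sT)).
have mZ : measurable_fun setT (fun w => ((1 + N (s, w) + (2 + M)) `^ p)%:E).
  apply/measurable_EFinP; apply: (measurableT_comp (measurable_powR p)).
  apply: measurable_funD => //; apply: measurable_funD => //.
  exact: (measurableT_comp mN (measurable_pair1 s)).
apply: (@le_trans _ _ (\int[P]_w ((2 `^ p)%:E * (hsnorm (X s w) `^ p)%:E +
    (2 `^ p * (3 + M) `^ p)%:E * 1))%E).
  apply: ge0_le_integral => //.
  - by move=> w _; rewrite lee_fin powR_ge0.
  - by apply: emeasurable_funD => //; exact: measurable_funeM.
  move=> w _; rewrite NE// mule1 -EFinM -EFinD lee_fin -mulrDr.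
  have x0 := hsnorm_ge0 (X s w); move: (hsnorm _) x0 => x x0.
  have -> : 1 + x + (2 + M) = x + (3 + M) by ring.
  have M3 : 0 <= 3 + M by lra.
  by have := ler_powRD x (3 + M) p0; rewrite !ger0_norm// addr_ge0.
rewrite (@ge0_integral_lincomb _ _ _ P setT (fun w => (hsnorm (X s w) `^ p)%:E) (cst 1%E))//;
  do ?[by move=> w; rewrite lee_fin powR_ge0|by rewrite mulr_ge0 ?powR_ge0|exact: powR_ge0].
rewrite integral_cst//= probability_setT !mule1 mulrDr EFinD leeD2r// EFinM.
by rewrite lee_wpmul2l// ?lee_fin ?powR_ge0// XM.
Qed.

Lemma drift_increment_moment (R : realType) (disp : measure_display)
    (Omega : measurableType disp) (P : probability Omega R)
    (p A a t t' : R) (k : R -> R) (Z : R * Omega -> R)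
    (f f' : R -> Omega -> R) (y : Omega -> R) :
  1 <= p -> 0 < A -> 0 < a -> 0 <= t -> t <= t' ->
  measurable_fun setT k -> measurable_fun setT Z -> measurable_fun setT y ->
  (forall s, 0 <= k s) -> (forall z, 0 <= Z z) ->
  (forall s, 0 <= s -> s <= t' -> (\int[P]_w (Z (s, w) `^ p)%:E <= A%:E)%E) ->
  (\int[lebesgue_measure]_(s in `[0%R, t']) (k s)%:E <= a%:E)%E ->
  {ae P, forall w, lebesgue_measure.-integrable `[0, t] (fun s => (f s w)%:E)} ->
  {ae P, forall w, lebesgue_measure.-integrable `[0, t'] (fun s => (f' s w)%:E)} ->
  (forall s w, 0 <= s -> s <= t -> `|f' s w - f s w| <= k s * Z (s, w)) ->
  (forall s w, 0 <= s -> t < s -> s <= t' -> `|f' s w| <= k s * Z (s, w)) ->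
  {ae P, forall w, y w = Rintegral lebesgue_measure `[0, t'] (f'^~ w) -
                         Rintegral lebesgue_measure `[0, t] (f^~ w)} ->
  (\int[P]_w (`|y w| `^ p)%:E <= (2 `^ p * a `^ p * A)%:E)%E.
Proof.
move=> p1 A0 a0 t0 tt' mk mZ my k0 Z0 ZA ka fi fi' h1 h2 yE.
apply: (@weighted_integral_moment _ _ _ P p a A `[0, t'] k Z) => //.
- exact: ltW.
- by move=> s; rewrite /= in_itv/= => /andP[s0 st']; exact: ZA.
apply: filterS3 fi fi' yE => w fi fi' ->.
apply: Rintegral_glued_le => //; last by move=> s; exact: h2.
- by apply: measurable_funM => //; exact: (measurableT_comp mZ (measurable_pair2 w)).
- by move=> s; exact: h1.
Qed.

Lemma diffusion_increment_moment (R : realType) (disp : measure_display)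
    (Omega : measurableType disp) (P : probability Omega R)
    (F : R -> set (set Omega)) (d m : nat) (W : R -> Omega -> 'cV[R]_m) (p : R) :
  usual_filtration P F -> brownian_motion P F W -> 2 <= p ->
  exists2 kappa : R, 0 < kappa &
  forall (A a t t' : R) (k : R -> R) (Z : R * Omega -> R)
    (H H' : R -> Omega -> 'M[R]_(d, m)) (I I' : Omega -> 'cV[R]_d) (i : 'I_d),
  0 < A -> 0 < a -> 0 <= t -> t <= t' -> 0 < t' ->
  measurable_fun setT k -> measurable_fun setT Z ->
  (forall s, 0 <= k s) -> (forall z, 0 <= Z z) ->
  (forall s, 0 <= s -> s <= t' -> (\int[P]_w (Z (s, w) `^ p)%:E <= A%:E)%E) ->
  (\int[lebesgue_measure]_(s in `]0%R, t']) (k s)%:E <= a%:E)%E ->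
  ito_integral P F W H t I -> ito_integral P F W H' t' I' ->
  (forall s w, 0 <= s -> s <= t -> hsnorm (H' s w - H s w) ^+ 2 <= k s * Z (s, w) ^+ 2) ->
  (forall s w, 0 <= s -> t < s -> s <= t' -> hsnorm (H' s w) ^+ 2 <= k s * Z (s, w) ^+ 2) ->
  (\int[P]_w (`|I' w i 0 - I w i 0| `^ p)%:E <=
   ((kappa * (A `^ (p / 2)^-1 * a)) `^ (p / 2))%:E)%E.
Proof.
move=> FU WB p2; have [kappa kappa0 ito] := ito_increment_moment d FU WB p2.
exists kappa => // A a t t' k Z H H' I I' i A0 a0 t0 tt' t'0 mk mZ k0 Z0 ZA ka IH IH' h1 h2.
have q0 : 0 < p / 2 by rewrite divr_gt0//; lra.
have Aq0 : 0 < A `^ (p / 2)^-1 by rewrite powR_gt0.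
(* The entry is bounded by [k^(1/2) Z], hence its [p]-th moment by [k^(p/2) A], which is the power
   [p/2] of [A^(2/p) k]. *)
apply: (ito t t' H H' I I' i (fun s => A `^ (p / 2)^-1 * k s)) => //.
- by apply: measurable_funTS; exact: measurable_funM.
- by move=> s _; rewrite mulr_ge0// ltW.
- move=> j s; rewrite in_itv/= => /andP[s0 st'].
  set D := fun w => H' s w i j - (if s <= t then H s w i j else 0).
  have mH (r : R) (G : R -> Omega -> 'M[R]_(d, m)) J : 0 <= r -> s <= r ->
      ito_integral P F W G r J -> measurable_fun setT (fun w => G s w i j).
    move=> r0 sr IG; apply: (measurableT_comp (measurable_coord i j)).
    apply: measurable_wrt_fun (ito_integrand_adapted IG (ltW s0) sr).
    exact: (filtration_sub FU (ltW s0)).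
  have mD : measurable_fun setT D.
    apply: measurable_funB; first exact: (mH t' H' I' (ltW t'0) st' IH').
    by have [st|//] := leP s t; exact: (mH t H I t0 st IH).
  have D2 w : D w ^+ 2 <= k s * Z (s, w) ^+ 2.
    rewrite /D; have [st|ts] := leP s t.
      apply: le_trans (h1 s w (ltW s0) st).
      by have := sqr_coord_hsnorm (H' s w - H s w) i j; rewrite !mxE.
    by rewrite subr0; apply: le_trans (h2 s w (ltW s0) ts st'); exact: sqr_coord_hsnorm.
  have mZs : measurable_fun setT (fun w => (Z (s, w) `^ p)%:E).
    apply/measurable_EFinP; apply: (measurableT_comp (measurable_powR p)).
    exact: (measurableT_comp mZ (measurable_pair1 s)).
  apply: (@le_trans _ _ (\int[P]_w ((k s `^ (p / 2))%:E * (Z (s, w) `^ p)%:E))%E).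
    apply: ge0_le_integral => //.
    - apply/measurable_EFinP; apply: (measurableT_comp (measurable_powR p)).
      exact: measurableT_comp.
    - exact: measurable_funeM.
    move=> w _; rewrite -EFinM lee_fin.
    have sq (x : R) : 0 <= x -> x `^ p = (x ^+ 2) `^ (p / 2).
      by move=> x0; rewrite -powR_mulrn// -powRrM mulrC divfK.
    rewrite (sq (`|D w|))// (sq (Z (s, w)))// real_normK ?num_real//.
    rewrite -(powRM _ (k0 s) (sqr_ge0 (Z (s, w)))).
    apply: ge0_ler_powR; rewrite ?nnegrE ?sqr_ge0 ?(ltW q0)//.
    by rewrite mulr_ge0 ?sqr_ge0.
  rewrite ge0_integralZl//; last by rewrite lee_fin powR_ge0.
    rewrite (powRM _ (ltW Aq0) (k0 s)) -powRrM mulVf ?gt_eqF// powRr1 ?(ltW A0)//.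
    rewrite [A * _]mulrC EFinM lee_wpmul2l ?lee_fin ?powR_ge0//; apply: ZA => //; exact: ltW.
  by move=> w _; rewrite lee_fin powR_ge0.
- by rewrite mulr_gt0.
have mkE : measurable_fun `]0, t'] (fun s => (k s)%:E).
  by apply/measurable_EFinP; exact: measurable_funTS.
under eq_integral do rewrite EFinM.
rewrite ge0_integralZl//; do ?[by move=> s _; rewrite lee_fin|by rewrite lee_fin ltW].
by rewrite EFinM lee_wpmul2l ?lee_fin ?(ltW Aq0).
Qed.

(** Both kernels integrate to order [h^gamma] with [h = t' - t]. The drift gets the power [p], the
    diffusion only [p / 2] because its kernel dominates the square of [sigma]; the diffusion
    therefore fixes the exponent. *)
Lemma solution_increment_moment (R : realType) (disp : measure_display)
    (Omega : measurableType disp) (P : probability Omega R)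
    (F : R -> set (set Omega)) (d m : nat) (W : R -> Omega -> 'cV[R]_m)
    (T gamma p : R) (X0 : Omega -> 'cV[R]_d)
    (b : R -> R -> 'cV[R]_d -> P2 R d -> 'cV[R]_d)
    (sigma : R -> R -> 'cV[R]_d -> P2 R d -> 'M[R]_(d, m))
    (K3 K4 : R -> R -> R) (C : R) (F1 F2 : R -> R -> R -> R)
    (X : R -> Omega -> 'cV[R]_d) (L : R -> P2 R d) :
  usual_filtration P F -> brownian_motion P F W ->
  0 < T -> 0 < gamma -> 2 <= p ->
  ('E_P[fun w => (hsnorm (X0 w) `^ p)%R] < +oo)%E ->
  kernel_class K3 -> kernel_class K4 ->
  drift_kernel_regular T C gamma K3 -> diffusion_kernel_regular T C gamma K4 ->
  (forall (t s : R) x mu, 0 <= s -> s <= t -> t <= T ->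
    hsnorm (b t s x mu) <= K3 t s * (1 + hsnorm x + W2 mu (delta0 R d))) ->
  (forall (t s : R) x mu, 0 <= s -> s <= t -> t <= T ->
    hsnorm (sigma t s x mu) ^+ 2 <=
    K4 t s * (1 + hsnorm x ^+ 2 + W2 mu (delta0 R d) ^+ 2)) ->
  (forall t' t s : R, t' \in `[0, T] -> t \in `[0, T] -> s \in `[0, T] ->
    0 <= F1 t' t s /\ 0 <= F2 t' t s) ->
  (forall t' t : R, t' \in `[0, T] -> t \in `[0, T] ->
    measurable_fun `[0, t] (F1 t' t) /\ measurable_fun `[0, t] (F2 t' t)) ->
  (forall (t' t s : R) x mu, t' \in `[0, T] -> t \in `[0, T] -> s \in `[0, T] ->
    hsnorm (b t' s x mu - b t s x mu) <=
    F1 t' t s * (1 + hsnorm x + W2 mu (delta0 R d))) ->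
  (forall (t' t s : R) x mu, t' \in `[0, T] -> t \in `[0, T] -> s \in `[0, T] ->
    hsnorm (sigma t' s x mu - sigma t s x mu) ^+ 2 <=
    F2 t' t s * (1 + hsnorm x ^+ 2 + W2 mu (delta0 R d) ^+ 2)) ->
  (forall t' t : R, t' \in `[0, T] -> t \in `[0, T] ->
    (\int[lebesgue_measure]_(s in `[0%R, t]) (F1 t' t s)%:E
      <= (C * `|t - t'| `^ gamma)%:E)%E) ->
  (forall t' t : R, t' \in `[0, T] -> t \in `[0, T] ->
    (\int[lebesgue_measure]_(s in `[0%R, t]) (F2 t' t s)%:E
      <= (C * `|t - t'| `^ (2 * gamma))%:E)%E) ->
  volterra_solution P F W T p b sigma X0 X L ->
  exists2 c : R, 0 <= c & forall (i : 'I_d) t t', 0 <= t -> t <= t' -> t' <= T ->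
    (\int[P]_w (`|X t' w i 0 - X t w i 0| `^ p)%:E
       <= (c * (t' - t) `^ (gamma * (p / 2)))%:E)%E.
Proof.
move=> FU WB T0 g0 p2 X0p KK3 KK4 RK3 RK4 b_growth s_growth F0 mF b_time s_time RF1 RF2 sol.
have p0 : 0 < p by lra.
have q0 : 0 < p / 2 by rewrite divr_gt0.
have [Z [A [A0 mZ Z0 ZX ZA]]] := solution_weight FU (ltW T0) p2 sol X0p.
have [kappa kappa0 dif] := diffusion_increment_moment d FU WB p2.
(* The first summand covers [F1] as well as [F2], whose order [h^(2 gamma)] is at most
   [T^gamma h^gamma]. The second is the tail constant. The absolute value is there because [C] has
   no prescribed sign. *)
pose Ca := `|C| * (1 + T `^ gamma) + (`|C| + T).
have Ca0 : 0 < Ca.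
  by rewrite ltr_wpDl// ?ltr_wpDl// mulr_ge0// addr_ge0 ?powR_ge0.
(* The drift yields [h^(gamma p)]; half of this exponent is traded for a power of [T]. *)
pose c1 := 2 `^ p * Ca `^ p * A * T `^ (gamma * (p / 2)).
pose c2 := (kappa * (A `^ (p / 2)^-1 * Ca)) `^ (p / 2).
have Aq0 : 0 < A `^ (p / 2)^-1 by rewrite powR_gt0.
have kACa0 : 0 <= kappa * (A `^ (p / 2)^-1 * Ca).
  by rewrite !mulr_ge0 ?(ltW kappa0) ?(ltW Aq0) ?(ltW Ca0).
have c10 : 0 <= c1 by rewrite /c1 !mulr_ge0 ?powR_ge0 ?(ltW A0).
exists (2 `^ p * (c1 + c2)) => [|i t t' t0 tt' t'T].
  by rewrite mulr_ge0 ?powR_ge0// addr_ge0 ?powR_ge0.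
(* The tail estimate divides by a power of [t' - t], so equal times are settled first. *)
move: tt'; rewrite le_eqVlt => /orP[/eqP ->|tt'].
  under eq_integral do rewrite subrr normr0 powR0 ?gt_eqF//.
  by rewrite integral0 lee_fin mulr_ge0 ?powR_ge0// mulr_ge0 ?powR_ge0// addr_ge0 ?powR_ge0.
have tT : t <= T by rewrite (le_trans (ltW tt')).
have t'0 : 0 < t' by exact: le_lt_trans tt'.
have tI : t \in `[0, T] by rewrite in_itv/= t0.
have t'I : t' \in `[0, T] by rewrite in_itv/= (ltW t'0).
have sI s : 0 <= s -> s <= t -> s \in `[0, T].
  by move=> s0 st; rewrite in_itv/= s0 (le_trans st).
have h0 : 0 < t' - t by rewrite subr_gt0.
have hn : `|t - t'| = t' - t by rewrite distrC gtr0_norm.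
have hT : t' - t <= T by lra.
set h := t' - t in h0 hn hT *.
have l0 : 0 < h `^ gamma by rewrite powR_gt0.
have lT : h `^ gamma <= T `^ gamma.
  by apply: ge0_ler_powR; rewrite ?nnegrE ?(ltW g0) ?(ltW h0) ?(ltW T0).
have CaE (x : R) : x <= `|C| * (1 + T `^ gamma) * h `^ gamma ->
    x + (C + T) * h `^ gamma <= Ca * h `^ gamma.
  by move=> hx; rewrite /Ca [leRHS]mulrDl lerD// ler_wpM2r ?(ltW l0)// lerD2r ler_norm.
have [mF1 mF2] := mF t' t t'I tI.
have F10 s : 0 <= s -> s <= t -> 0 <= F1 t' t s.
  by move=> s0 st; have [] := F0 t' t s t'I tI (sI s s0 st).
have F20 s : 0 <= s -> s <= t -> 0 <= F2 t' t s.
  by move=> s0 st; have [] := F0 t' t s t'I tI (sI s s0 st).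
have Kpos K s : kernel_class K -> t < s -> s <= t' -> 0 <= K t' s.
  by move=> KK ts st'; apply: (kernel_ge0 KK) => //; rewrite (le_trans t0)// ltW.
have K30 s : t < s -> s <= t' -> 0 <= K3 t' s by exact: Kpos.
have K40 s : t < s -> s <= t' -> 0 <= K4 t' s by exact: Kpos.
have mK3 := @kernel_section_measurable R K3 t t' KK3 t0.
have mK4 := @kernel_section_measurable R K4 t t' KK4 t0.
pose kb := glued_kernel t t' (F1 t' t) (K3 t').
pose ks := glued_kernel t t' (F2 t' t) (K4 t').
have kb0 : forall s, 0 <= kb s by apply: glued_kernel_ge0.
have ks0 : forall s, 0 <= ks s by apply: glued_kernel_ge0.
have mkb : measurable_fun setT kb by apply: measurable_glued_kernel.
have mks : measurable_fun setT ks by apply: measurable_glued_kernel.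
have kbI (B : set R) : measurable B ->
    (\int[lebesgue_measure]_(s in B) (kb s)%:E <= (Ca * h `^ gamma)%:E)%E.
  move=> mB; apply: (@le_trans _ _
    (`|C| * (1 + T `^ gamma) * h `^ gamma + (C + T) * h `^ gamma)%:E).
    apply: glued_kernel_integral => //.
      apply: (le_trans (RF1 t' t t'I tI)); rewrite lee_fin hn ler_wpM2r ?(ltW l0)//.
      by rewrite (le_trans (ler_norm C))// ler_peMr// lerDl powR_ge0.
    exact: (kernel_tail_integral t0 tt' t'T g0 mK3 K30 (RK3 t t' t0 (ltW tt') t'T).2).
  by rewrite lee_fin CaE.
have ksI (B : set R) : measurable B ->
    (\int[lebesgue_measure]_(s in B) (ks s)%:E <= (Ca * h `^ gamma)%:E)%E.
  move=> mB; apply: (@le_trans _ _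
    (`|C| * (1 + T `^ gamma) * h `^ gamma + (C + T) * h `^ gamma)%:E).
    apply: glued_kernel_integral => //.
      apply: (le_trans (RF2 t' t t'I tI)); rewrite lee_fin hn.
      rewrite [2 * gamma]mulrC powRrM powR_mulrn ?powR_ge0// expr2 mulrA.
      rewrite ler_wpM2r ?(ltW l0)// (@le_trans _ _ (`|C| * h `^ gamma))//.
        by rewrite ler_wpM2r ?(ltW l0)// ler_norm.
      by rewrite ler_wpM2l//; lra.
    exact: (kernel_tail_integral t0 tt' t'T g0 mK4 K40 (RK4 t t' t0 (ltW tt') t'T).2).
  by rewrite lee_fin CaE.
have a0 : 0 < Ca * h `^ gamma by rewrite mulr_gt0.
have ZA' s : 0 <= s -> s <= t' -> (\int[P]_w (Z (s, w) `^ p)%:E <= A%:E)%E.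
  by move=> s0 st'; apply: ZA => //; exact: le_trans t'T.
have W20 mu : 0 <= W2 mu (delta0 R d) by exact: sqrtr_ge0.
have Z1 s w c x : 0 <= s -> s <= t' -> 0 <= c ->
    x <= c * (1 + hsnorm (X s w) + W2 (L s) (delta0 R d)) -> x <= c * Z (s, w).
  move=> s0 st' c0 hx; apply: (le_trans hx); rewrite ler_wpM2l//; apply: ZX => //.
  exact: le_trans t'T.
have Z2 s w c x : 0 <= s -> s <= t' -> 0 <= c ->
    x <= c * (1 + hsnorm (X s w) ^+ 2 + W2 (L s) (delta0 R d) ^+ 2) ->
    x <= c * Z (s, w) ^+ 2.
  (* A sum of squares of nonnegative numbers is at most the square of the sum, so the weight of the
     drift also serves the diffusion. *)
  move=> s0 st' c0 hx; apply: (le_trans hx); rewrite ler_wpM2l//.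
  have := ZX s w s0 (le_trans st' t'T).
  have := hsnorm_ge0 (X s w); have := W20 (L s).
  move: (hsnorm _) (W2 _ _) (Z _) => u v z; nra.
have [I IH IE] := solution_equation sol t0 tT.
have [I' IH' IE'] := solution_equation sol (ltW t'0) t'T.
have mX s : 0 <= s -> s <= T -> measurable_fun setT (fun w => X s w i 0).
  move=> s0 sT; apply: (measurableT_comp (measurable_coord i 0)).
  apply: measurable_wrt_fun (solution_adapted sol s0 sT).
  exact: (filtration_sub FU s0).
have mI (J : Omega -> 'cV[R]_d) : measurable_fun setT J -> measurable_fun setT (fun w => J w i 0).
  by move=> mJ; exact: (measurableT_comp (measurable_coord i 0) mJ).
have mdI : measurable_fun setT (fun w => I' w i 0 - I w i 0).
  by apply: measurable_funB; apply: mI; [exact: ito_measurable IH'|exact: ito_measurable IH].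
pose y w := X t' w i 0 - X t w i 0 - (I' w i 0 - I w i 0).
have my : measurable_fun setT y.
  apply: measurable_funB => //; apply: measurable_funB; apply: mX => //; exact: ltW.
have yp : (\int[P]_w (`|y w| `^ p)%:E <= (c1 * h `^ (gamma * (p / 2)))%:E)%E.
  apply: (@le_trans _ _ (2 `^ p * (Ca * h `^ gamma) `^ p * A)%:E).
    apply: (@drift_increment_moment _ _ _ P p A (Ca * h `^ gamma) t t' kb Z
      (fun s w => b t s (X s w) (L s) i 0) (fun s w => b t' s (X s w) (L s) i 0)) => //.
    - by lra.
    - exact: ltW.
    - exact: kbI.
    - by apply: filterS (solution_drift_integrable sol t0 tT) => w; exact.
    - by apply: filterS (solution_drift_integrable sol (ltW t'0) t'T) => w; exact.
    - move=> s w s0 st; have st' : s <= t' by rewrite (le_trans st)// ltW.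
      rewrite /kb glued_kernel_left//.
      apply: Z1 => //; first exact: F10.
      apply: le_trans (b_time t' t s (X s w) (L s) t'I tI (sI s s0 st)).
      have := ler_coord_hsnorm (b t' s (X s w) (L s) - b t s (X s w) (L s)) i 0.
      by rewrite !mxE.
    - move=> s w s0 ts st'; rewrite /kb glued_kernel_right//.
      apply: Z1 => //; first exact: K30.
      apply: le_trans (b_growth t' s (X s w) (L s) s0 st' t'T).
      exact: ler_coord_hsnorm.
    by apply: filterS2 IE IE' => w E E'; rewrite /y E E' !mxE; ring.
  rewrite lee_fin (powRM _ (ltW Ca0) (ltW l0)) /c1.
  have -> : h `^ gamma `^ p = h `^ (gamma * (p / 2)) * h `^ (gamma * (p / 2)).
    by rewrite -powRrM -powRD ?(gt_eqF h0) ?implybT// -mulrDr -splitr.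
  have hTq : h `^ (gamma * (p / 2)) <= T `^ (gamma * (p / 2)).
    have gq0 : 0 <= gamma * (p / 2) by rewrite mulr_ge0// ltW.
    by apply: ge0_ler_powR; rewrite ?nnegrE ?(ltW h0) ?(ltW T0).
  rewrite [X in X <= _](_ : _ = 2 `^ p * Ca `^ p * A * h `^ (gamma * (p / 2)) *
    h `^ (gamma * (p / 2))); last by ring.
  rewrite ler_wpM2r ?powR_ge0// ler_wpM2l// !mulr_ge0 ?powR_ge0// ltW//.
have dp : (\int[P]_w (`|I' w i 0 - I w i 0| `^ p)%:E <= (c2 * h `^ (gamma * (p / 2)))%:E)%E.
  have -> : c2 * h `^ (gamma * (p / 2)) =
      (kappa * (A `^ (p / 2)^-1 * (Ca * h `^ gamma))) `^ (p / 2).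
    by rewrite /c2 [h `^ (_ * (_ / _))]powRrM -(powRM _ kACa0 (ltW l0)) !mulrA.
  apply: (dif A (Ca * h `^ gamma) t t' ks Z (fun s w => sigma t s (X s w) (L s))
      (fun s w => sigma t' s (X s w) (L s))) => //.
  - exact: ltW.
  - exact: ksI.
  - move=> s w s0 st; have st' : s <= t' by rewrite (le_trans st)// ltW.
    rewrite /ks glued_kernel_left//.
    by apply: Z2 => //; [exact: F20|exact: s_time _ _ _ _ _ t'I tI (sI s s0 st)].
  - move=> s w s0 ts st'; rewrite /ks glued_kernel_right//.
    by apply: Z2 => //; [exact: K40|exact: s_growth].
have mp (f : Omega -> R) : measurable_fun setT f -> measurable_fun setT (fun w => (`|f w| `^ p)%:E).
  move=> mf; apply/measurable_EFinP; apply: (measurableT_comp (measurable_powR p)).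
  exact: measurableT_comp.
apply: (@le_trans _ _ (\int[P]_w ((2 `^ p)%:E * (`|y w| `^ p)%:E +
    (2 `^ p)%:E * (`|I' w i 0 - I w i 0| `^ p)%:E))%E).
  apply: ge0_le_integral => //.
  - by apply: mp; apply: measurable_funB; apply: mX => //; exact: ltW.
  - by apply: emeasurable_funD; apply: measurable_funeM; exact: mp.
  move=> w _; rewrite -!EFinM -EFinD lee_fin -mulrDr.
  by have := ler_powRD (y w) (I' w i 0 - I w i 0) (ltW p0); rewrite /y subrK.
rewrite (@ge0_integral_lincomb _ _ _ P setT (fun w => (`|y w| `^ p)%:E)
  (fun w => (`|I' w i 0 - I w i 0| `^ p)%:E))//;
  do ?[by apply: mp|by move=> w; rewrite lee_fin powR_ge0|exact: powR_ge0].
apply: (le_trans (leeD (lee_wpmul2l _ yp) (lee_wpmul2l _ dp)));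
  rewrite ?lee_fin ?powR_ge0//.
by rewrite -mulrDr -mulrDl mulrA.
Qed.

Theorem theorem3p2
  (R : realType) (disp : measure_display) (Omega : measurableType disp)
  (P : probability Omega R) (F : R -> set (set Omega))
  (d m : nat) (W : R -> Omega -> 'cV[R]_m)
  (T gamma p : R) (X0 : Omega -> 'cV[R]_d)
  (b : R -> R -> 'cV[R]_d -> P2 R d -> 'cV[R]_d)
  (sigma : R -> R -> 'cV[R]_d -> P2 R d -> 'M[R]_(d, m))
  (K1 K2 K3 K4 : R -> R -> R) (C : R) (F1 F2 : R -> R -> R -> R)
  (X : R -> Omega -> 'cV[R]_d) (L : R -> P2 R d)
  (P_complete : measure_is_complete P)
  (F_usual : usual_filtration P F)
  (W_bm : brownian_motion P F W)
  (T_gt0 : 0 < T) (gamma_gt0 : 0 < gamma) (p_gt : Num.max 2 (2 / gamma) < p)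
  (X0_measurable : measurable_wrt (F 0) X0)
  (X0_Lp : ('E_P[fun w => (hsnorm (X0 w) `^ p)%R] < +oo)%E)
  (b_measurable : measurable_fun
    [set z : R * R * 'cV[R]_d * P2 R d | 0 <= z.1.1.1 /\ 0 <= z.1.1.2]
    (fun z => b z.1.1.1 z.1.1.2 z.1.2 z.2))
  (sigma_measurable : measurable_fun
    [set z : R * R * 'cV[R]_d * P2 R d | 0 <= z.1.1.1 /\ 0 <= z.1.1.2]
    (fun z => sigma z.1.1.1 z.1.1.2 z.1.2 z.2))
  (K1_class : kernel_class K1) (K2_class : kernel_class K2)
  (K3_class : kernel_class K3) (K4_class : kernel_class K4)
  (K1_regular : drift_kernel_regular T C gamma K1)
  (K3_regular : drift_kernel_regular T C gamma K3)
  (K2_regular : diffusion_kernel_regular T C gamma K2)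
  (K4_regular : diffusion_kernel_regular T C gamma K4)
  (b_lipschitz : forall (t s : R) x y mu nu, 0 <= s -> s <= t -> t <= T ->
    hsnorm (b t s x mu - b t s y nu) <=
    K1 t s * (hsnorm (x - y) + W2 mu nu))
  (sigma_lipschitz : forall (t s : R) x y mu nu, 0 <= s -> s <= t -> t <= T ->
    hsnorm (sigma t s x mu - sigma t s y nu) ^+ 2 <=
    K2 t s * (hsnorm (x - y) ^+ 2 + W2 mu nu ^+ 2))
  (b_growth : forall (t s : R) x mu, 0 <= s -> s <= t -> t <= T ->
    hsnorm (b t s x mu) <=
    K3 t s * (1 + hsnorm x + W2 mu (delta0 R d)))
  (sigma_growth : forall (t s : R) x mu, 0 <= s -> s <= t -> t <= T ->
    hsnorm (sigma t s x mu) ^+ 2 <=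
    K4 t s * (1 + hsnorm x ^+ 2 + W2 mu (delta0 R d) ^+ 2))
  (F_ge0 : forall t' t s : R,
    t' \in `[0, T] -> t \in `[0, T] -> s \in `[0, T] ->
    0 <= F1 t' t s /\ 0 <= F2 t' t s)
  (F_measurable : forall t' t : R, t' \in `[0, T] -> t \in `[0, T] ->
    measurable_fun `[0, t] (F1 t' t) /\ measurable_fun `[0, t] (F2 t' t))
  (b_time : forall (t' t s : R) x mu,
    t' \in `[0, T] -> t \in `[0, T] -> s \in `[0, T] ->
    hsnorm (b t' s x mu - b t s x mu) <=
    F1 t' t s * (1 + hsnorm x + W2 mu (delta0 R d)))
  (sigma_time : forall (t' t s : R) x mu,
    t' \in `[0, T] -> t \in `[0, T] -> s \in `[0, T] ->
    hsnorm (sigma t' s x mu - sigma t s x mu) ^+ 2 <=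
    F2 t' t s * (1 + hsnorm x ^+ 2 + W2 mu (delta0 R d) ^+ 2))
  (F1_regular : forall t' t : R, t' \in `[0, T] -> t \in `[0, T] ->
    (\int[lebesgue_measure]_(s in `[0%R, t]) (F1 t' t s)%:E
      <= (C * `|t - t'| `^ gamma)%:E)%E)
  (F2_regular : forall t' t : R, t' \in `[0, T] -> t \in `[0, T] ->
    (\int[lebesgue_measure]_(s in `[0%R, t]) (F2 t' t s)%:E
      <= (C * `|t - t'| `^ (2 * gamma))%:E)%E)
  (X_solution : volterra_solution P F W T p b sigma X0 X L) :
  forall delta : R, 0 <= delta -> delta < gamma / 2 - 1 / p ->
    exists Y : R -> Omega -> 'cV[R]_d,
      modification P T X Y /\
      forall w, holder_continuous delta T (fun t => Y t w).
Proof.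
move=> delta delta0 deltalt.
have [p2 pg] : 2 < p /\ 2 / gamma < p by move: p_gt; rewrite gt_max => /andP[].
have p0 : 0 < p by lra.
(* The assumption [2 / gamma < p] is what makes the time exponent exceed 1 in Kolmogorov's
   criterion. *)
have b1 : 1 < gamma * (p / 2).
  by move: pg; rewrite ltr_pdivrMr// => pg; lra.
have [c c0 HX] := solution_increment_moment F_usual W_bm T_gt0 gamma_gt0 (ltW p2)
  X0_Lp K3_class K4_class K3_regular K4_regular b_growth sigma_growth F_ge0
  F_measurable b_time sigma_time F1_regular F2_regular X_solution.
(* The midpoint leaves room on both sides: below the Kolmogorov bound, and above [delta], so that it
   is positive even when [delta = 0]. *)
pose delta' := (delta + (gamma / 2 - 1 / p)) / 2.
have dd' : delta < delta' by rewrite /delta'; lra.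
have d'0 : 0 < delta' by exact: le_lt_trans dd'.
have d'b : delta' < (gamma * (p / 2) - 1) / p.
  have -> : (gamma * (p / 2) - 1) / p = gamma / 2 - 1 / p by field; rewrite gt_eqF.
  by rewrite /delta'; lra.
have mX t : 0 <= t -> t <= T -> measurable_fun setT (X t).
  move=> t0 tT; apply: measurable_wrt_fun (solution_adapted X_solution t0 tT).
  exact: (filtration_sub F_usual t0).
have /choice[Y HY] (i : 'I_d) := @kolmogorov_continuity _ _ _ P T p (gamma * (p / 2)) c
  (fun t w => X t w i 0) T_gt0 ltac:(lra) b1 c0
  (fun t ht => measurableT_comp (measurable_coord i 0)
     (mX t (andP ht).1 (andP ht).2))
  (fun s t s0 st tT => HX i s t s0 st tT) delta' d'0 d'b.
exists (fun t w => \col_i Y i t w); split.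
  move=> t t0 tT.
  have YX : {ae P, forall w, \col_i Y i t w = X t w}.
    have h : {ae P, forall w, forall i, Y i t w = X t w i 0}.
      by apply: filter_forall => i; have [/(_ t)[|//]] := HY i; rewrite t0.
    apply: filterS h => w h; apply/matrixP => i j; rewrite mxE (ord1 j); exact: h.
  by split => //; exact: (ae_eq_measurable_complete P_complete (mX t t0 tT) YX).
move=> w; apply: (holder_continuous_coordinates T_gt0 delta0 dd') => i.
have [_ /(_ w)[e He]] := HY i; exists e => s t s0 st tT.
by rewrite !mxE; exact: He.
Qed.
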